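(* For any integer $k\ge3$, any $q_1,\ldots,q_k\in[1,\infty)$ with $\sum_i\frac1{q_i}>1$, and any $\epsilon,K,C>0$, there exist $\delta,\tau>0$ such that the following holds. Let $(X_i,\mathbf{P}_i)$ be finite probability spaces and $f_i:X_i\times X_{i+1}\to[0,\infty)$, for $i\in\mathbf{Z}/k\mathbf{Z}$. Assume that for each $i$: (i) $\|f_i\|_{S^{q_i}}\le C$, and (ii) for any partitions $\mathcal{P}_i,\mathcal{P}_{i+1}$ of $X_i,X_{i+1}$ into parts with probabilities $\ge\tau$, one has $$\left\|f_i\mathbf{1}_{\mathbf{E}(f_i\mid\mathcal{P}_i\otimes\mathcal{P}_{i+1})>K}\right\|_{L^1}\le\epsilon/4.\qquad( * )$$ If additionally $$\mathbf{E}_{x_1,\ldots,x_k}\prod_{i=1}^kf_i(x_i,x_{i+1})\le\delta,\qquad( ** )$$ then there exist subsets $E_i\subset X_i\times X_{i+1}$ with $\|f_i\mathbf{1}_{E_i^c}\|_{L^1}\le\epsilon$ for each $i$, such that $$\mathbf{E}_{x_1,\ldots,x_k}\prod_{i=1}^k\mathbf{1}_{E_i}(x_i,x_{i+1})=0.$$ Moreover, if all $(X_i,\mathbf{P}_i)=(X,\mathbf{P})$ are equal, $\mathbf{P}$ is the uniform distribution, and $|X|$ is sufficiently large in terms of $k,q_1,\ldots,q_k,\epsilon,K,C$, then the same conclusion holds when condition (ii) is only assumed for $\mathcal{P}_i=\mathcal{P}_{i+1}$, and when $( ** )$ is replaced with $$\mathbf{E}_{x_1,\ldots,x_k}\mathbf{1}_{x_1,\ldots,x_k\text{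 distinct}}\prod_{i=1}^kf_i(x_i,x_{i+1})\le\delta.$$ If additionally all $f_i=f$ are equal, then one can also replace $( * )$ with $$\left\|f\,\mathbf{1}_{\mathbf{E}(f\mid\mathcal{P}\otimes\mathcal{P})>K}\,\mathbf{1}_{\mathrm{diag}(\mathcal{P})^c}\right\|_{L^1}\le\epsilon/8$$ (for any partition $\mathcal{P}$ of $X$ into parts with probabilities $\ge\tau$).
   Context: Indices are modulo $k$ ($X_{k+1}=X_1$, $x_{k+1}=x_1$). Finite probability spaces carry the full $\sigma$-algebra, products carry product measures, and in $\mathbf{E}_{x_1,\ldots,x_k}$ the $x_i$ are sampled independently from $(X_i,\mathbf{P}_i)$. For finite probability spaces $(X,\mathbf{P}_X),(Y,\mathbf{P}_Y)$ and $f:X\times Y\to\mathbf{C}$, $\|f\|_{L^1}:=\mathbf{E}_{x,y}|f(x,y)|$, and $\|f\|_{S^q}$ is the $\ell^q$ norm of the singular values of the $|X|\times|Y|$ matrix with $(x,y)$ entry $f(x,y)\sqrt{\mathbf{P}_X(x)\mathbf{P}_Y(y)}$. For partitions $\mathcal{P}$ of $X$ and $\mathcal{Q}$ of $Y$, $\mathcal{P}\otimes\mathcal{Q}:=\{A\times B:A\in\mathcal{P},B\in\mathcal{Q}\}$, $\mathbf{E}(f\mid\mathcal{P}\otimes\mathcal{Q})$ is the function equal on each part $A\times B$ to $\mathbf{E}[f\mathbf{1}_{A\times B}]/(\mathbf{P}_X(A)\mathbf{P}_Y(B))$, and $\mathbf{1}_{\mathbf{E}(f\mid\cdot)>K}$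 is the indicator function of the set where it exceeds $K$. $\mathrm{diag}(\mathcal{P}):=\bigcup_{A\in\mathcal{P}}(A\times A)\subset X\times X$. $E^c$ denotes the complement of $E$. *)

(* Defs.v *)
From mathcomp Require Export all_boot all_order all_algebra complex.
From mathcomp Require Export reals exp.

Set Implicit Arguments.
Unset Strict Implicit.
Unset Printing Implicit Defensive.

Import Order.TTheory GRing.Theory Num.Theory.

#[local] Open Scope ring_scope.
#[local] Open Scope complex_scope.
#[local] Open Scope sesquilinear_scope.

(* Atoms of mass zero are allowed. *)
Record finProbSpace (R : realType) := FinProbSpace {
  carrier :> finType;
  mass : carrier -> R;
  mass_ge0 : forall x, 0 <= mass x;
  mass_sum1 : \sum_x mass x = 1 }.

Arguments mass {R X} x : rename.

Definition prob (R : realType) (X : finProbSpace R) (A : {set X}) : R :=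
  \sum_(x in A) mass x.

Definition expect (R : realType) (X : finProbSpace R) (g : X -> R) : R :=
  \sum_x mass x * g x.

Definition uniform (R : realType) (X : finProbSpace R) : Prop :=
  forall x : X, mass x = #|X|%:R^-1.

Section Product.
Variables (R : realType) (X Y : finProbSpace R).

Definition prod_mass (z : X * Y) : R := mass z.1 * mass z.2.

Fact prod_mass_ge0 z : 0 <= prod_mass z.
Proof. by rewrite mulr_ge0 ?mass_ge0. Qed.

Fact prod_mass_sum1 : \sum_z prod_mass z = 1.
Proof.
rewrite -(pair_bigA _ (fun x y => mass x * mass y)) /=.
by under eq_bigr do rewrite -mulr_sumr mass_sum1 mulr1; exact: mass_sum1.
Qed.

Definition prod_space := FinProbSpace prod_mass_ge0 prod_mass_sum1.

End Product.

Section FamilyProduct.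
Variables (R : realType) (I : finType) (X : I -> finProbSpace R).

Definition pi_mass (x : {dffun forall i, X i}) : R := \prod_i mass (x i).

Fact pi_mass_ge0 x : 0 <= pi_mass x.
Proof. by apply: prodr_ge0 => i _; exact: mass_ge0. Qed.

Fact pi_mass_sum1 : \sum_x pi_mass x = 1.
Proof.
rewrite (reindex (@dffun_of_fprod I X)) /=; last first.
  exact/onW_bij/dffun_of_fprod_bij.
pose P i : {ffun X i -> R} := [ffun a => mass a].
transitivity (\sum_(t : fprod X) \prod_(i in I) P i (t i)).
  by apply: eq_bigr => t _; apply: eq_bigr => i _; rewrite !ffunE.
rewrite (big_fprod _ _ P) -(bigA_distr_big_dep _ (fun i j => untag 0 (P i) j)).
apply: big1 => i _; rewrite -(big_tag (fun i a => P i a)).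
by under eq_bigr do rewrite ffunE; exact: mass_sum1.
Qed.

Definition pi_space := FinProbSpace pi_mass_ge0 pi_mass_sum1.

End FamilyProduct.

Section TwoVariables.
Variables (R : realType) (X Y : finProbSpace R).
Implicit Type f : X * Y -> R.

Definition L1norm f : R := expect (X := prod_space X Y) (fun z => `|f z|).

Definition cond_exp f (P : {set {set X}}) (Q : {set {set Y}}) (z : X * Y) : R :=
  let A := pblock P z.1 in
  let B := pblock Q z.2 in
  expect (X := prod_space X Y) (fun w => f w * (w \in setX A B)%:R)
    / (prob A * prob B).

Definition weighted_mx f : 'M[R[i]]_(#|X|, #|Y|) :=
  \matrix_(i, j) (f (enum_val i, enum_val j)
                  * Num.sqrt (mass (enum_val i) * mass (enum_val j)))%:C.

End TwoVariables.

(* The square roots of the eigenvalues, with multiplicity, of the Hermitian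
   matrix M^* M: these are the singular values of M, up to the number of zeros
   in the list, which does not matter below. *)
Definition singular_value (R : realType) (m n : nat) (M : 'M[R[i]]_(m, n))
    (j : 'I_n) : R :=
  Num.sqrt (complex.Re (spectral_diag (M^t* *m M) 0 j)).

Definition schatten (R : realType) (q : R) (X Y : finProbSpace R)
    (f : X * Y -> R) : R :=
  (\sum_j singular_value (weighted_mx f) j `^ q) `^ q^-1.

Definition partition_ge (R : realType) (tau : R) (X : finProbSpace R)
    (P : {set {set X}}) : Prop :=
  partition P [set: X] /\ forall A, A \in P -> tau <= prob A.

Definition diag (T : finType) (P : {set {set T}}) : {set T * T} :=
  \bigcup_(A in P) setX A A.

(* [ordS] is the cyclic successor on 'I_k, so 'I_k plays the role of Z/kZ. *)
Definition cycle_mean (R : realType) (k : nat) (X : 'I_k -> finProbSpace R)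
    (f : forall i, X i * X (ordS i) -> R) : R :=
  expect (X := pi_space X) (fun x => \prod_i f i (x i, x (ordS i))).

Definition distinct_cycle_mean (R : realType) (k : nat) (X : finProbSpace R)
    (f : 'I_k -> X * X -> R) : R :=
  expect (X := pi_space (fun _ : 'I_k => X))
    (fun x => (injectiveb x)%:R * \prod_i f i (x i, x (ordS i))).

(* Main.v *)
Require Import Defs.
From mathcomp Require Import ring lra zify.

(** The proof is a removal lemma driven by the spectrum of the kernels.

    Weight each f_i by the square roots of the masses, so that it becomes an
    operator F_i on unweighted l^2; the cycle mean is then the trace of the
    product of the F_i, written [cyc].  Grouping singular values dyadically
    writes F_i as a sum of layers, layer m having operator norm at most
    C / 2^m and rank of order 2^(q_i m) ([schatten_tame]).  The trace of a
    product is at most the product of the norms times any one of the ranks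
    ([cyc_flat]); taking a weighted geometric mean of these k bounds, which is
    where sum 1/q_i > 1 is used, makes the contribution of a choice of layers
    decay geometrically in every layer index ([layers_decay_exponents]).  So the
    low layers are negligible in the trace ([cyc_tail]), and this survives
    restriction to sets and conditional expectation, which are contractions.

    The top layers are boundedly many rank-one terms.  Off a small set their
    vectors are bounded multiples of the square root of the mass, and
    partitioning by rounded values makes them nearly constant on cells.  Hence
    for any fine enough partition q', on the good set, F_i may be replaced in the
    trace by its conditional expectation on q' ([count_approx]).

    Refine partitions in this way again and again.  The energy, which is the
    integral of 1 / (1 + average of f_i), is bounded and increases under
    refinement, so at some stage q' refines q with almost no gain for any i
    ([removal_step]).  Then wherever the average of f_i over q is neither small nor
    large, the average over q' is rarely much below it.  The edges
    that are kept lie in pairs of non-tiny q-cells where the q-average is neither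
    too small nor too large and where the q'-average is rarely low
    ([edge_set]).  Deleting the other edges costs little ([edge_set_mass]): the
    hypothesis on conditional expectations controls the pairs with a large
    average, once tiny cells have been merged into big ones ([merge_tiny]).  If a
    cycle of kept edges existed, the q'-averages would be bounded below on most
    of the product of its k cells, and so would the cycle mean, even when the
    cells are replaced by subsets of relative size 1/(2k) ([edge_set_count]).

    All cases are instances of one statement about a single finite measure space
    ([removal_core]).  Different spaces X_i are put side by side in a disjoint
    union.  For tuples of distinct points, the cells of the cycle are replaced by
    pairwise disjoint subsets.  When the diagonal cells are excluded from the
    hypothesis, one starts from a partition into cells of small mass: the
    spectral bound forces little mass on their diagonal blocks
    ([mass_diagonal]). *)

Set Implicit Arguments.
Unset Strict Implicit.
Unset Printing Implicit Defensive.

Import Order.TTheory GRing.Theory Num.Theory.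

#[local] Open Scope ring_scope.

(** * Kernels of small norm and rank *)

Lemma le_of_eq (R : numDomainType) (x y : R) : x = y -> x <= y.
Proof. by move->. Qed.

Section Kernels.
Variable R : realType.

Definition norm2 (X : finType) (a : X -> R) : R := \sum_x a x ^+ 2.

Definition act (X Y : finType) (G : X -> Y -> R) (b : Y -> R) (x : X) : R :=
  \sum_y G x y * b y.

(** Operator norm at most s, squared so that no square root is carried along. *)
Definition op_bound (X Y : finType) (s : R) (G : X -> Y -> R) : Prop :=
  forall b, norm2 (act G b) <= s ^+ 2 * norm2 b.

Definition rank_bound (X Y : finType) (s : R) (N : nat) (G : X -> Y -> R) :=
  exists (a : nat -> X -> R) (b : nat -> Y -> R),
    [/\ forall l, norm2 (a l) <= s ^+ 2, forall l, norm2 (b l) <= 1 &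
        forall x y, G x y = \sum_(l < N) a l x * b l y].

(** The building block of the proof: the trace of a product containing a flat kernel
    is controlled by its rank and by the operator norms alone. *)
Definition flat (X Y : finType) (s : R) (N : nat) (G : X -> Y -> R) : Prop :=
  op_bound s G /\ rank_bound s N G.

Lemma norm2_ge0 (X : finType) (a : X -> R) : 0 <= norm2 a.
Proof. by apply: sumr_ge0 => x _; exact: sqr_ge0. Qed.

Lemma cauchy_schwarz (X : finType) (P : pred X) (a b : X -> R) :
  (\sum_(x | P x) a x * b x) ^+ 2 <=
  (\sum_(x | P x) a x ^+ 2) * (\sum_(x | P x) b x ^+ 2).
Proof.
set A := \sum_(x | P x) a x ^+ 2; set B := \sum_(x | P x) b x ^+ 2.
set D := \sum_(x | P x) a x * b x.
have A0 : 0 <= A by apply: sumr_ge0 => x _; exact: sqr_ge0.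
have B0 : 0 <= B by apply: sumr_ge0 => x _; exact: sqr_ge0.
have quad t : 0 <= A - 2 * t * D + t ^+ 2 * B.
  have -> : A - 2 * t * D + t ^+ 2 * B = \sum_(x | P x) (a x - t * b x) ^+ 2.
    rewrite /A /D /B !mulr_sumr -sumrB -big_split /=.
    by apply: eq_bigr => x _; ring.
  by apply: sumr_ge0 => x _; exact: sqr_ge0.
have [B00|B00] := eqVneq B 0.
  suff -> : D = 0 by rewrite expr0n /= B00 mulr0.
  have := B00; move/eqP; rewrite psumr_eq0; last by move=> x _; exact: sqr_ge0.
  move=> /allP b0; apply: big1 => x Px.
  by have := b0 x (mem_index_enum x); rewrite Px sqrf_eq0 => /eqP ->; rewrite mulr0.
have Bp : 0 < B by rewrite lt_def B00.
have := quad (D / B).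
have -> : A - 2 * (D / B) * D + (D / B) ^+ 2 * B = A - D ^+ 2 / B by field.
by rewrite subr_ge0 ler_pdivrMr.
Qed.

Lemma norm2_dot (X : finType) (a b : X -> R) :
  (\sum_x a x * b x) ^+ 2 <= norm2 a * norm2 b.
Proof. exact: cauchy_schwarz. Qed.

Lemma sqr_le_norm (x y : R) : 0 <= y -> x ^+ 2 <= y ^+ 2 -> `|x| <= y.
Proof.
by move=> y0; rewrite -[x ^+ 2]real_normK ?num_real // ler_pXn2r ?nnegrE.
Qed.

Lemma op_bound_form (X Y : finType) s (G : X -> Y -> R) a b :
  op_bound s G ->
  (\sum_x \sum_y a x * G x y * b y) ^+ 2 <= s ^+ 2 * (norm2 a * norm2 b).
Proof.
move=> Gs.
have -> : \sum_x \sum_y a x * G x y * b y = \sum_x a x * act G b x.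
  by apply: eq_bigr => x _; rewrite mulr_sumr; apply: eq_bigr => y _; rewrite mulrA.
apply: le_trans (norm2_dot _ _) _.
rewrite mulrCA; apply: ler_wpM2l; [exact: norm2_ge0 | exact: Gs].
Qed.

(** Symmetry makes one hypothesis serve for multiplication on either side. *)
Definition sym_contraction (X : finType) (U : X -> X -> R) : Prop :=
  (forall x y, U x y = U y x) /\ op_bound 1 U.

Definition sandwich (X Y : finType) (U : X -> X -> R) (V : Y -> Y -> R)
    (G : X -> Y -> R) (x : X) (y : Y) : R :=
  \sum_u \sum_v U x u * G u v * V v y.

Lemma act_sandwich (X Y : finType) (U : X -> X -> R) (V : Y -> Y -> R) G b x :
  act (sandwich U V G) b x = act U (act G (act V b)) x.
Proof.
rewrite /act /sandwich.
under eq_bigr do rewrite mulr_suml.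
rewrite exchange_big; apply: eq_bigr => u _ /=.
rewrite mulr_sumr.
under eq_bigr do rewrite mulr_suml.
rewrite exchange_big; apply: eq_bigr => v _ /=.
by rewrite !mulr_sumr; apply: eq_bigr => y _; rewrite !mulrA.
Qed.

Lemma eq_norm2 (X : finType) (a b : X -> R) : a =1 b -> norm2 a = norm2 b.
Proof. by move=> ab; apply: eq_bigr => x _; rewrite ab. Qed.

(** Both restriction to sets and conditional expectation are of this form, so that
    whatever is proved for flat kernels survives these operations at no cost. *)
Lemma flat_sandwich (X Y : finType) s N (U : X -> X -> R) (V : Y -> Y -> R) G :
  sym_contraction U -> sym_contraction V -> flat s N G ->
  flat s N (sandwich U V G).
Proof.
move=> [Us U1] [Vs V1] [Gs [a [b [an bn Gab]]]]; split.
  move=> c; rewrite (eq_norm2 (act_sandwich U V G c)).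
  apply: le_trans (U1 _) _; rewrite expr1n mul1r.
  apply: le_trans (Gs _) _; rewrite ler_wpM2l ?sqr_ge0 //.
  by apply: le_trans (V1 _) _; rewrite expr1n mul1r.
exists (fun l => act U (a l)), (fun l => act V (b l)); split.
- by move=> l; apply: le_trans (U1 _) _; rewrite expr1n mul1r.
- by move=> l; apply: le_trans (V1 _) _; rewrite expr1n mul1r.
move=> x y; rewrite /sandwich /act.
under eq_bigr do under eq_bigr do rewrite Gab mulr_sumr mulr_suml.
under eq_bigr do rewrite exchange_big.
rewrite exchange_big; apply: eq_bigr => l _ /=.
rewrite mulr_suml; apply: eq_bigr => u _; rewrite mulr_sumr.
by apply: eq_bigr => v _; rewrite (Vs y v); ring.
Qed.

Lemma flat0 (X Y : finType) s N (G : X -> Y -> R) :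
  (forall x y, G x y = 0) -> flat s N G.
Proof.
move=> G0.
have n0 (Z : finType) : norm2 (fun _ : Z => 0) = 0.
  by rewrite /norm2 big1 // => x _; rewrite expr0n.
split.
  move=> b; rewrite (@eq_norm2 _ _ (fun=> 0)) ?n0.
    by rewrite mulr_ge0 ?sqr_ge0 ?norm2_ge0.
  by move=> x; rewrite /act big1 // => y _; rewrite G0 mul0r.
exists (fun _ _ => 0), (fun _ _ => 0); split => [l|l|x y]; rewrite ?n0 ?sqr_ge0 ?ler01 //.
by rewrite G0 big1 // => l _; rewrite mulr0.
Qed.

End Kernels.

(** * Pieces of the singular value decomposition *)

Section SVD.
Local Open Scope complex_scope.
Local Open Scope sesquilinear_scope.
Variable R : realType.

Definition sqabs (z : R[i]) : R := complex.Re z ^+ 2 + complex.Im z ^+ 2.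

Lemma sqabs_ge0 z : 0 <= sqabs z.
Proof. by rewrite addr_ge0 ?sqr_ge0. Qed.

Lemma Re_sum (I : Type) (r : seq I) (P : pred I) (F : I -> R[i]) :
  complex.Re (\sum_(i <- r | P i) F i) = \sum_(i <- r | P i) complex.Re (F i).
Proof. exact: (raddf_sum (@complex.Re R : Rcomplex R -> R)). Qed.

Lemma sq_norm_vec n (v : 'cV[R[i]]_n) :
  complex.Re ((v^t* *m v) 0 0) = \sum_j sqabs (v j 0).
Proof.
rewrite mxE Re_sum; apply: eq_bigr => j _; rewrite !mxE /sqabs.
by case: (v j 0) => a b /=; ring.
Qed.

Variables (m n : nat) (N : 'M[R]_(m, n)).
Let M : 'M[R[i]]_(m, n) := \matrix_(i, j) (N i j)%:C.
Let H := M^t* *m M.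
Let P := spectralmx H.
Let d := spectral_diag H.
Let W := M *m P^t*.

Let P_unitary : P *m P^t* = 1%:M.
Proof. exact/unitarymxP/spectral_unitarymx. Qed.

Let P_unitary' : P^t* *m P = 1%:M.
Proof. exact: mulmx1C. Qed.

Let H_normal : H \is normalmx.
Proof.
apply: hermitian_normalmx; rewrite is_hermitianmxE expr0 scale1r.
by rewrite /H trmx_mul map_mxM trmxCK.
Qed.

Let WtW : W^t* *m W = diag_mx d.
Proof.
rewrite /W trmx_mul map_mxM trmxCK !mulmxA -(mulmxA P) -/H.
have /orthomx_spectralP -> := H_normal; rewrite -/P -/d.
rewrite invmx_unitary ?spectral_unitarymx // -/P.
by rewrite !mulmxA P_unitary mul1mx -mulmxA P_unitary mulmx1.
Qed.

Let MWP : W *m P = M.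
Proof. by rewrite /W -mulmxA P_unitary' mulmx1. Qed.

Let sv := singular_value M.

Let sq_norm_W (c : 'cV[R[i]]_n) :
  \sum_x sqabs ((W *m c) x 0) = \sum_j sv j ^+ 2 * sqabs (c j 0).
Proof.
have dE j : d 0 j = (\sum_x sqabs (W x j))%:C.
  have /matrixP/(_ j j) := WtW; rewrite [RHS]mxE eqxx mulr1n => <-.
  rewrite mxE rmorph_sum; apply: eq_bigr => x _; rewrite !mxE /sqabs.
  case: (\sum__ _) => a b; apply/eqP; rewrite eq_complex /=.
  by apply/andP; split; apply/eqP; ring.
rewrite -sq_norm_vec trmx_mul map_mxM -mulmxA (mulmxA (W^t*)) WtW.
rewrite mxE Re_sum; apply: eq_bigr => j _.
rewrite mul_diag_mx !mxE /sv /singular_value -/H -/d dE sqr_sqrtr /=; last first.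
  by apply: sumr_ge0 => x _; exact: sqabs_ge0.
by rewrite /sqabs; case: (c j 0) => a b /=; ring.
Qed.

Let sq_norm_P (b : 'cV[R[i]]_n) :
  \sum_j sqabs ((P *m b) j 0) = \sum_j sqabs (b j 0).
Proof.
by rewrite -!sq_norm_vec trmx_mul map_mxM -mulmxA (mulmxA (P^t*)) P_unitary' mul1mx.
Qed.

(** With M^* M = P^* D P and W = M P^*, the columns of W are orthogonal with the
    singular values as norms, and M = W P.  Keeping the columns in J and taking the
    real part gives a real kernel, because M is real; the price is a factor 2 in the
    rank. *)
Definition svd_part (J : pred 'I_n) (x : 'I_m) (y : 'I_n) : R :=
  complex.Re (\sum_(j | J j) W x j * P j y).

Lemma svd_part_all x y : svd_part predT x y = N x y.
Proof.
rewrite /svd_part; have /matrixP/(_ x y) := MWP; rewrite mxE => ->.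
by rewrite mxE.
Qed.

Let unitv j : 'cV[R[i]]_n := delta_mx j 0.

Let norm_Wcol j : \sum_x sqabs (W x j) = sv j ^+ 2.
Proof.
transitivity (\sum_x sqabs ((W *m unitv j) x 0)).
  by apply: eq_bigr => x _; rewrite /unitv -colE [col _ _ _ _]mxE.
rewrite sq_norm_W (bigD1 j) //= big1 => [|i ij].
  by rewrite mxE !eqxx /sqabs /= expr0n expr1n !addr0 mulr1.
by rewrite mxE (negPf ij) /sqabs /= expr0n addr0 mulr0.
Qed.

Let norm_Prow j : \sum_y sqabs (P j y) = 1.
Proof.
have /matrixP/(_ j j) := P_unitary; rewrite !mxE eqxx => /(congr1 (@complex.Re R)).
rewrite Re_sum /= => <-; apply: eq_bigr => y _; rewrite !mxE /sqabs.
by case: (P j y) => a b /=; ring.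
Qed.

Lemma svd_part_null (J : pred 'I_n) x y :
  (forall j, J j -> sv j = 0) -> svd_part J x y = 0.
Proof.
move=> J0; rewrite /svd_part big1 // => j Jj.
have /eqP := norm_Wcol j; rewrite J0 // expr0n /= psumr_eq0; last first.
  by move=> i _; exact: sqabs_ge0.
move=> /allP/(_ x (mem_index_enum x)) /=.
rewrite /sqabs paddr_eq0 ?sqr_ge0 // !sqrf_eq0 => /andP[/eqP a0 /eqP b0].
by case: (W x j) a0 b0 => a b /= -> ->; rewrite mul0r.
Qed.

(** Parseval twice: P preserves norms, and the columns of W in J are orthogonal with
    norms at most s.  Taking real parts only decreases the norm. *)
Lemma svd_part_op (J : pred 'I_n) s : 0 <= s -> (forall j, J j -> sv j <= s) ->
  op_bound s (svd_part J).
Proof.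
move=> s0 Js b.
pose bc : 'cV[R[i]]_n := \col_y (b y)%:C.
pose c : 'cV[R[i]]_n := \col_j (if J j then (P *m bc) j 0 else 0).
have actE x : act (svd_part J) b x = complex.Re ((W *m c) x 0).
  rewrite /act mxE.
  transitivity (complex.Re (\sum_y (\sum_(j | J j) W x j * P j y) * (b y)%:C)).
    rewrite Re_sum; apply: eq_bigr => y _; rewrite /svd_part.
    by case: (\sum_(j | J j) _) => u v /=; ring.
  congr complex.Re; under eq_bigr do rewrite mulr_suml.
  rewrite exchange_big /= [RHS]big_mkcond /= [LHS]big_mkcond.
  apply: eq_bigr => j _; rewrite [c j 0]mxE; case: ifP => _; last by rewrite mulr0.
  rewrite [(P *m bc) j 0]mxE mulr_sumr; apply: eq_bigr => y _; rewrite [bc y 0]mxE.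
  by rewrite mulrA.
apply: (@le_trans _ _ (\sum_x sqabs ((W *m c) x 0))).
  by apply: ler_sum => x _; rewrite actE /sqabs lerDl sqr_ge0.
rewrite sq_norm_W.
apply: (@le_trans _ _ (\sum_j s ^+ 2 * sqabs ((P *m bc) j 0))).
  apply: ler_sum => j _; rewrite [c j 0]mxE; case: ifP => [Jj|_].
    rewrite ler_wpM2r ?sqabs_ge0 // ler_pXn2r ?nnegrE ?Js //.
    by rewrite sqrtr_ge0.
  by rewrite {1}/sqabs /= expr0n addr0 mulr0 mulr_ge0 ?sqr_ge0 ?sqabs_ge0.
rewrite -mulr_sumr sq_norm_P ler_wpM2l ?sqr_ge0 //.
apply: ler_sum => y _; rewrite mxE /sqabs /= expr0n addr0; exact: lexx.
Qed.

(** The real part of a product of complex numbers is a difference of two products of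
    real numbers; the boolean says which of the two is meant. *)
Lemma svd_part_decomp (J : pred 'I_n) s :
  0 <= s -> (forall j, J j -> sv j <= s) ->
  exists (a : 'I_n * bool -> 'I_m -> R) (b : 'I_n * bool -> 'I_n -> R),
    [/\ forall l, J l.1 -> norm2 (a l) <= s ^+ 2,
        forall l, norm2 (b l) <= 1 &
        forall x y, svd_part J x y = \sum_(l | J l.1) a l x * b l y].
Proof.
move=> s0 Js.
exists (fun l x => if l.2 then complex.Re (W x l.1) else - complex.Im (W x l.1)).
exists (fun l y => if l.2 then complex.Re (P l.1 y) else complex.Im (P l.1 y)).
split.
- move=> [j e] /= Jj; apply: (@le_trans _ _ (sv j ^+ 2)); last first.
    by rewrite ler_pXn2r ?nnegrE ?Js // sqrtr_ge0.
  rewrite -norm_Wcol; apply: ler_sum => x _; rewrite /sqabs.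
  by case: e; rewrite ?sqrrN ?lerDl ?lerDr sqr_ge0.
- move=> [j e] /=; rewrite -(norm_Prow j); apply: ler_sum => y _; rewrite /sqabs.
  by case: e; rewrite ?lerDl ?lerDr sqr_ge0.
- move=> x y; rewrite /svd_part Re_sum.
  under [RHS]eq_bigl => l do rewrite -[J l.1]andbT.
  rewrite -(pair_big_dep J (fun _ _ => true)
    (fun j (e : bool) => (if e then complex.Re (W x j) else - complex.Im (W x j)) *
      (if e then complex.Re (P j y) else complex.Im (P j y)))) /=.
  apply: eq_bigr => j _; rewrite big_bool /=.
  by case: (W x j) => a b; case: (P j y) => a' b' /=; ring.
Qed.

End SVD.

(** * Dyadic layers *)

Section Tame.
Variable R : realType.

(** After the singular value decomposition, this is the only form in which the
    Schatten norm is used. *)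
Definition tame (X Y : finType) (C : R) (N : nat -> nat) (F : X -> Y -> R) :=
  exists (M : nat) (G : nat -> X -> Y -> R),
    (forall x y, F x y = \sum_(m < M) G m x y) /\
    forall m, flat (C / 2 ^+ m) (N m) (G m).

(** Ranks are indexed by initial segments of nat; any index type that is small enough
    is one of them after padding by zero vectors. *)
Lemma rank_bound_fin (X Y L : finType) (J : pred L) s N (G : X -> Y -> R)
    (a : L -> X -> R) (b : L -> Y -> R) :
  (#|[set l | J l]| <= N)%N ->
  (forall l, J l -> norm2 (a l) <= s ^+ 2) -> (forall l, norm2 (b l) <= 1) ->
  (forall x y, G x y = \sum_(l | J l) a l x * b l y) -> rank_bound s N G.
Proof.
move=> JN an bn Gab.
pose D := [set l | J l].
pose val_at (Z : finType) (c : L -> Z -> R) (l : nat) (z : Z) : R :=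
  if insub l is Some i then c (enum_val (i : 'I_#|D|)) z else 0.
have n0 (Z : finType) : norm2 (fun _ : Z => 0 : R) = 0.
  by rewrite /norm2 big1 // => x _; rewrite expr0n.
exists (val_at X a), (val_at Y b); split.
- move=> l; rewrite /val_at; case: insub => [i|]; last by rewrite n0 sqr_ge0.
  by apply: an; have := enum_valP i; rewrite inE.
- by move=> l; rewrite /val_at; case: insub => [i|]; [exact: bn | rewrite n0 ler01].
move=> x y; rewrite Gab.
rewrite (eq_bigl (mem D)); last by move=> l; rewrite /= inE.
rewrite big_enum_val /=.
rewrite -(subnK JN) addnC.
rewrite big_split_ord /= [X in _ = _ + X]big1 ?addr0; last first.
  by move=> i _; rewrite /val_at insubF ?mul0r // ltnNge leq_addr.
apply: eq_bigr => i _; rewrite /val_at.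
by rewrite valK.
Qed.

Lemma sum_enum_rank (X : finType) (h : 'I_#|X| -> R) :
  \sum_x h (enum_rank x) = \sum_i h i.
Proof. by rewrite [RHS](reindex (@enum_rank X)) //; exact/onW_bij/enum_rank_bij. Qed.

Section Schatten.
Local Open Scope complex_scope.
Variables (X Y : finProbSpace R) (f : X * Y -> R) (q C : R).
Hypotheses (q0 : 0 < q) (C0 : 0 < C) (fC : schatten q f <= C).

(** With these weights the operator acts on unweighted l^2, and atoms of mass zero
    drop out. *)
Definition weighted_kernel (x : X) (y : Y) : R :=
  f (x, y) * Num.sqrt (mass x * mass y).

Definition layer_rank (q : R) (m : nat) : nat :=
  Num.trunc (2 * 2 `^ (q * m.+1%:R)).

Let N : 'M[R]_(#|X|, #|Y|) :=
  \matrix_(i, j) weighted_kernel (enum_val i) (enum_val j).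

Let sv := singular_value (weighted_mx f).

Let sv_ge0 j : 0 <= sv j. Proof. exact: sqrtr_ge0. Qed.

Let weighted_mxE : weighted_mx f = \matrix_(i, j) (N i j)%:C.
Proof. by apply/matrixP => i j; rewrite !mxE. Qed.

Let sum_sv : \sum_j sv j `^ q <= C `^ q.
Proof.
have S0 : 0 <= \sum_j sv j `^ q by apply: sumr_ge0 => j _; exact: powR_ge0.
rewrite -[leLHS](powRr1 S0) -(mulVf (lt0r_neq0 q0)) powRrM.
by apply: ge0_ler_powR; rewrite ?nnegrE ?powR_ge0 // ltW.
Qed.

Let count_sv (t : R) : 0 < t ->
  #|[set j | C * t < sv j]|%:R <= t^-1 `^ q.
Proof.
move=> t0; have Ct0 : 0 < C * t by rewrite mulr_gt0.
suff: #|[set j | C * t < sv j]|%:R * (C * t) `^ q <= C `^ q.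
  rewrite powRM ?(ltW C0) ?(ltW t0) // mulrCA -[leRHS]mulr1 ler_pM2l ?powR_gt0 //.
  rewrite -ler_pdivlMr ?powR_gt0 // mul1r => /le_trans; apply.
  by rewrite -powR_inv1 ?(ltW t0) // powRAC powR_inv1 ?powR_ge0.
apply: le_trans sum_sv.
rewrite mulr_natl -sumr_const [leRHS](bigID (mem [set j | C * t < sv j])) /=.
apply: ler_wpDr; first by apply: sumr_ge0 => j _; exact: powR_ge0.
apply: ler_sum => j; rewrite inE => ltj.
by apply: ge0_ler_powR; rewrite ?nnegrE ?(ltW q0) ?(ltW Ct0) ?sv_ge0 ?(ltW ltj).
Qed.

Let sv_le j : sv j <= C.
Proof.
have : sv j `^ q <= C `^ q.
  apply: le_trans sum_sv; rewrite (bigD1 j) //= lerDl.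
  by apply: sumr_ge0 => i _; exact: powR_ge0.
apply: contraTT; rewrite -!ltNge => lt.
by apply: gt0_ltr_powR; rewrite ?nnegrE ?(ltW C0) ?sv_ge0.
Qed.

Let layer (m : nat) : pred 'I_#|Y| :=
  fun j => (C / 2 ^+ m.+1 < sv j) && (sv j <= C / 2 ^+ m).

Let part (m : nat) (x : X) (y : Y) : R :=
  svd_part N (layer m) (enum_rank x) (enum_rank y).

Let C2_ge0 m : 0 <= C / 2 ^+ m.
Proof. by rewrite divr_ge0 ?exprn_ge0 ?(ltW C0). Qed.

Let svE j : singular_value (\matrix_(i, j) (N i j)%:C) j = sv j.
Proof. by rewrite /sv weighted_mxE. Qed.

Let part_flat m : flat (C / 2 ^+ m) (layer_rank q m) (part m).
Proof.
have layP j : layer m j -> singular_value (\matrix_(i, j) (N i j)%:C) j <= C / 2 ^+ m.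
  by rewrite svE => /andP[].
split.
  move=> b; have := svd_part_op (C2_ge0 m) layP (fun j => b (enum_val j)).
  rewrite /norm2 -!sum_enum_rank.
  under [X in _ <= _ * X -> _]eq_bigr do rewrite enum_rankK.
  apply: le_trans; apply: ler_sum => x _; rewrite /act -sum_enum_rank.
  by under [X in _ <= X ^+ _]eq_bigr do rewrite enum_rankK.
have [a [b [an bn ab]]] := svd_part_decomp (C2_ge0 m) layP.
apply: (@rank_bound_fin _ _ _ (fun l => layer m l.1) _ _ _
   (fun l x => a l (enum_rank x)) (fun l y => b l (enum_rank y))).
- rewrite /layer_rank.
  have -> : [set l : 'I_#|Y| * bool | layer m l.1] =
    setX [set j | layer m j] [set: bool] by apply/setP => -[j e]; rewrite !inE andbT.
  rewrite cardsX cardsT card_bool -[leqLHS](@natrK R); apply: le_truncn.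
  rewrite natrM mulrC ler_wpM2l // powRrM powR_mulrn ?powR_ge0 //.
  have -> : 2 `^ q ^+ m.+1 = ((2 ^+ m.+1)^-1)^-1 `^ q :> R.
    rewrite invrK -(powR_mulrn m.+1 (powR_ge0 2 q)) powRAC.
    by rewrite (powR_mulrn m.+1 (ler0n R 2)).
  apply: le_trans (count_sv _); last by rewrite invr_gt0 exprn_gt0.
  by rewrite ler_nat subset_leq_card //; apply/subsetP => j; rewrite !inE => /andP[].
- by move=> l Jl; rewrite /norm2 (sum_enum_rank (fun i => a l i ^+ 2)); exact: an.
- by move=> l; rewrite /norm2 (sum_enum_rank (fun i => b l i ^+ 2)); exact: bn.
- by move=> x y; rewrite /part ab.
Qed.

Let svd_partE (J : pred 'I_#|Y|) x y :
  svd_part N J x y = \sum_(j | J j) svd_part N (pred1 j) x y.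
Proof.
rewrite /svd_part Re_sum; apply: eq_bigr => j _.
by rewrite (big_pred1 j).
Qed.

(** Layer m consists of the singular values in (C / 2^(m+1), C / 2^m].  By the
    l^q bound every singular value is at most C and at most 2^(q(m+1)) of them exceed
    C / 2^(m+1).  The nonzero ones are finitely many, so finitely many layers
    exhaust them. *)
Lemma schatten_tame : tame C (layer_rank q) weighted_kernel.
Proof.
have lev j : exists m : nat, sv j = 0 \/ layer m j.
  have [sv0|svn0] := eqVneq (sv j) 0; first by exists 0%N; left.
  have svp : 0 < sv j by rewrite lt_def svn0 sv_ge0.
  have exm : exists m : nat, C / 2 ^+ m.+1 < sv j.
    exists (Num.bound (C / sv j)); rewrite ltr_pdivrMr ?exprn_gt0 // mulrC.
    rewrite -ltr_pdivrMr //; apply: upper_nthrootP; exact: leqnSn.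
  have [m mP min] := ex_minnP exm; exists m; right; rewrite /layer mP /=.
  case: m mP min => [|m] _ min; first by rewrite expr0 divr1.
  by rewrite leNgt; apply/negP => /min; rewrite ltnn.
(* A nonzero singular value lies in the first layer whose lower end it exceeds. *)
have [l lP] := fin_all_exists lev.
pose M := (\max_j l j).+1.
exists M, part; split => // x y.
have -> : weighted_kernel x y = svd_part N predT (enum_rank x) (enum_rank y).
  by rewrite svd_part_all mxE !enum_rankK.
rewrite svd_partE /=.
under [RHS]eq_bigr do rewrite /part svd_partE big_mkcond /=.
rewrite exchange_big; apply: eq_bigr => j _ /=.
have [sv0|layj] := lP j.
  have h0 : svd_part N (pred1 j) (enum_rank x) (enum_rank y) = 0.
    by apply: svd_part_null => i /eqP ->; rewrite svE.
  by rewrite h0 big1 // => m _; case: ifP.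
have ltlM : (l j < M)%N by rewrite ltnS (leq_bigmax j).
rewrite (bigD1 (Ordinal ltlM)) //= layj big1 ?addr0 // => m ml.
case: ifP => // /andP[lo hi]; case/andP: layj => lo' hi'.
have mono a b : (a < b)%N -> C / 2 ^+ b <= C / 2 ^+ a.+1.
  move=> ab; rewrite ler_wpM2l ?(ltW C0) // lef_pV2 ?posrE ?exprn_gt0 //.
  by rewrite ler_weXn2l // ler1n.
have [lt|lt|eq] := ltngtP m (l j).
- by have := le_lt_trans (le_trans hi' (mono _ _ lt)) lo; rewrite ltxx.
- by have := le_lt_trans (le_trans hi (mono _ _ lt)) lo'; rewrite ltxx.
- by move: ml; rewrite -val_eqE /= eq eqxx.
Qed.

End Schatten.
End Tame.

(** * Traces of products around a cycle *)

Section Cycle.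
Variables (R : realType) (Y : finType).
Implicit Types (a b h : Y -> R).

(** The trace of the product of the G i. *)
Definition cyc (k : nat) (G : 'I_k -> Y -> Y -> R) : R :=
  \sum_(x : {ffun 'I_k -> Y}) \prod_i G i (x i) (x (ordS i)).

Lemma cyc_rot k (G : 'I_k -> Y -> Y -> R) :
  cyc (fun i => G (ordS i)) = cyc G.
Proof.
rewrite /cyc.
pose h (x : {ffun 'I_k -> Y}) := [ffun i => x (ord_pred i)].
rewrite [RHS](reindex h) /=; last first.
  exists (fun x => [ffun i => x (ordS i)]) => x _.
    by apply/ffunP => i; rewrite !ffunE ordSK.
  by apply/ffunP => i; rewrite !ffunE ord_predK.
apply: eq_bigr => x _.
rewrite [RHS](reindex (@ordS k)) /=; last exact/onW_bij/ordS_bij.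
by apply: eq_bigr => i _; rewrite !ffunE !ordSK.
Qed.

Lemma eq_cyc k (G G' : 'I_k -> Y -> Y -> R) :
  (forall i x y, G i x y = G' i x y) -> cyc G = cyc G'.
Proof. by move=> GG'; apply: eq_bigr => x _; apply: eq_bigr. Qed.

(** The product of the first n kernels, applied to a vector. *)
Fixpoint chain (n : nat) (G : nat -> Y -> Y -> R) a : Y -> R :=
  if n is n'.+1 then act (G 0%N) (chain n' (fun i => G i.+1) a) else a.

Lemma chain_norm n (G : nat -> Y -> Y -> R) (s : nat -> R) a :
  (forall i, (i < n)%N -> op_bound (s i) (G i)) ->
  norm2 (chain n G a) <= (\prod_(i < n) s i) ^+ 2 * norm2 a.
Proof.
elim: n G s => [|n IHn] G s Gs /=; first by rewrite big_ord0 expr1n mul1r.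
apply: le_trans (Gs 0%N isT _) _.
rewrite big_ord_recl /= exprMn -(mulrA (s 0%N ^+ 2)) ler_wpM2l ?sqr_ge0 //.
by apply: (IHn (fun i => G i.+1) (fun i => s i.+1)) => i ni; exact: Gs.
Qed.

(** Summing out the vertices of a path from its far end is repeated application of the
    kernels to a vector. *)
Lemma path_sum n (G : nat -> Y -> Y -> R) h a :
  \sum_(x : {ffun 'I_n.+1 -> Y})
     h (x ord0) * (\prod_(i < n) G i (x (inord i)) (x (inord i.+1)))
     * a (x ord_max) =
  \sum_y h y * chain n G a y.
Proof.
elim: n G h => [|n IHn] G h /=.
  rewrite (reindex (fun y : Y => [ffun _ : 'I_1 => y])) /=; last first.
    exists (fun x : {ffun 'I_1 -> Y} => x ord0) => [y _|x _]; first by rewrite ffunE.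
    apply/ffunP => i; rewrite ffunE; congr (x _).
    by case: i => [[|]] // lt; exact: val_inj.
  by apply: eq_bigr => y _; rewrite big_ord0 !ffunE mulr1.
pose cons (p : Y * {ffun 'I_n.+1 -> Y}) : {ffun 'I_n.+2 -> Y} :=
  [ffun i => if unlift ord0 i is Some j then p.2 j else p.1].
rewrite (reindex cons) /=; last first.
  exists (fun x => (x ord0, [ffun j => x (lift ord0 j)])) => [[y x] _|x _].
    congr pair; first by rewrite ffunE unlift_none.
    by apply/ffunP => j; rewrite !ffunE liftK.
  apply/ffunP => i; rewrite ffunE /=; case: unliftP => [j|] -> //.
  by rewrite ffunE.
rewrite -(pair_bigA _ (fun y x => h ((cons (y, x)) ord0) *
  (\prod_(i < n.+1) G i ((cons (y, x)) (inord i)) ((cons (y, x)) (inord i.+1)))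
  * a ((cons (y, x)) ord_max))) /=.
apply: eq_bigr => y _.
have cons0 x : cons (y, x) ord0 = y by rewrite ffunE unlift_none.
have consS x (j : nat) : (j < n.+1)%N -> cons (y, x) (inord j.+1) = x (inord j).
  move=> jn; have -> : inord j.+1 = lift ord0 (inord j) :> 'I_n.+2.
    by apply: ord_inj; rewrite lift0 !inordK.
  by rewrite ffunE liftK.
rewrite -[RHS]/(h y * act (G 0%N) (chain n (fun i => G i.+1) a) y).
rewrite /act -(IHn (fun i => G i.+1) (G 0%N y)) mulr_sumr.
apply: eq_bigr => x _; rewrite big_ord_recl /= cons0.
have -> : inord 0 = ord0 :> 'I_n.+2 by apply: ord_inj; rewrite inordK.
rewrite cons0 consS //.
have -> : inord 0 = ord0 :> 'I_n.+1 by apply: ord_inj; rewrite inordK.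
have -> : ord_max = inord n.+1 :> 'I_n.+2 by apply: ord_inj; rewrite inordK.
have -> : ord_max = inord n :> 'I_n.+1 by apply: ord_inj; rewrite inordK.
rewrite consS // !mulrA; congr (_ * _ * _).
apply: eq_bigr => i _; rewrite -[bump 0 i]/(i.+1) !consS //.
- by rewrite ltnS.
- by rewrite ltnS ltnW.
Qed.

(** Expand the closing edge into rank-one terms.  Each of them cuts the cycle into a
    path between two vectors, and the kernels along the path act by their operator
    norms. *)
Lemma cyc_flat_last n (G : 'I_n.+1 -> Y -> Y -> R) (s : 'I_n.+1 -> R) N :
  (forall i, 0 <= s i) -> (forall i, op_bound (s i) (G i)) ->
  rank_bound (s ord_max) N (G ord_max) ->
  `|cyc G| <= N%:R * \prod_i s i.
Proof.
move=> s0 Gs [a [b [an bn Gab]]].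
pose Gn (i : nat) := G (inord i); pose sn (i : nat) := s (inord i).
have inord_widen (i : 'I_n) : inord i = widen_ord (leqnSn n) i.
  by apply: ord_inj; rewrite inordK //= ltnS ltnW.
have ordS_widen (i : 'I_n) : ordS (widen_ord (leqnSn n) i) = inord i.+1.
  by apply: val_inj; rewrite /= inordK ?modn_small // ltnS.
have ordS_max : ordS ord_max = ord0 :> 'I_n.+1 by apply: val_inj; rewrite /= modnn.
have -> : cyc G = \sum_(l < N) \sum_y b l y * chain n Gn (a l) y.
  under eq_bigr do rewrite -path_sum.
  rewrite exchange_big; apply: eq_bigr => x _ /=.
  rewrite big_ord_recr /= ordS_max Gab mulr_sumr; apply: eq_bigr => l _.
  have -> : \prod_(i < n) G (widen_ord (leqnSn n) i) (x (widen_ord (leqnSn n) i))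
        (x (ordS (widen_ord (leqnSn n) i))) =
      \prod_(i < n) Gn i (x (inord i)) (x (inord i.+1)).
    by apply: eq_bigr => i _; rewrite /Gn ordS_widen inord_widen.
  ring.
apply: le_trans (ler_norm_sum _ _ _) _.
rewrite -[N in leRHS]card_ord mulr_natl -sumr_const; apply: ler_sum => l _.
apply: sqr_le_norm; first exact: prodr_ge0.
apply: le_trans (norm2_dot _ _) _.
rewrite -[leRHS]mul1r; apply: ler_pM => //; rewrite ?norm2_ge0 //.
rewrite big_ord_recr /= exprMn.
apply: le_trans (chain_norm (s := sn) _ _) _; first by move=> i _; exact: Gs.
have -> : \prod_(i < n) sn i = \prod_(i < n) s (widen_ord (leqnSn n) i).
  by apply: eq_bigr => i _; rewrite /sn inord_widen.
by rewrite ler_wpM2l ?sqr_ge0.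
Qed.

(** Rotating the cycle makes any edge the closing one, so each of the k ranks gives a
    bound. *)
Lemma cyc_flat k (G : 'I_k -> Y -> Y -> R) (s : 'I_k -> R) (N : 'I_k -> nat) i :
  (forall i, 0 <= s i) -> (forall i, flat (s i) (N i) (G i)) ->
  `|cyc G| <= (N i)%:R * \prod_i s i.
Proof.
case: k G s N i => [|n] G s N i; first by case: i.
have [d dP] : exists d : nat, i = iter d (@ordS n.+1) ord_max.
  exists i.+1.
  have iterS (j : nat) : (j <= n)%N -> iter j.+1 (@ordS n.+1) ord_max = inord j.
    elim: j => [_|j IHj jn].
      by apply: ord_inj; rewrite inordK //= modnn.
    rewrite iterS IHj 1?ltnW //; apply: ord_inj.
    by rewrite inordK //= inordK ?modn_small // ltnW.
  by rewrite iterS ?inord_val // -ltnS.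
elim: d i dP G s N => [|d IHd] i -> G s N s0 GsN.
  by apply: (cyc_flat_last s0) => [j|]; [have [] := GsN j | have [] := GsN ord_max].
rewrite -cyc_rot iterS.
have -> : \prod_i s i = \prod_i s (ordS i).
  by rewrite (reindex (@ordS n.+1)) //; exact/onW_bij/ordS_bij.
exact: (IHd _ erefl (fun i => G (ordS i)) (fun i => s (ordS i)) (fun i => N (ordS i))).
Qed.

End Cycle.

(** * Summing over the layers *)

Section Tail.
Variables (R : realType) (k : nat).

(** The k bounds of [cyc_flat], one for each rank, combine into geometric decay in all
    layer indices at once.  The ratio is r^2 so that one factor r can be spent on
    smallness beyond a cutoff and the other on summability. *)
Definition layers_decay (C B r : R) (N : 'I_k -> nat -> nat) : Prop :=
  forall (A : R) (m : 'I_k -> nat),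
    0 <= A -> (forall i, A <= (N i (m i))%:R * \prod_j (C / 2 ^+ m j)) ->
    A <= \prod_j (B * (r ^+ m j * r ^+ m j)).

Lemma sum_geometric (r : R) M : 0 <= r -> r < 1 ->
  \sum_(m < M) r ^+ m <= (1 - r)^-1.
Proof.
move=> r0 r1; have r1' : 0 < 1 - r by rewrite subr_gt0.
rewrite -[leRHS]mul1r ler_pdivlMr // mulrC -opprB mulNr -subrX1 opprB.
by rewrite gerBl exprn_ge0.
Qed.

Lemma expr_small (r e : R) : 0 < r -> r < 1 -> 0 < e ->
  exists m : nat, r ^+ m <= e.
Proof.
move=> r0 r1 e0.
have bern m : r ^+ m * (1 + m%:R * (1 - r)) <= 1.
  elim: m => [|m IHm]; first by rewrite expr0 mul0r addr0 mulr1.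
  apply: le_trans IHm; rewrite exprSr -mulrA ler_wpM2l ?exprn_ge0 ?(ltW r0) //.
  rewrite -subr_ge0 -natr1.
  have -> : 1 + m%:R * (1 - r) - r * (1 + (m%:R + 1) * (1 - r)) =
    (m%:R + 1) * (1 - r) ^+ 2 by ring.
  by rewrite mulr_ge0 ?sqr_ge0 // addr_ge0.
(* Bernoulli gives r^m <= 1 / (1 + m (1 - r)). *)
exists (Num.bound (e^-1 / (1 - r))).
set m := Num.bound _.
have r1' : 0 < 1 - r by rewrite subr_gt0.
have lt : e^-1 < m%:R * (1 - r).
  rewrite -ltr_pdivrMr //; apply: archi_boundP.
  by rewrite divr_ge0 ?invr_ge0 ?ltW.
have big : e^-1 <= 1 + m%:R * (1 - r) by rewrite (le_trans (ltW lt)) // lerDr.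
rewrite -[leLHS]mulr1 -(mulVf (lt0r_neq0 e0)) mulrA ler_piMl ?(ltW e0) //.
by apply: le_trans (bern m); rewrite ler_wpM2l ?exprn_ge0 ?(ltW r0).
Qed.

Variables (C B r : R) (N : 'I_k -> nat -> nat).
Hypotheses (C0 : 0 < C) (B0 : 0 < B) (r0 : 0 < r) (r1 : r < 1).
Hypothesis NC : layers_decay C B r N.

Section OnType.
Variable Y : finType.

Lemma tame_family (F : 'I_k -> Y -> Y -> R) :
  (forall i, tame C (N i) (F i)) ->
  exists (M : nat) (G : 'I_k -> nat -> Y -> Y -> R),
    (forall i x y, F i x y = \sum_(m < M) G i m x y) /\
    forall i m, flat (C / 2 ^+ m) (N i m) (G i m).
Proof.
move=> /fin_all_exists[M /fin_all_exists[G FG]].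
exists (\max_i M i), (fun i m => if (m < M i)%N then G i m else fun _ _ => 0).
split => [i x y|i m]; last first.
  by case: ifP => _; [have [_] := FG i; apply | exact: flat0].
have [-> _] := FG i.
rewrite (big_ord_widen _ (fun m => G i m x y) (leq_bigmax i)) big_mkcond /=.
by apply: eq_bigr => m _; case: ifP.
Qed.

Lemma cyc_sum M (G : 'I_k -> nat -> Y -> Y -> R) :
  cyc (fun i x y => \sum_(m < M) G i m x y) =
  \sum_(mu : {ffun 'I_k -> 'I_M}) cyc (fun i => G i (mu i)).
Proof.
rewrite /cyc exchange_big; apply: eq_bigr => x _ /=.
by rewrite (bigA_distr_bigA (fun i (m : 'I_M) => G i m (x i) (x (ordS i)))).
Qed.

(** Expanding the product over all choices of layers, the terms that disappear have
    some layer index at least m0; one of the two factors r^(mu i) then gives r^m0 and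
    the other sums to a geometric series. *)
Lemma cyc_tail M m0 (G : 'I_k -> nat -> Y -> Y -> R) :
  (forall i m, flat (C / 2 ^+ m) (N i m) (G i m)) ->
  `|cyc (fun i x y => \sum_(m < M) G i m x y) -
    cyc (fun i x y => \sum_(m < M | (m < m0)%N) G i m x y)|
  <= r ^+ m0 * (B / (1 - r)) ^+ k.
Proof.
move=> Gflat.
pose H i m x y : R := if (m < m0)%N then G i m x y else 0.
have -> : cyc (fun i x y => \sum_(m < M | (m < m0)%N) G i m x y) =
          cyc (fun i x y => \sum_(m < M) H i m x y).
  by apply: eq_cyc => i x y; rewrite big_mkcond.
rewrite !cyc_sum -sumrB.
apply: le_trans (ler_norm_sum _ _ _) _.
have geo : \prod_(i < k) (\sum_(m < M) B * r ^+ m) <= (B / (1 - r)) ^+ k.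
  rewrite prodr_const card_ord lerXn2r ?nnegrE //.
  - by apply: sumr_ge0 => m _; rewrite mulr_ge0 ?exprn_ge0 ?ltW.
  - by rewrite divr_ge0 ?(ltW B0) // subr_ge0 ltW.
  - by rewrite -mulr_sumr ler_wpM2l ?(ltW B0) ?sum_geometric ?(ltW r0).
apply: le_trans (ler_wpM2l (exprn_ge0 m0 (ltW r0)) geo).
rewrite (bigA_distr_bigA (fun i (m : 'I_M) => B * r ^+ m)) mulr_sumr.
apply: ler_sum => mu _.
have [/forallP all|] := boolP [forall i, (mu i < m0)%N].
  have -> : cyc (fun i => H i (mu i)) = cyc (fun i => G i (mu i)).
    by apply: eq_cyc => i x y; rewrite /H all.
  rewrite subrr normr0 mulr_ge0 ?exprn_ge0 ?(ltW r0) //.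
  by apply: prodr_ge0 => i _; rewrite mulr_ge0 ?exprn_ge0 ?ltW.
rewrite negb_forall => /existsP[i0]; rewrite -leqNgt => lei.
have -> : cyc (fun i => H i (mu i)) = 0.
  rewrite /cyc big1 // => x _; rewrite (bigD1 i0) //= /H ltnNge lei mul0r //.
rewrite subr0.
apply: (@le_trans _ _ (\prod_j (B * (r ^+ mu j * r ^+ mu j)))).
  apply: (NC (m := fun i => mu i)) => // i.
  apply: (cyc_flat i (G := fun i => G i (mu i)) (s := fun i => C / 2 ^+ mu i)
    (N := fun i => N i (mu i))) => // j.
  by rewrite divr_ge0 ?exprn_ge0 ?(ltW C0).
under eq_bigr do rewrite mulrCA.
rewrite big_split /= ler_wpM2r //.
  by apply: prodr_ge0 => i _; rewrite mulr_ge0 ?exprn_ge0 ?ltW.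
rewrite (bigD1 i0) //=; apply: (@le_trans _ _ (r ^+ mu i0)).
  rewrite ler_piMr ?exprn_ge0 ?(ltW r0) //.
  by apply: prodr_ile1 => i _; rewrite exprn_ge0 ?exprn_ile1 ?(ltW r0) ?(ltW r1).
by rewrite ler_wiXn2l ?(ltW r0) ?(ltW r1).
Qed.

(** The number of rank-one terms in the top layers depends only on the cutoff and on
    the rank bounds, not on the kernels or on the space. *)
Lemma top_decomp M m0 (G : 'I_k -> nat -> Y -> Y -> R) :
  (forall i m, flat (C / 2 ^+ m) (N i m) (G i m)) ->
  let L := ('I_m0 * 'I_(\sum_(m < m0) \sum_i N i m))%type in
  exists a b : 'I_k -> L -> Y -> R,
    [/\ forall i l, norm2 (a i l) <= C ^+ 2, forall i l, norm2 (b i l) <= 1 &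
     forall i x y, \sum_(m < M | (m < m0)%N) G i m x y
       = \sum_l a i l x * b i l y].
Proof.
move=> Gflat L; set Nb := \sum_(m < m0) _ in L *.
have rk i (m : 'I_m0) : exists ab : (nat -> Y -> R) * (nat -> Y -> R),
    [/\ forall l, norm2 (ab.1 l) <= (C / 2 ^+ m) ^+ 2,
        forall l, norm2 (ab.2 l) <= 1 &
        forall x y, G i m x y = \sum_(l < N i m) ab.1 l x * ab.2 l y].
  by have [_ [a [b abP]]] := Gflat i m; exists (a, b).
have [h hP] := fin_all_exists (fun p : 'I_k * 'I_m0 => rk p.1 p.2).
have n0 : norm2 (fun _ : Y => 0 : R) = 0.
  by rewrite /norm2 big1 // => x _; rewrite expr0n.
exists (fun i (l : L) x => if (l.1 < M)%N && (l.2 < N i l.1)%N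
                           then (h (i, l.1)).1 l.2 x else 0).
exists (fun i (l : L) x => (h (i, l.1)).2 l.2 x).
split.
- move=> i l /=; case: (_ && _); last by rewrite n0 sqr_ge0.
  have [an _ _] := hP (i, l.1); apply: le_trans (an _) _ => /=.
  rewrite lerXn2r ?nnegrE ?divr_ge0 ?exprn_ge0 ?(ltW C0) //.
  by rewrite ler_pdivrMr ?exprn_gt0 // ler_peMr ?(ltW C0) // exprn_ege1 // ler1n.
- by move=> i l /=; have [_ bn _] := hP (i, l.1); exact: bn.
move=> i x y.
rewrite -(pair_bigA _ (fun (m : 'I_m0) (l : 'I_Nb) =>
   (if (m < M)%N && (l < N i m)%N then (h (i, m)).1 l x else 0) *
   (h (i, m)).2 l y)) /=.
have NiN (m : 'I_m0) : (N i m <= Nb)%N.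
  rewrite /Nb (bigD1 m) //=; apply: leq_trans (leq_addr _ _).
  by rewrite (bigD1 i) //=; exact: leq_addr.
transitivity (\sum_(m < m0 | (m < M)%N) G i m x y).
  have [le|le] := leqP m0 M.
    rewrite -(big_ord_widen M (fun m => G i m x y) le).
    by apply: eq_bigl => m; rewrite (leq_trans (ltn_ord m) le).
  rewrite -(big_ord_widen m0 (fun m => G i m x y) (ltnW le)).
  by apply: eq_bigl => m; rewrite (leq_trans (ltn_ord m) (ltnW le)).
rewrite big_mkcond /=; apply: eq_bigr => m _.
case: ifP => mM /=; last by rewrite big1 // => l _; rewrite mul0r.
have [_ _ /= ->] := hP (i, m).
rewrite (big_ord_widen Nb (fun l => (h (i, m)).1 l x * (h (i, m)).2 l y)) //.
rewrite big_mkcond /=.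
by apply: eq_bigr => l _; case: ifP => //; rewrite mul0r.
Qed.

End OnType.
End Tail.

(** * Conditional expectation and localization *)

Section CondExp.
Variables (R : realType) (Y : finType) (m : Y -> R).
Hypothesis m0 : forall y, 0 <= m y.

Definition measure (A : pred Y) : R := \sum_(y | A y) m y.

Definition cell (T : eqType) (q : Y -> T) (x : Y) : pred Y := fun y => q y == q x.

Lemma measure_ge0 A : 0 <= measure A.
Proof. by apply: sumr_ge0. Qed.

Lemma measure_sub (A A' : pred Y) : (forall y, A y -> A' y) -> measure A <= measure A'.
Proof.
move=> AA'; rewrite /measure [leLHS]big_mkcond [leRHS]big_mkcond /=.
apply: ler_sum => y _; case: ifP => [/AA' -> //|_].
by case: ifP.
Qed.

Section Partition.
Variables (T : eqType) (q : Y -> T).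

Lemma eq_cell x y : q x = q y -> cell q x =1 cell q y.
Proof. by move=> qxy u; rewrite /cell qxy. Qed.

Lemma le_measure_cell x : m x <= measure (cell q x).
Proof. by rewrite /measure (bigD1 x) /cell //= lerDl sumr_ge0. Qed.

Lemma measure_cell0 x : measure (cell q x) = 0 -> m x = 0.
Proof.
by move=> P0; apply/eqP; rewrite eq_le m0 andbT -P0 le_measure_cell.
Qed.

(** Where the cell has mass zero the quotient is zero by convention, and so is m x. *)
Lemma sum_cell_weight x : m x * (\sum_(u | cell q x u) m u / measure (cell q u)) = m x.
Proof.
have [P0|P0] := eqVneq (measure (cell q x)) 0; first by rewrite measure_cell0 ?mul0r.
rewrite (eq_bigr (fun u => m u / measure (cell q x))).
  by rewrite -mulr_suml mulfV ?mulr1.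
by move=> u /eqP qu; congr (_ / _); apply: eq_bigl; exact: eq_cell.
Qed.

(** Conditional expectation on the cells of q, conjugated by the square root of the
    mass: an orthogonal projection of unweighted l^2. *)
Definition cond_kernel (x y : Y) : R :=
  Num.sqrt (m x) * Num.sqrt (m y) * (cell q x y)%:R / measure (cell q x).

Lemma cell_sym x y : cell q x y = cell q y x.
Proof. by rewrite /cell eq_sym. Qed.

Lemma cond_kernelC x y : cond_kernel x y = cond_kernel y x.
Proof.
rewrite /cond_kernel (cell_sym x y) [Num.sqrt (m x) * _]mulrC.
have [/eqP qxy|] := boolP (cell q y x); last by rewrite !mulr0 !mul0r.
by congr (_ / _); apply: eq_bigl; exact: eq_cell.
Qed.

Lemma sqrt_m x : Num.sqrt (m x) ^+ 2 = m x.
Proof. by rewrite sqr_sqrtr. Qed.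

(** Cauchy-Schwarz inside each cell. *)
Lemma cond_kernel_contraction : sym_contraction cond_kernel.
Proof.
split; first exact: cond_kernelC.
move=> b; rewrite expr1n mul1r.
have step x : act cond_kernel b x ^+ 2 <=
    m x / measure (cell q x) * \sum_(u | cell q x u) b u ^+ 2.
  have -> : act cond_kernel b x = Num.sqrt (m x) / measure (cell q x) *
      \sum_(u | cell q x u) Num.sqrt (m u) * b u.
    rewrite /act mulr_sumr [RHS]big_mkcond /=; apply: eq_bigr => u _.
    by rewrite /cond_kernel; case: (cell q x u); rewrite ?mulr1 ?mulr0 ?mul0r //; ring.
  rewrite exprMn expr_div_n sqrt_m.
  have [P0|P0] := eqVneq (measure (cell q x)) 0.
    by rewrite measure_cell0 // !mul0r.
  have Pp : 0 < measure (cell q x) by rewrite lt_def P0 measure_ge0.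
  apply: (@le_trans _ _ (m x / measure (cell q x) ^+ 2 *
     (measure (cell q x) * \sum_(u | cell q x u) b u ^+ 2))).
    rewrite ler_wpM2l ?divr_ge0 ?sqr_ge0 //.
    apply: le_trans (cauchy_schwarz _ _ _) _.
    by rewrite /measure; under [X in X * _ <= _]eq_bigr do rewrite sqrt_m.
  by apply: le_of_eq; field.
apply: (@le_trans _ _ (\sum_x \sum_(u | cell q x u) m x / measure (cell q x) * b u ^+ 2)).
  by apply: ler_sum => x _; rewrite -mulr_sumr.
rewrite (exchange_big_dep predT) //=; apply: ler_sum => u _.
rewrite -mulr_suml ler_piMl ?sqr_ge0 //.
rewrite (eq_bigl (cell q u)); last by move=> x; rewrite cell_sym.
have [P0|P0] := eqVneq (measure (cell q u)) 0.
  rewrite big1 ?ler01 // => x /eqP qx.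
  have -> : measure (cell q x) = measure (cell q u) by apply: eq_bigl; exact: eq_cell.
  by rewrite P0 invr0 mulr0.
rewrite (eq_bigr (fun x => m x / measure (cell q u))).
  by rewrite -mulr_suml mulfV.
by move=> x /eqP qx; congr (_ / _); apply: eq_bigl; exact: eq_cell.
Qed.

Definition average (f : Y -> Y -> R) (x y : Y) : R :=
  (\sum_(u | cell q x u) \sum_(v | cell q y v) m u * m v * f u v) /
  (measure (cell q x) * measure (cell q y)).

Lemma average_ge0 f x y : (forall u v, 0 <= f u v) -> 0 <= average f x y.
Proof.
move=> f0; rewrite /average divr_ge0 ?mulr_ge0 ?measure_ge0 //.
by apply: sumr_ge0 => u _; apply: sumr_ge0 => v _; rewrite !mulr_ge0.
Qed.

Lemma eq_average f x y x' y' : q x = q x' -> q y = q y' ->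
  average f x y = average f x' y'.
Proof.
move=> qx qy; rewrite /average (eq_bigl _ _ (eq_cell qx)) /measure.
under eq_bigr do rewrite (eq_bigl _ _ (eq_cell qy)).
by rewrite (eq_bigl _ _ (eq_cell qx)) (eq_bigl _ _ (eq_cell qy)).
Qed.

(** Exchanging sums moves the averaging from f to g, on which it does nothing, g being
    constant on cells; points in cells of mass zero contribute to neither side. *)
Lemma sum_average f (g : Y -> Y -> R) :
  (forall x y x' y', q x = q x' -> q y = q y' -> g x y = g x' y') ->
  \sum_x \sum_y m x * m y * (average f x y * g x y) =
  \sum_x \sum_y m x * m y * (f x y * g x y).
Proof.
move=> gq.
transitivity (\sum_u \sum_v m u * m v * f u v * g u v *
  ((\sum_(x | cell q u x) m x / measure (cell q x)) *
   (\sum_(y | cell q v y) m y / measure (cell q y)))); last first.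
  apply: eq_bigr => u _; apply: eq_bigr => v _.
  have := sum_cell_weight u; have := sum_cell_weight v.
  set a := \sum_(_ | _) _; set b := \sum_(_ | _) _ => ma mb.
  rewrite -[in RHS]ma -[in RHS]mb; ring.
have -> : \sum_x \sum_y m x * m y * (average f x y * g x y) =
  \sum_x \sum_y \sum_(u | cell q x u) \sum_(v | cell q y v)
     m u * m v * f u v * g u v * (m x / measure (cell q x) * (m y / measure (cell q y))).
  apply: eq_bigr => x _; apply: eq_bigr => y _.
  rewrite /average; move: (measure (cell q x)) (measure (cell q y)) => Px Py.
  rewrite !mulr_suml mulr_sumr; apply: eq_bigr => u /eqP qu.
  rewrite !mulr_suml mulr_sumr; apply: eq_bigr => v /eqP qv.
  by rewrite (gq _ _ _ _ qu qv) invfM; ring.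
under eq_bigr do rewrite exchange_big /=.
rewrite (exchange_big_dep predT) //=.
apply: eq_bigr => u _.
under eq_bigr do rewrite (exchange_big_dep predT) //=.
rewrite exchange_big /=.
apply: eq_bigr => v _.
rewrite -mulrA !mulr_suml mulr_sumr.
rewrite (eq_bigl (cell q u)); last by move=> x; rewrite cell_sym.
apply: eq_bigr => x _; rewrite !mulr_sumr.
rewrite (eq_bigl (cell q v)); last by move=> y; rewrite cell_sym.
by apply: eq_bigr => y _; rewrite !mulrA.
Qed.

(** Links the operator form of conditional expectation, used for counting, to the
    pointwise averages, used for lower bounds. *)
Lemma sandwich_cond (f : Y -> Y -> R) x y :
  sandwich cond_kernel cond_kernel
    (fun u v => f u v * (Num.sqrt (m u) * Num.sqrt (m v))) x y
  = average f x y * (Num.sqrt (m x) * Num.sqrt (m y)).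
Proof.
have Ex u : cond_kernel x u = Num.sqrt (m x) * Num.sqrt (m u) * (cell q x u)%:R
    / measure (cell q x) by [].
have Ey v : cond_kernel v y = Num.sqrt (m y) * Num.sqrt (m v) * (cell q y v)%:R
    / measure (cell q y) by rewrite cond_kernelC.
rewrite /sandwich; under eq_bigr do under eq_bigr do rewrite Ex Ey.
rewrite /average; move: (measure (cell q x)) (measure (cell q y)) => Px Py.
rewrite !mulr_suml [RHS]big_mkcond /=; apply: eq_bigr => u _; case: ifP => cu; last first.
  by apply: big1 => v _; rewrite mulr0 !mul0r.
rewrite !mulr_suml [RHS]big_mkcond /=; apply: eq_bigr => v _.
case: ifP => cv; last by rewrite !(mulr0, mul0r).
by rewrite -[in RHS](sqrt_m u) -[in RHS](sqrt_m v) invfM !mulr1; ring.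
Qed.

End Partition.

Definition localize (A B : pred Y) (G : Y -> Y -> R) (x y : Y) : R :=
  (A x)%:R * (B y)%:R * G x y.

Definition diag_kernel (A : pred Y) (x y : Y) : R := (A x)%:R * (x == y)%:R.

Lemma diag_contraction A : sym_contraction (diag_kernel A).
Proof.
split.
  move=> x y; rewrite /diag_kernel eq_sym.
  by case: eqVneq => [->//|_]; rewrite !mulr0.
move=> b; rewrite expr1n mul1r; apply: ler_sum => x _.
rewrite /act (bigD1 x) //= big1; last first.
  by move=> y /negPf; rewrite eq_sym /diag_kernel => ->; rewrite mulr0 mul0r.
rewrite /diag_kernel eqxx addr0 mulr1.
by case: (A x); rewrite ?mul1r // mul0r expr0n sqr_ge0.
Qed.

(** Makes localization an instance of multiplication by contractions, to which
    [flat_sandwich] applies. *)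
Lemma localize_sandwich A B G x y :
  localize A B G x y = sandwich (diag_kernel A) (diag_kernel B) G x y.
Proof.
rewrite /sandwich (bigD1 x) //= [X in _ + X]big1; last first.
  move=> u /negPf; rewrite eq_sym => xu; apply: big1 => v _.
  by rewrite /diag_kernel xu mulr0 !mul0r.
rewrite (bigD1 y) //= [X in _ + X + _]big1; last first.
  by move=> v /negPf yv; rewrite /diag_kernel yv !mulr0.
by rewrite /diag_kernel !eqxx /localize !addr0 !mulr1; ring.
Qed.

End CondExp.

(** * Replacing bounded kernels in a cycle *)

Section Bounded.
Variables (R : realType).

Lemma flat_ext (X Y : finType) s N (G G' : X -> Y -> R) :
  (forall x y, G x y = G' x y) -> flat s N G -> flat s N G'.
Proof.
move=> GG' [Gs [a [b [an bn Gab]]]]; split.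
  move=> c; rewrite (@eq_norm2 _ _ _ (act G c)) //.
  by move=> x; apply: eq_bigr => y _; rewrite GG'.
by exists a, b; split => // x y; rewrite -GG'.
Qed.

Lemma prod_close (I : Type) (s : seq I) (a b w : I -> R) (t e : R) :
  1 <= t -> 0 <= e -> (forall i, 0 <= w i) ->
  (forall i, `|a i| <= t * w i) -> (forall i, `|b i| <= t * w i) ->
  (forall i, `|a i - b i| <= e * w i) ->
  `|\prod_(i <- s) a i - \prod_(i <- s) b i| <=
    (size s)%:R * t ^+ size s * e * \prod_(i <- s) w i.
Proof.
move=> t1 e0 w0 at_ bt abe; have t0 : 0 <= t by apply: le_trans t1.
elim: s => [|i s IHs]; first by rewrite !big_nil subrr normr0 !mul0r.
rewrite !big_cons /=.
set A := \prod_(j <- s) a j in IHs *; set A' := \prod_(j <- s) b j in IHs *.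
set W := \prod_(j <- s) w j in IHs *.
have W0 : 0 <= W by exact: prodr_ge0.
have A't : `|A'| <= t ^+ size s * W.
  have -> : t ^+ size s * W = \prod_(j <- s) (t * w j).
    rewrite big_split /= big_const_seq count_predT; congr (_ * _).
    by rewrite -[LHS]mulr1 -iter_mulr.
  rewrite /A' normr_prod.
  by apply: ler_prod => j _; rewrite normr_ge0 bt.
have -> : a i * A - b i * A' = a i * (A - A') + (a i - b i) * A' by ring.
apply: le_trans (ler_normD _ _) _; rewrite !normrM.
have h1 : `|a i| * `|A - A'| <= (t * w i) * ((size s)%:R * t ^+ size s * e * W).
  by apply: ler_pM.
have h2 : `|a i - b i| * `|A'| <= (e * w i) * (t ^+ size s * W) by apply: ler_pM.
apply: le_trans (lerD h1 h2) _.
have h3 : (e * w i) * (t ^+ size s * W) <= (e * w i) * (t ^+ (size s).+1 * W).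
  rewrite ler_wpM2l ?mulr_ge0 // ler_wpM2r // exprS ler_peMl ?exprn_ge0 //.
apply: le_trans (lerD (lexx _) h3) _.
rewrite -natr1 exprS.
by apply: le_of_eq; ring.
Qed.

Variables (Y : finType) (m : Y -> R).
Hypothesis m0 : forall y, 0 <= m y.

Lemma prod_sqrt_cycle k (x : {ffun 'I_k -> Y}) :
  \prod_i (Num.sqrt (m (x i)) * Num.sqrt (m (x (ordS i)))) = \prod_i m (x i).
Proof.
rewrite big_split /= [X in _ * X](_ : _ = \prod_i Num.sqrt (m (x i))); last first.
  by rewrite [RHS](reindex (@ordS k)) //; exact/onW_bij/ordS_bij.
by rewrite -big_split; apply: eq_bigr => i _; rewrite /= -expr2 sqr_sqrtr.
Qed.

(** Telescoping the product.  Around the cycle the square roots of the masses pair up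
    to the product measure, see [prod_sqrt_cycle]. *)
Lemma cyc_close k (K1 K2 : 'I_k -> Y -> Y -> R) (t e mu0 : R) :
  1 <= t -> 0 <= e -> \sum_y m y <= mu0 ->
  (forall i x y, `|K1 i x y| <= t * (Num.sqrt (m x) * Num.sqrt (m y))) ->
  (forall i x y, `|K2 i x y| <= t * (Num.sqrt (m x) * Num.sqrt (m y))) ->
  (forall i x y, `|K1 i x y - K2 i x y| <= e * (Num.sqrt (m x) * Num.sqrt (m y))) ->
  `|cyc K1 - cyc K2| <= k%:R * t ^+ k * e * mu0 ^+ k.
Proof.
move=> t1 e0 mmu K1t K2t Ke; rewrite /cyc -sumrB.
have t0 : 0 <= t by apply: le_trans t1.
apply: le_trans (ler_norm_sum _ _ _) _.
apply: (@le_trans _ _ (\sum_(x : {ffun 'I_k -> Y})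
    k%:R * t ^+ k * e * \prod_(i < k) m (x i))).
  apply: ler_sum => x _.
  have := @prod_close _ (index_enum 'I_k) (fun i => K1 i (x i) (x (ordS i)))
    (fun i => K2 i (x i) (x (ordS i)))
    (fun i => Num.sqrt (m (x i)) * Num.sqrt (m (x (ordS i)))) t e t1 e0.
  rewrite prod_sqrt_cycle.
  have -> : size (index_enum 'I_k) = k.
    by rewrite -[RHS]size_enum_ord enumT [index_enum _]unlock.
  apply => // i.
  by rewrite mulr_ge0 ?sqrtr_ge0.
rewrite -mulr_sumr -(bigA_distr_bigA (fun _ y => m y)) prodr_const card_ord.
rewrite ler_wpM2l ?mulr_ge0 ?exprn_ge0 //.
have S0 : 0 <= \sum_y m y by exact: sumr_ge0.
by rewrite lerXn2r ?nnegrE // (le_trans S0).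
Qed.

Lemma average_norm (T : finType) (q : Y -> T) (g : Y -> Y -> R) x y t :
  0 <= t ->
  (forall u v, cell q x u -> cell q y v -> `|g u v| <= t) ->
  `|average m q g x y| <= t.
Proof.
move=> t0 gt; rewrite /average normrM.
set P := measure m (cell q x); set Q := measure m (cell q y).
have PQ0 : 0 <= P * Q by rewrite mulr_ge0 ?measure_ge0.
have [PQ|PQ] := eqVneq (P * Q) 0; first by rewrite PQ invr0 normr0 mulr0.
rewrite [X in _ * X]ger0_norm ?invr_ge0 // ler_pdivrMr ?lt_def ?PQ //.
apply: le_trans (ler_norm_sum _ _ _) _.
rewrite mulrA [t * P]mulr_sumr mulr_suml; apply: ler_sum => u cu.
apply: le_trans (ler_norm_sum _ _ _) _.
rewrite /Q /measure mulr_sumr; apply: ler_sum => v cv.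
rewrite !normrM (ger0_norm (m0 u)) (ger0_norm (m0 v)).
have -> : t * m u * m v = m u * m v * t by ring.
by rewrite ler_wpM2l ?mulr_ge0 // gt.
Qed.

Lemma average_cst (T : finType) (q : Y -> T) (t : R) x y :
  measure m (cell q x) != 0 -> measure m (cell q y) != 0 ->
  average m q (fun _ _ => t) x y = t.
Proof.
move=> P0 Q0; rewrite /average.
have -> : \sum_(u | cell q x u) \sum_(v | cell q y v) m u * m v * t =
  measure m (cell q x) * measure m (cell q y) * t.
  rewrite /measure !mulr_suml; apply: eq_bigr => u _.
  by rewrite mulr_sumr mulr_suml.
by field; rewrite P0 Q0.
Qed.

Lemma averageB (T : finType) (q : Y -> T) (g h : Y -> Y -> R) x y :
  average m q g x y - average m q h x y = average m q (fun u v => g u v - h u v) x y.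
Proof.
rewrite /average -mulrBl; congr (_ / _); rewrite -sumrB; apply: eq_bigr => u _.
by rewrite -sumrB; apply: eq_bigr => v _; rewrite mulrBr.
Qed.

End Bounded.

(** * Replacing kernels by conditional expectations *)

Section Count.
Variables (R : realType).

Lemma rounding (h e : R) : 0 < h -> 0 < e ->
  exists (b : nat) (c : R -> 'I_b.+1),
    forall s t, `|s| <= h -> `|t| <= h -> c s = c t -> `|s - t| <= e.
Proof.
move=> h0 e0; pose c0 (s : R) := Num.trunc ((s + h) / e).
exists (c0 h), (fun s => inord (c0 s)) => s t sh th.
have cP u : `|u| <= h -> (c0 u <= c0 h)%N /\
    (c0 u)%:R * e <= u + h < ((c0 u)%:R + 1) * e.
  rewrite ler_norml => /andP[hu uh].
  have u0 : 0 <= (u + h) / e by rewrite divr_ge0 ?(ltW e0) //; lra.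
  split; first by apply: le_truncn; rewrite ler_pM2r ?invr_gt0 // lerD2r.
  rewrite -ler_pdivlMr // -ltr_pdivrMr // natr1.
  by apply: truncn_itv.
have [sc /andP[s1 s2]] := cP s sh; have [tc /andP[t1 t2]] := cP t th.
move=> /(congr1 val) /=; rewrite !inordK // => st.
rewrite st in s1 s2; rewrite ler_norml; move: s1 s2 t1 t2.
set n := (c0 t)%:R => s1 s2 t1 t2; apply/andP; split; nra.
Qed.

Variables (k : nat) (C B r : R) (N : 'I_k -> nat -> nat).
Hypotheses (C0 : 0 < C) (B0 : 0 < B) (r0 : 0 < r) (r1 : r < 1).
Hypothesis NC : layers_decay C B r N.

Definition localize_cycle (Y : finType) (A : 'I_k -> pred Y)
    (F : 'I_k -> Y -> Y -> R) (i : 'I_k) : Y -> Y -> R :=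
  localize (A i) (A (ordS i)) (F i).

Lemma cyc_localize_tail (Y : finType) M m0 (G : 'I_k -> nat -> Y -> Y -> R)
    (A : 'I_k -> pred Y) :
  (forall i m, flat (C / 2 ^+ m) (N i m) (G i m)) ->
  `|cyc (localize_cycle A (fun i x y => \sum_(m < M) G i m x y)) -
    cyc (localize_cycle A (fun i x y => \sum_(m < M | (m < m0)%N) G i m x y))|
  <= r ^+ m0 * (B / (1 - r)) ^+ k.
Proof.
move=> Gflat.
have -> : cyc (localize_cycle A (fun i x y => \sum_(m < M) G i m x y)) =
    cyc (fun i x y => \sum_(m < M) localize (A i) (A (ordS i)) (G i m) x y).
  by apply: eq_cyc => i x y; rewrite /localize_cycle /localize mulr_sumr.
have -> : cyc (localize_cycle A (fun i x y => \sum_(m < M | (m < m0)%N) G i m x y)) =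
    cyc (fun i x y => \sum_(m < M | (m < m0)%N) localize (A i) (A (ordS i)) (G i m) x y).
  by apply: eq_cyc => i x y; rewrite /localize_cycle /localize mulr_sumr.
apply: (cyc_tail C0 B0 r0 r1 NC M m0
  (G := fun i m => localize (A i) (A (ordS i)) (G i m))).
move=> i m; apply: (flat_ext (G := sandwich (diag_kernel R (A i))
    (diag_kernel R (A (ordS i))) (G i m))).
  by move=> x y; rewrite localize_sandwich.
by apply: flat_sandwich; [exact: diag_contraction | exact: diag_contraction | ].
Qed.

Lemma sandwich_sum (Y : finType) (U V : Y -> Y -> R) (I : finType) (P : pred I)
    (G : I -> Y -> Y -> R) x y :
  sandwich U V (fun u v => \sum_(m | P m) G m u v) x y =
  \sum_(m | P m) sandwich U V (G m) x y.
Proof.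
rewrite /sandwich [RHS]exchange_big /=; apply: eq_bigr => u _.
rewrite [RHS]exchange_big /=; apply: eq_bigr => v _.
by rewrite mulr_sumr mulr_suml.
Qed.

(** Three replacements in the trace: drop the low layers of F; replace the top layers
    by their conditional expectation; put the low layers back under the conditional
    expectation.  The first and the last cost a tail each.  For the middle one, the top
    layers are a sum of boundedly many products of a function of x and a function of
    y.  A point is good if these functions are at most h there, relative to the square
    root of the mass, and the colouring rounds them, so that on good cells the sum is
    bounded and nearly constant.  The colour type is chosen before the space. *)
Lemma count_approx (mu0 xi nu : R) : 0 < mu0 -> 0 < xi -> 0 < nu ->
  exists T : finType, forall (Y : finType) (m : Y -> R) (F : 'I_k -> Y -> Y -> R),
    (forall y, 0 <= m y) -> \sum_y m y <= mu0 ->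
    (forall i, tame C (N i) (F i)) ->
    exists (c : Y -> T) (good : pred Y),
    [/\ forall x y, c x = c y -> good x = good y,
        measure m (predC good) <= nu &
        forall (T' : finType) (q : Y -> T'),
          (forall x y, q x = q y -> c x = c y) ->
          forall A : 'I_k -> pred Y, (forall i y, A i y -> good y) ->
          `|cyc (localize_cycle A F) -
            cyc (localize_cycle A
              (fun i => sandwich (cond_kernel m q) (cond_kernel m q) (F i)))| <= xi].
Proof.
move=> mu00 xi0 nu0.
pose Om := (B / (1 - r)) ^+ k.
have r1' : 0 < 1 - r by rewrite subr_gt0.
have Om0 : 0 < Om by rewrite exprn_gt0 // divr_gt0.
have [m0 m0P] := expr_small r0 r1 (e := xi / (4 * Om))
  ltac:(by rewrite divr_gt0 // mulr_gt0).
pose L := ('I_m0 * 'I_(\sum_(m < m0) \sum_i N i m))%type.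
pose J := ('I_k * L * bool)%type.
pose l : R := #|{: L}|%:R; have l0 : 0 <= l by exact: ler0n.
pose nJ : R := #|{: J}|%:R; have nJ0 : 0 <= nJ by exact: ler0n.
(* By Chebyshev the bad points have measure at most nJ * (C^2 + 1) / h^2 <= nu. *)
pose h : R := nJ * (C ^+ 2 + 1) / nu + 1.
have h1 : 1 <= h.
  by rewrite lerDr divr_ge0 ?(ltW nu0) // mulr_ge0 // addr_ge0 ?sqr_ge0.
have h0 : 0 < h by apply: lt_le_trans h1.
pose t := l * h ^+ 2 + 1.
have t1 : 1 <= t by rewrite lerDr mulr_ge0 ?sqr_ge0.
have t0 : 0 <= t by apply: le_trans t1.
pose Z := k%:R * t ^+ k * mu0 ^+ k.
have Z0 : 0 <= Z by rewrite !mulr_ge0 ?exprn_ge0 ?(ltW mu00).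
pose e := xi / (2 * (Z + 1)).
have Z1 : 0 < Z + 1 by rewrite ltr_wpDl.
have e0 : 0 < e by rewrite divr_gt0 // mulr_gt0.
(* Rounding l products of numbers of size at most h to precision ka costs at most
   2 * h * l * ka <= e. *)
pose ka := e / (2 * h * l + 1).
have hl1 : 0 < 2 * h * l + 1 by rewrite ltr_wpDl // !mulr_ge0 ?(ltW h0).
have ka0 : 0 < ka by rewrite divr_gt0.
have [b [rd rdP]] := rounding h0 ka0.
exists ({ffun J -> 'I_b.+1} * bool)%type => Y m F mge mmu Ft.
have [M [G [FG Gflat]]] := tame_family Ft.
have [a0 [b0 [an bn Tab]]] := top_decomp C0 M m0 Gflat.
pose s x := Num.sqrt (m x).
have s2 x : s x ^+ 2 = m x by rewrite sqr_sqrtr.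
pose w (j : J) (x : Y) : R := if j.2 then a0 j.1.1 j.1.2 x else b0 j.1.1 j.1.2 x.
have wn j : norm2 (w j) <= C ^+ 2 + 1.
  case: j => [[i lm] []] /=; first by apply: le_trans (an _ _) _; rewrite lerDl.
  by apply: le_trans (bn _ _) _; rewrite lerDr sqr_ge0.
pose good : pred Y := fun x => [forall j, w j x ^+ 2 <= m x * h ^+ 2].
pose wt j x := w j x / s x.
have goodP x j : good x -> w j x = wt j x * s x /\ `|wt j x| <= h.
  move=> /forallP/(_ j) wj; rewrite /wt.
  have [sx0|sx0] := eqVneq (s x) 0.
    move: wj; rewrite -s2 sx0 expr0n mul0r => wj.
    have : w j x ^+ 2 == 0 by rewrite eq_le wj sqr_ge0.
    by rewrite sqrf_eq0 => /eqP ->; rewrite !mul0r normr0 (ltW h0).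
  split; first by rewrite mulfVK.
  apply: sqr_le_norm; first exact: ltW.
  rewrite expr_div_n s2 ler_pdivrMr; first by rewrite mulrC.
  by rewrite lt_def -{1}s2 sqrf_eq0 sx0 mge.
exists (fun x => ([ffun j => rd (wt j x)], good x)), good.
split=> [x y [_ //]||].
  have h2 : 0 < h ^+ 2 by rewrite exprn_gt0.
  apply: (@le_trans _ _ (\sum_x \sum_j w j x ^+ 2 / h ^+ 2)).
    rewrite /measure big_mkcond /=; apply: ler_sum => x _.
    have S0 : 0 <= \sum_j w j x ^+ 2 / h ^+ 2.
      by apply: sumr_ge0 => j _; rewrite divr_ge0 ?sqr_ge0.
    case: ifP => // /negP/negP; rewrite negb_forall => /existsP[j]; rewrite -ltNge => lt.
    rewrite (bigD1 j) //= ler_wpDr //.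
      by apply: sumr_ge0 => i _; rewrite divr_ge0 ?sqr_ge0.
    by rewrite ler_pdivlMr // ltW.
  rewrite exchange_big /=.
  apply: (@le_trans _ _ (\sum_(j : J) (C ^+ 2 + 1) / h ^+ 2)).
    by apply: ler_sum => j _; rewrite -mulr_suml ler_pM2r ?invr_gt0 // wn.
  rewrite sumr_const -[_ *+ _]mulr_natl -/nJ mulrA ler_pdivrMr //.
  have hh : h <= h ^+ 2 by rewrite expr2 ler_peMl // ltW.
  apply: le_trans (ler_wpM2l (ltW nu0) hh).
  rewrite /h; move: (nJ * _) => X.
  by rewrite mulrDr mulr1 [nu * _]mulrC divfK ?lt0r_neq0 // lerDl ltW.
move=> T' q qc A Agood; set E := cond_kernel m q.
have sE := cond_kernel_contraction mge q.
pose Tp i x y : R := \sum_(m < M | (m < m0)%N) G i m x y.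
have omega : r ^+ m0 * Om <= xi / 4.
  have := ler_wpM2r (ltW Om0) m0P; move/le_trans; apply.
  by apply: le_of_eq; field; rewrite lt0r_neq0.
have step1 : `|cyc (localize_cycle A F) - cyc (localize_cycle A Tp)| <= xi / 4.
  apply: le_trans omega.
  rewrite (@eq_cyc _ _ _ _ (localize_cycle A (fun i x y => \sum_(m < M) G i m x y))).
    exact: cyc_localize_tail.
  by move=> i x y; rewrite /localize_cycle /localize FG.
have step3 : `|cyc (localize_cycle A (fun i => sandwich E E (F i))) -
               cyc (localize_cycle A (fun i => sandwich E E (Tp i)))| <= xi / 4.
  apply: le_trans omega.
  rewrite (@eq_cyc _ _ _ _ (localize_cycle A (fun i x y =>
     \sum_(m < M) sandwich E E (G i m) x y))).
    rewrite (@eq_cyc _ _ _ (localize_cycle A (fun i => sandwich E E (Tp i)))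
     (localize_cycle A (fun i x y =>
     \sum_(m < M | (m < m0)%N) sandwich E E (G i m) x y))).
      apply: (cyc_localize_tail M m0 (G := fun i m => sandwich E E (G i m))) => i m'.
      exact: flat_sandwich.
    by move=> i x y; rewrite /localize_cycle /localize /Tp -sandwich_sum.
  move=> i x y; rewrite /localize_cycle /localize -sandwich_sum; congr (_ * _).
  by apply: eq_bigr => u _; apply: eq_bigr => v _; rewrite FG.
pose tt i x y : R := \sum_(lm : L) wt (i, lm, true) x * wt (i, lm, false) y.
have TpE i x y : good x -> good y -> Tp i x y = tt i x y * (s x * s y).
  move=> gx gy; rewrite /Tp Tab /tt mulr_suml; apply: eq_bigr => lm _.
  rewrite -[a0 i lm x]/(w (i, lm, true) x) -[b0 i lm y]/(w (i, lm, false) y).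
  rewrite (goodP x (i, lm, true) gx).1 (goodP y (i, lm, false) gy).1; ring.
have cell_good x u : cell q x u -> good x -> good u /\
    forall j, `|wt j u - wt j x| <= ka.
  move=> /eqP /qc [rdu gu] gx; have gu' : good u by rewrite gu.
  split => // j; apply: rdP; [exact: (goodP u j gu').2 | exact: (goodP x j gx).2|].
  by move/ffunP: rdu => /(_ j); rewrite !ffunE.
have ttn i x y : good x -> good y -> `|tt i x y| <= t.
  move=> gx gy; apply: (@le_trans _ _ (l * h ^+ 2)); last by rewrite lerDl.
  apply: le_trans (ler_norm_sum _ _ _) _.
  rewrite /l mulr_natl -sumr_const; apply: ler_sum => lm _.
  by rewrite (normrM (wt (i, lm, true) x)) expr2 ler_pM //
      ?(goodP x _ gx).2 ?(goodP y _ gy).2.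
have ttd i x y u v : good x -> good y -> cell q x u -> cell q y v ->
   `|tt i u v - tt i x y| <= e.
  move=> gx gy cu cv.
  have [gu du] := cell_good x u cu gx; have [gv dv] := cell_good y v cv gy.
  apply: (@le_trans _ _ (l * (2 * h * ka))).
    rewrite /tt -sumrB; apply: le_trans (ler_norm_sum _ _ _) _.
    rewrite /l mulr_natl -sumr_const; apply: ler_sum => lm _.
    set p := wt (i, lm, true); set p' := wt (i, lm, false).
    have -> : p u * p' v - p x * p' y = p u * (p' v - p' y) + (p u - p x) * p' y by ring.
    have -> : 2 * h * ka = h * ka + ka * h by ring.
    apply: le_trans (ler_normD _ _) _.
    rewrite (normrM (p u)) (normrM (p u - p x)).
    apply: lerD; apply: ler_pM; rewrite ?normr_ge0 ?du ?dv //.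
      exact: (goodP u (i, lm, true) gu).2.
    exact: (goodP y (i, lm, false) gy).2.
  have -> : l * (2 * h * ka) = 2 * h * l * ka by ring.
  rewrite /ka mulrA ler_pdivrMr //; lra. 
have step2 : `|cyc (localize_cycle A Tp) -
    cyc (localize_cycle A (fun i => sandwich E E (Tp i)))| <= xi / 2.
  apply: (@le_trans _ _ (k%:R * t ^+ k * e * mu0 ^+ k)); last first.
    have -> : k%:R * t ^+ k * e * mu0 ^+ k = Z * e by rewrite /Z; ring.
    rewrite /e; apply: (@le_trans _ _ ((Z + 1) * (xi / (2 * (Z + 1))))).
      by rewrite ler_wpM2r ?(ltW e0) // lerDl.
    by apply: le_of_eq; field; rewrite lt0r_neq0.
  have S0 x y : 0 <= s x * s y by rewrite mulr_ge0 ?sqrtr_ge0.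
  (* On a cell of positive mass the projected kernel is an average of tt; on a
     cell of mass zero the weights vanish and any value of g will do. *)
  have key i x y : good x -> good y -> exists g : R,
     [/\ sandwich E E (Tp i) x y = g * (s x * s y), `|g| <= t &
         `|tt i x y - g| <= e].
    move=> gx gy.
    have sw : sandwich E E (Tp i) x y = average m q (tt i) x y * (s x * s y).
      rewrite -(sandwich_cond mge) /sandwich.
      apply: eq_bigr => u _; apply: eq_bigr => v _.
      have [cu|cu] := boolP (cell q x u); last first.
        by rewrite /E /cond_kernel (negPf cu) mulr0 !mul0r.
      have [cv|cv] := boolP (cell q y v); last first.
        by rewrite /E [cond_kernel m q v y]cond_kernelC /cond_kernel
            (negPf cv) !(mulr0, mul0r).
      by rewrite TpE //;
        [have [] := cell_good x u cu gx | have [] := cell_good y v cv gy].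
    have [P0|P0] := eqVneq (measure m (cell q x)) 0.
      exists (tt i x y); split; [|exact: ttn|by rewrite subrr normr0 ltW].
      by rewrite sw /s (measure_cell0 mge P0) sqrtr0 mul0r !mulr0.
    have [Q0|Q0] := eqVneq (measure m (cell q y)) 0.
      exists (tt i x y); split; [|exact: ttn|by rewrite subrr normr0 ltW].
      by rewrite sw /s (measure_cell0 mge Q0) sqrtr0 !mulr0.
    exists (average m q (tt i) x y); split => //.
      apply: average_norm => // u v cu cv.
      by apply: ttn; [have [] := cell_good x u cu gx | have [] := cell_good y v cv gy].
    rewrite distrC -(average_cst (tt i x y) P0 Q0) averageB.
    apply: average_norm => //; first exact: ltW.
    by move=> u v cu cv; exact: ttd.
  have T0 x y : 0 <= t * (Num.sqrt (m x) * Num.sqrt (m y)).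
    by apply: mulr_ge0 => //; exact: S0.
  have E0 x y : 0 <= e * (Num.sqrt (m x) * Num.sqrt (m y)).
    by apply: mulr_ge0; [exact: ltW | exact: S0].
  apply: (cyc_close mge t1 (ltW e0) mmu) => i x y;
    rewrite /localize_cycle /localize.
  - have [Ax|_] := boolP (A i x); last by rewrite !mul0r normr0 T0.
    have [Ay|_] := boolP (A (ordS i) y); last by rewrite mulr0 mul0r normr0 T0.
    rewrite !mul1r TpE ?(Agood i x) ?(Agood (ordS i) y) // normrM (ger0_norm (S0 x y)).
    by rewrite ler_wpM2r // ttn ?(Agood i x) ?(Agood (ordS i) y).
  - have [Ax|_] := boolP (A i x); last by rewrite !mul0r normr0 T0.
    have [Ay|_] := boolP (A (ordS i) y); last by rewrite mulr0 mul0r normr0 T0.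
    have [g [-> gt _]] := key i x y (Agood _ _ Ax) (Agood _ _ Ay).
    by rewrite !mul1r normrM (ger0_norm (S0 x y)) ler_wpM2r.
  - have [Ax|_] := boolP (A i x); last by rewrite !mul0r subrr normr0 E0.
    have [Ay|_] := boolP (A (ordS i) y); last first.
      by rewrite mulr0 !mul0r subrr normr0 E0.
    have [g [-> _ ge]] := key i x y (Agood _ _ Ax) (Agood _ _ Ay).
    rewrite !mul1r TpE ?(Agood i x) ?(Agood (ordS i) y) // -mulrBl normrM
      (ger0_norm (S0 x y)).
    by rewrite ler_wpM2r.
rewrite ler_norml in step1; rewrite ler_norml in step2; rewrite ler_norml in step3.
move: step1 step2 step3 => /andP[? ?] /andP[? ?] /andP[? ?].
by rewrite ler_norml; apply/andP; split; lra.
Qed.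

End Count.

(** * The energy of a partition *)

Section Energy.
Variables (R : realType) (Y : finType) (m : Y -> R).
Hypothesis m0 : forall y, 0 <= m y.

(** The function 1 / (1 + t) is convex and bounded, so the energy is bounded whatever
    the size of f. *)
Definition energy (T : eqType) (q : Y -> T) (f : Y -> Y -> R) : R :=
  \sum_x \sum_y m x * m y * (1 + average m q f x y)^-1.

Definition refines (T T' : eqType) (q' : Y -> T') (q : Y -> T) : Prop :=
  forall x y, q' x = q' y -> q x = q y.

Variables (f : Y -> Y -> R).
Hypothesis f0 : forall x y, 0 <= f x y.

Lemma energy_bounds (T : eqType) (q : Y -> T) mu0 : \sum_y m y <= mu0 ->
  0 <= energy q f <= mu0 ^+ 2.
Proof.
move=> mmu; have a0 x y := average_ge0 m0 q x y f0.
have S0 : 0 <= \sum_y m y by exact: sumr_ge0.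
apply/andP; split.
  apply: sumr_ge0 => x _; apply: sumr_ge0 => y _.
  by rewrite !mulr_ge0 // invr_ge0 addr_ge0.
apply: (@le_trans _ _ ((\sum_y m y) ^+ 2)); last first.
  by rewrite lerXn2r ?nnegrE ?(le_trans S0).
rewrite expr2 mulr_suml; apply: ler_sum => x _; rewrite mulr_sumr.
apply: ler_sum => y _; rewrite ler_piMr ?mulr_ge0 //.
by rewrite invf_le1 ?lerDl // ltr_wpDr.
Qed.

(** With a the coarse and b the fine average,
    1/(1+b) - 1/(1+a) + (b-a)/(1+a)^2 = (b-a)^2 / ((1+b)(1+a)^2).  The linear term
    integrates to zero, because its coefficient is constant on coarse cells. *)
Lemma energy_increment (T T' : eqType) (q : Y -> T) (q' : Y -> T') :
  refines q' q ->
  energy q' f - energy q f =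
  \sum_x \sum_y m x * m y *
    ((average m q' f x y - average m q f x y) ^+ 2 /
     ((1 + average m q' f x y) * (1 + average m q f x y) ^+ 2)).
Proof.
move=> q'q.
have a0 x y := average_ge0 m0 q x y f0.
have a0' x y := average_ge0 m0 q' x y f0.
pose g x y := ((1 + average m q f x y) ^+ 2)^-1.
have gq x y x' y' : q x = q x' -> q y = q y' -> g x y = g x' y'.
  by move=> qx qy; rewrite /g (eq_average m f qx qy).
have e1 := @sum_average R Y m m0 _ q f g gq.
have e2 := @sum_average R Y m m0 _ q' f g
  (fun x y x' y' h h' => gq _ _ _ _ (q'q _ _ h) (q'q _ _ h')).
apply/eqP; rewrite -subr_eq0; apply/eqP.
transitivity (\sum_x \sum_y m x * m y * (average m q f x y * g x y) -
              \sum_x \sum_y m x * m y * (average m q' f x y * g x y)); last first.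
  by rewrite e1 e2 subrr.
rewrite /energy -!sumrB; apply: eq_bigr => x _; rewrite -!sumrB; apply: eq_bigr => y _.
have := a0 x y; have := a0' x y; rewrite /g.
move: (average _ _ _ _ _) (average _ _ _ _ _) => a b b0 a00.
by field; apply/andP; split; lra.
Qed.

Lemma energy_incr_ge0 (T T' : eqType) (q : Y -> T) (q' : Y -> T') :
  refines q' q -> energy q f <= energy q' f.
Proof.
move=> q'q; rewrite -subr_ge0 energy_increment //.
apply: sumr_ge0 => x _; apply: sumr_ge0 => y _.
have := average_ge0 m0 q x y f0; have := average_ge0 m0 q' x y f0 => a0 b0.
apply: mulr_ge0; first exact: mulr_ge0.
by rewrite divr_ge0 ?sqr_ge0 // mulr_ge0 ?sqr_ge0 // addr_ge0.
Qed.

(** Where the coarse average lies in [c, K] and the fine one is below c / 2, they differ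
    by at least c / 2 and both are at most K. *)
Lemma energy_drop (T T' : eqType) (q : Y -> T) (q' : Y -> T') (c K : R) :
  0 < c -> 0 < K -> refines q' q ->
  \sum_x \sum_y m x * m y * ((average m q' f x y < c / 2)%R%:R *
     ((c <= average m q f x y) && (average m q f x y <= K))%R%:R) <=
  (energy q' f - energy q f) * ((1 + K) ^+ 3 * 4 / c ^+ 2).
Proof.
move=> c0 K0 q'q; rewrite energy_increment // mulr_suml; apply: ler_sum => x _.
rewrite mulr_suml; apply: ler_sum => y _.
rewrite -[leRHS]mulrA ler_wpM2l ?mulr_ge0 //.
have := average_ge0 m0 q x y f0; have := average_ge0 m0 q' x y f0.
move: (average _ _ _ _ _) (average _ _ _ _ _) => b a a0 b0.
have X0 : 0 <= (a - b) ^+ 2 / ((1 + a) * (1 + b) ^+ 2) * ((1 + K) ^+ 3 * 4 / c ^+ 2).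
  have K1 : 0 <= 1 + K by rewrite addr_ge0 ?(ltW K0).
  have a1 : 0 <= 1 + a by rewrite addr_ge0. 
  apply: mulr_ge0; apply: divr_ge0; rewrite ?sqr_ge0 //; apply: mulr_ge0 => //.
    exact: sqr_ge0.
  exact: exprn_ge0.
case: ltP => ac; last by rewrite mul0r.
case: (leP c b) => cb /=; last by rewrite mulr0.
case: (leP b K) => bK /=; last by rewrite mulr0.
have d : (c / 2) ^+ 2 <= (a - b) ^+ 2.
  by rewrite -[leRHS]sqrrN opprB lerXn2r ?nnegrE; lra.
have e : (1 + a) * (1 + b) ^+ 2 <= (1 + K) ^+ 3.
  rewrite [leRHS]exprS ler_pM ?addr_ge0 ?sqr_ge0 //; first lra.
  by rewrite lerXn2r ?nnegrE ?addr_ge0 ?(ltW K0) // lerD2l.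
have e0 : 0 < (1 + a) * (1 + b) ^+ 2 by rewrite mulr_gt0 ?exprn_gt0 //; lra.
have c2 : 0 < c ^+ 2 by rewrite exprn_gt0.
have h1 : 1 <= (a - b) ^+ 2 * (4 / c ^+ 2).
  by rewrite mulrA ler_pdivlMr // mul1r; move: d; rewrite expr_div_n; lra.
have K3 : 0 <= (1 + K) ^+ 3 by rewrite exprn_ge0 ?addr_ge0 ?(ltW K0).
have -> : (a - b) ^+ 2 / ((1 + a) * (1 + b) ^+ 2) * ((1 + K) ^+ 3 * 4 / c ^+ 2) =
  ((a - b) ^+ 2 * (4 / c ^+ 2)) * (1 + K) ^+ 3 / ((1 + a) * (1 + b) ^+ 2) by ring.
rewrite mulr1 ler_pdivlMr // mul1r; apply: le_trans e _.
by rewrite ler_peMl.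
Qed.

End Energy.

(** * A union bound for weighted cycles *)

Section LowerBound.
Variables (R : realType) (Y : finType) (k : nat).

(** Fixing the two endpoints of the edge, the remaining coordinates are independent. *)
Lemma sum_prod_edge (w : 'I_k -> Y -> R) (h : Y -> Y -> R) (i i' : 'I_k) :
  i' != i ->
  \sum_(y : {ffun 'I_k -> Y}) (\prod_j w j (y j)) * h (y i) (y i') =
  (\prod_(j | (j != i) && (j != i')) \sum_u w j u) *
  \sum_u \sum_v w i u * w i' v * h u v.
Proof.
move=> ii'.
(* The indicator of the endpoints u and v is absorbed into the weights. *)
pose W u v j z : R := w j z *
  (if j == i then (z == u)%:R else if j == i' then (z == v)%:R else 1).
have WE u v (y : {ffun 'I_k -> Y}) : \prod_j W u v j (y j) =
    (\prod_j w j (y j)) * ((y i == u)%:R * (y i' == v)%:R).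
  rewrite big_split /=; congr (_ * _).
  rewrite (bigD1 i) //= eqxx; congr (_ * _).
  rewrite (bigD1 i') //= (negPf ii') eqxx big1 ?mulr1 //.
  by move=> j /andP[/negPf -> /negPf ->].
transitivity (\sum_u \sum_v h u v * \sum_(y : {ffun 'I_k -> Y}) \prod_j W u v j (y j)).
  under [RHS]eq_bigr do under eq_bigr do rewrite mulr_sumr.
  under [RHS]eq_bigr do rewrite exchange_big /=.
  rewrite exchange_big /=; apply: eq_bigr => y _.
  rewrite (bigD1 (y i)) //= [X in _ + X]big1 ?addr0; last first.
    move=> u /negPf yu; apply: big1 => v _.
    by rewrite WE eq_sym yu mul0r !mulr0.
  rewrite (bigD1 (y i')) //= [X in _ + X]big1 ?addr0; last first.
    by move=> v /negPf yv; rewrite WE [y i' == v]eq_sym yv !mulr0.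
  by rewrite WE !eqxx !mulr1 mulrC.
rewrite mulr_sumr; apply: eq_bigr => u _; rewrite mulr_sumr; apply: eq_bigr => v _.
rewrite -(bigA_distr_bigA (W u v)) (bigD1 i) //= (bigD1 i') //=.
have sW (j : 'I_k) (z : Y) : \sum_y w j y * (y == z)%:R = w j z.
  rewrite (bigD1 z) //= eqxx mulr1 big1 ?addr0 // => y /negPf ->.
  by rewrite mulr0.
have -> : \sum_y W u v i y = w i u by rewrite /W eqxx sW.
have -> : \sum_y W u v i' y = w i' v by rewrite /W (negPf ii') eqxx sW.
have -> : \prod_(j | (j != i) && (j != i')) \sum_y W u v j y =
          \prod_(j | (j != i) && (j != i')) \sum_y w j y.
  apply: eq_bigr => j /andP[/negPf ji /negPf ji']; apply: eq_bigr => y _.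
  by rewrite /W ji ji' mulr1.
ring.
Qed.

(** A union bound: the product of the g i is at least c^k unless some edge is exceptional
    (h i at least 1), and the exceptional edges carry at most half of the product
    weight. *)
Lemma sum_prod_ge (w : 'I_k -> Y -> R) (g h : 'I_k -> Y -> Y -> R)
    (c th : R) (P : 'I_k -> R) :
  (2 <= k)%N -> 0 <= c -> 0 <= th ->
  (forall i y, 0 <= w i y) ->
  (forall i x y, 0 <= g i x y) -> (forall i x y, 0 <= h i x y) ->
  (forall i x y, c <= g i x y \/ 1 <= h i x y) ->
  (forall i, 0 <= P i) ->
  (forall i, P i <= \sum_u w i u) ->
  (forall i, \sum_u \sum_v w i u * w (ordS i) v * h i u v <=
     th * (P i * P (ordS i))) ->
  k%:R * th <= 2^-1 ->
  c ^+ k * 2^-1 * \prod_i (\sum_u w i u) <=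
  \sum_(y : {ffun 'I_k -> Y}) (\prod_j w j (y j)) * \prod_i g i (y i) (y (ordS i)).
Proof.
move=> k2 c0 th0 w0 g0 h0 gh P0 PS hP thk.
have S0 i : 0 <= \sum_u w i u by exact: sumr_ge0.
apply: (@le_trans _ _ (\sum_(y : {ffun 'I_k -> Y}) (\prod_j w j (y j)) *
    (c ^+ k * (1 - \sum_i h i (y i) (y (ordS i)))))); last first.
  apply: ler_sum => y _; rewrite ler_wpM2l ?prodr_ge0 //.
  have Sh0 (Q : pred 'I_k) : 0 <= \sum_(i | Q i) h i (y i) (y (ordS i)).
    exact: sumr_ge0.
  have [/forallP all|] := boolP [forall i, c <= g i (y i) (y (ordS i))].
    apply: (@le_trans _ _ (c ^+ k)); first by rewrite ler_piMr ?exprn_ge0 // gerBl.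
    rewrite -[k in c ^+ k]card_ord -prodr_const; apply: ler_prod => i _.
    by rewrite c0 all.
  rewrite negb_forall => /existsP[i ci].
  have h1 : 1 <= h i (y i) (y (ordS i)).
    by case: (gh i (y i) (y (ordS i))) => // cg; rewrite cg in ci.
  apply: (@le_trans _ _ 0); last exact: prodr_ge0.
  rewrite mulr_ge0_le0 ?exprn_ge0 // subr_le0 (bigD1 i) //=.
  by rewrite ler_wpDr.
under [leRHS]eq_bigr do rewrite mulrCA.
rewrite -mulr_sumr -mulrA ler_wpM2l ?exprn_ge0 //.
under [leRHS]eq_bigr do rewrite mulrBr mulr1 mulr_sumr.
rewrite sumrB -(bigA_distr_bigA w) exchange_big /=.
set PS' := \prod_i \sum_u w i u.
have PS0 : 0 <= PS' by exact: prodr_ge0.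
suff : \sum_i \sum_(y : {ffun 'I_k -> Y}) (\prod_j w j (y j)) * h i (y i) (y (ordS i))
   <= 2^-1 * PS' by lra.
apply: (@le_trans _ _ (\sum_(i < k) th * PS')); last first.
  by rewrite sumr_const card_ord -[leLHS]mulr_natl mulrA ler_wpM2r.
apply: ler_sum => i _.
have ii : ordS i != i.
  rewrite -val_eqE /=; apply/eqP => e.
  have := ltn_ord i; rewrite leq_eqVlt => /orP[/eqP ek|lt].
    by move: e; rewrite ek modnn => e; rewrite -ek -e in k2.
  by move: e; rewrite modn_small //; apply/eqP; rewrite neq_ltn ltnSn orbT.
have -> : PS' = (\sum_u w i u) * ((\sum_u w (ordS i) u) *
    \prod_(j | (j != i) && (j != ordS i)) \sum_u w j u).
  by rewrite /PS' (bigD1 i) //= (bigD1 (ordS i)).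
rewrite sum_prod_edge //.
set Q := \prod_(j | _) _; have Q0 : 0 <= Q by exact: prodr_ge0.
apply: (@le_trans _ _ (Q * (th * (P i * P (ordS i))))); first by rewrite ler_wpM2l.
have -> : th * ((\sum_u w i u) * ((\sum_u w (ordS i) u) * Q)) =
  Q * (th * ((\sum_u w i u) * (\sum_u w (ordS i) u))) by ring.
by rewrite !ler_wpM2l // ler_pM.
Qed.

End LowerBound.

(** * Mass estimates and merging of tiny cells *)

Section Mass.
Variable R : realType.

(** The operator norms of the layers sum to a geometric series. *)
Lemma tame_form (X Y : finType) C N (F : X -> Y -> R) a b : 0 < C ->
  tame C N F ->
  `|\sum_x \sum_y a x * F x y * b y| <= 2 * C * Num.sqrt (norm2 a * norm2 b).
Proof.
move=> C0 [M [G [FG Gf]]].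
have -> : \sum_x \sum_y a x * F x y * b y =
    \sum_(m < M) \sum_x \sum_y a x * G m x y * b y.
  rewrite [RHS]exchange_big /=; apply: eq_bigr => x _.
  rewrite [RHS]exchange_big /=; apply: eq_bigr => y _.
  by rewrite FG mulr_sumr mulr_suml.
apply: le_trans (ler_norm_sum _ _ _) _.
have half0 : 0 <= 2^-1 :> R by rewrite invr_ge0.
have half1 : 2^-1 < 1 :> R by lra.
apply: (@le_trans _ _ (\sum_(m < M) C * 2^-1 ^+ m * Num.sqrt (norm2 a * norm2 b))).
  apply: ler_sum => m _; apply: sqr_le_norm.
    by rewrite !mulr_ge0 ?sqrtr_ge0 ?exprn_ge0 ?(ltW C0).
  rewrite exprMn sqr_sqrtr ?mulr_ge0 ?norm2_ge0 // exprVn.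
  by have [Go _] := Gf m; exact: op_bound_form.
rewrite -mulr_suml -mulr_sumr ler_wpM2r ?sqrtr_ge0 // mulrC.
rewrite ler_wpM2r ?(ltW C0) //; apply: le_trans (sum_geometric _ half0 half1) _.
have -> : 1 - 2^-1 = 2^-1 :> R by lra.
by rewrite invrK.
Qed.

Section Space.
Variables (Y : finType) (m : Y -> R).
Hypothesis m0 : forall y, 0 <= m y.

Definition weighted (f : Y -> Y -> R) (x y : Y) : R :=
  f x y * (Num.sqrt (m x) * Num.sqrt (m y)).

Definition mass_on (f : Y -> Y -> R) (Q : Y -> pred Y) : R :=
  \sum_x \sum_y m x * m y * (f x y * (Q x y)%:R).

Lemma mass_on_sub f (Q Q' : Y -> pred Y) : (forall x y, 0 <= f x y) ->
  (forall x y, Q x y -> Q' x y) -> mass_on f Q <= mass_on f Q'.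
Proof.
move=> f0 QQ'; apply: ler_sum => x _; apply: ler_sum => y _.
rewrite ler_wpM2l ?mulr_ge0 // ler_wpM2l //.
by case: (boolP (Q x y)) => [/QQ' ->//|_]; rewrite ler0n.
Qed.

Lemma mass_on_rectangle C N f (A B : pred Y) : 0 < C ->
  (forall x y, 0 <= f x y) -> tame C N (weighted f) ->
  mass_on f (fun x y => A x && B y) <=
  2 * C * Num.sqrt (measure m A * measure m B).
Proof.
move=> C0 f0 ft.
pose ind (D : pred Y) y : R := Num.sqrt (m y) * (D y)%:R.
have nind D : norm2 (ind D) = measure m D.
  rewrite /norm2 /measure [RHS]big_mkcond /=; apply: eq_bigr => y _.
  by rewrite exprMn sqr_sqrtr //; case: (D y);
    rewrite ?mulr1 ?expr1n ?mulr1 // expr0n mulr0.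
have := tame_form (ind A) (ind B) C0 ft; rewrite !nind; apply: le_trans.
apply: le_trans (ler_norm _); apply: le_of_eq.
apply: eq_bigr => x _; apply: eq_bigr => y _.
rewrite /ind /weighted -{1}(sqr_sqrtr (m0 x)) -{1}(sqr_sqrtr (m0 y)).
by case: (A x); case: (B y) => /=; rewrite ?(mulr0, mul0r) //; ring.
Qed.

(** A strip over a set of small measure has small mass: pair the kernel with the
    indicators, whose l^2 norms are square roots of measures. *)
Lemma mass_on_thin C N f (A : pred Y) mu0 : 0 < C ->
  (forall x y, 0 <= f x y) -> tame C N (weighted f) -> \sum_y m y <= mu0 ->
  mass_on f (fun x y => A x || A y) <= 4 * C * Num.sqrt (measure m A * mu0).
Proof.
move=> C0 f0 ft mmu.
have A0 := measure_ge0 m0 A.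
have mono (B : pred Y) : measure m B <= mu0.
  by apply: le_trans mmu; rewrite /measure big_mkcond /= ler_sum // => y _; case: ifP.
have le1 : mass_on f (fun x y => A x && predT y) <= 2 * C * Num.sqrt (measure m A * mu0).
  apply: le_trans (mass_on_rectangle A predT C0 f0 ft) _.
  by rewrite ler_wpM2l ?mulr_ge0 ?(ltW C0) // ler_wsqrtr // ler_wpM2l.
have le2 : mass_on f (fun x y => predT x && A y) <= 2 * C * Num.sqrt (measure m A * mu0).
  apply: le_trans (mass_on_rectangle predT A C0 f0 ft) _.
  by rewrite ler_wpM2l ?mulr_ge0 ?(ltW C0) // ler_wsqrtr // mulrC ler_wpM2l.
apply: (@le_trans _ _ (mass_on f (fun x y => A x && predT y) +
                       mass_on f (fun x y => predT x && A y))); last lra.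
rewrite /mass_on -big_split; apply: ler_sum => x _ /=.
rewrite -big_split; apply: ler_sum => y _ /=.
rewrite -mulrDr ler_wpM2l ?mulr_ge0 // -mulrDr ler_wpM2l // -natrD ler_nat.
by case: (A x); case: (A y).
Qed.

Lemma measure_by_cells (T : finType) (q : Y -> T) (A : pred Y) t : 0 <= t ->
  (forall x, A x -> measure m (fun y => A y && cell q x y) <= t) ->
  measure m A <= #|T|%:R * t.
Proof.
move=> t0 At; rewrite /measure (partition_big q predT) //=.
rewrite mulr_natl -sumr_const; apply: ler_sum => s _.
have [x /andP[Ax /eqP qx]|none] := pickP (fun x => A x && (q x == s)).
  by apply: le_trans (At x Ax); rewrite /measure /cell qx.
by rewrite big_pred0.
Qed.

Definition tiny (T : eqType) (q : Y -> T) (tau : R) : pred Y :=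
  fun x => measure m (cell q x) < tau.

Lemma measure_tiny (T : finType) (q : Y -> T) tau : 0 <= tau ->
  measure m (tiny q tau) <= #|T|%:R * tau.
Proof.
move=> tau0; apply: (measure_by_cells (q := q)) => // x tx.
apply: le_trans (ltW tx); apply: measure_sub => // y /andP[] //.
Qed.

(** In each p0-class send all tiny cells to one big cell of that class, which exists by
    averaging.  The tiny cells together are small compared to it, so a cell that is not
    tiny grows by a factor 4/3 at most. *)
Lemma merge_tiny (T0 T : finType) (p0 : Y -> T0) (q : Y -> T) (M : nat) (tau0 tau : R) :
  (0 < M)%N -> (#|T| <= M)%N -> 0 < tau ->
  6 * M%:R ^+ 2 * tau <= tau0 ->
  refines q p0 -> (forall x, tau0 <= measure m (cell p0 x)) ->
  exists (T' : finType) (p : Y -> T'),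
    [/\ refines p p0, forall x, tau <= measure m (cell p x) &
        forall x, ~~ tiny q tau x ->
          (forall u, cell q x u -> cell p x u) /\
          measure m (cell p x) <= 4 / 3 * measure m (cell q x)].
Proof.
move=> M0 TM tau_gt0 tauM qp0 p0t.
have MR : 1 <= M%:R :> R by rewrite ler1n.
have M0R : 0 < M%:R :> R by lra.
have tau00 : 0 < tau0.
  by apply: lt_le_trans tauM; rewrite !mulr_gt0 ?exprn_gt0.
pose th := tau0 / (2 * M%:R).
have th0 : 0 < th by rewrite divr_gt0 // mulr_gt0.
have tauth : 3 * (M%:R * tau) <= th.
  rewrite ler_pdivlMr ?mulr_gt0 //.
  by apply: le_trans tauM; apply: le_of_eq; ring.
have tau_th : tau <= th.
  apply: le_trans tauth; have := ler_wpM2r (ltW tau_gt0) MR; rewrite mul1r; lra.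
have tinyM : 3 * measure m (tiny q tau) <= th.
  apply: le_trans tauth; rewrite ler_wpM2l //.
  apply: le_trans (measure_tiny q (ltW tau_gt0)) _.
  by rewrite ler_wpM2r ?(ltW tau_gt0) // ler_nat.
have ex_big (t : T0) : exists s : option T, forall y, p0 y = t ->
    exists z, [/\ s = Some (q z), p0 z = t & th <= measure m (cell q z)].
  have [z /andP[/eqP pz qz]|none] :=
      pickP (fun z => (p0 z == t) && (th <= measure m (cell q z))).
    by exists (Some (q z)) => y _; exists z.
  exists None => y py; exfalso.
  have : measure m (cell p0 y) <= M%:R * th.
    apply: (@le_trans _ _ (#|T|%:R * th)); last first.
      by rewrite ler_wpM2r ?(ltW th0) // ler_nat.
    apply: (measure_by_cells (q := q)); first exact: ltW.
    move=> x /eqP px; have := none x; rewrite /= px py eqxx /= => /negbT.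
    rewrite -ltNge => /ltW; apply: le_trans; apply: measure_sub => // u /andP[] //.
  have -> : M%:R * th = tau0 / 2 by rewrite /th; field; rewrite lt0r_neq0.
  by have := p0t y; lra.
have [big bigP] := fin_all_exists ex_big.
pose p x : option T := if tiny q tau x then big (p0 x) else Some (q x).
have pP x : exists z, [/\ p x = Some (q z), p0 z = p0 x, ~~ tiny q tau z &
     (tiny q tau x -> th <= measure m (cell q z))].
  rewrite /p; case: (boolP (tiny q tau x)) => tx; last by exists x; split.
  have [z [bz pz hz]] := bigP (p0 x) x erefl; exists z; split => //.
  by rewrite /tiny -leNgt (le_trans tau_th).
have okp x : ~~ tiny q tau x -> forall u, cell q x u -> cell p x u.
  move=> tx u /eqP qu; rewrite /cell /p (negPf tx).
  have -> : tiny q tau u = false.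
    by apply: negbTE; rewrite /tiny /measure (eq_bigl _ _ (eq_cell qu)).
  by rewrite qu.
exists (option T), p; split.
- move=> x y pxy; have [z [pz zx _ _]] := pP x; have [z' [pz' zy _ _]] := pP y.
  rewrite -zx -zy; apply: qp0; by move: pxy; rewrite pz pz' => -[].
- move=> x; have [z [pz _ tz _]] := pP x.
  have pzz : p z = Some (q z) by rewrite /p (negPf tz).
  apply: (@le_trans _ _ (measure m (cell q z))); first by rewrite leNgt.
  apply: measure_sub => // u cu.
  by have := okp z tz u cu; rewrite /cell pzz -pz.
move=> x tx; split; first exact: okp.
have pxx : p x = Some (q x) by rewrite /p (negPf tx).
have cell_p u : cell p x u -> cell q x u || tiny q tau u.
  rewrite /cell pxx /p; case: (tiny q tau u); rewrite ?orbT //= orbF.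
  by move/eqP => [->].
have [u /andP[cu tu]|none] := pickP (fun u => cell p x u && tiny q tau u).
  have [z [pz _ _ hz]] := pP u.
  have qz : q z = q x by move/eqP: cu; rewrite pz pxx => -[].
  have big_x : th <= measure m (cell q x).
    apply: le_trans (hz tu) _; rewrite /measure (eq_bigl _ _ (eq_cell qz)); exact: lexx.
  apply: (@le_trans _ _ (measure m (cell q x) + measure m (tiny q tau))); last by lra.
  rewrite /measure [leLHS]big_mkcond [X in _ <= X + _]big_mkcond
    [X in _ <= _ + X]big_mkcond -big_split /=.
  apply: ler_sum => v _; case: ifP => [/cell_p|_].
    by case: (cell q x v); case: (tiny q tau v) => //= _; rewrite ?lerDl ?addr0 ?add0r.
  by rewrite addr_ge0 //; case: ifP.
have P0 := measure_ge0 m0 (cell q x).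
apply: (@le_trans _ _ (measure m (cell q x))); last lra.
apply: measure_sub => // v cv; case/orP: (cell_p v cv) => // tv.
by have := none v; rewrite /= cv tv.
Qed.

(** The mass of a pair of cells can only grow under merging, and its measure grows by at
    most (4/3)^2 < 2. *)
Lemma average_merge (T T' : eqType) (q : Y -> T) (p : Y -> T') f x y :
  (forall u v, 0 <= f u v) ->
  (forall u, cell q x u -> cell p x u) -> (forall u, cell q y u -> cell p y u) ->
  0 < measure m (cell q x) -> 0 < measure m (cell q y) ->
  measure m (cell p x) <= 4 / 3 * measure m (cell q x) ->
  measure m (cell p y) <= 4 / 3 * measure m (cell q y) ->
  average m q f x y <= 2 * average m p f x y.
Proof.
move=> f0 qpx qpy Px Py ex ey; rewrite /average.
have px : measure m (cell q x) <= measure m (cell p x) by exact: measure_sub.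
have py : measure m (cell q y) <= measure m (cell p y) by exact: measure_sub.
have S : \sum_(u | cell q x u) \sum_(v | cell q y v) m u * m v * f u v <=
         \sum_(u | cell p x u) \sum_(v | cell p y v) m u * m v * f u v.
  have h0 u v : 0 <= m u * m v * f u v by rewrite !mulr_ge0.
  rewrite [leLHS]big_mkcond [leRHS]big_mkcond; apply: ler_sum => u _ /=.
  case: (boolP (cell q x u)) => [/qpx ->|_]; last first.
    by case: ifP => // _; exact: sumr_ge0.
  rewrite [leLHS]big_mkcond [leRHS]big_mkcond; apply: ler_sum => v _ /=.
  by case: (boolP (cell q y v)) => [/qpy ->//|_]; case: ifP.
have S0 : 0 <= \sum_(u | cell q x u) \sum_(v | cell q y v) m u * m v * f u v.
  by apply: sumr_ge0 => u _; apply: sumr_ge0 => v _; rewrite !mulr_ge0.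
move: (\sum_(u | cell q x u) _) (\sum_(u | cell p x u) _) S S0 => s s' ss s0.
move: (measure m (cell q x)) (measure m (cell q y)) (measure m (cell p x))
  (measure m (cell p y)) Px Py ex ey px py => a b a' b' a0 b0 aa bb a1 b1.
have a'0 : 0 < a' by lra.
have b'0 : 0 < b' by lra.
rewrite mulrA ler_pdivrMr ?mulr_gt0 // mulrAC ler_pdivlMr ?mulr_gt0 //.
have ab : a' * b' <= 2 * (a * b).
  have : a' * b' <= (4 / 3 * a) * (4 / 3 * b) by apply: ler_pM; lra.
  have : 0 <= a * b by rewrite mulr_ge0 ?ltW.
  by move=> ? ?; lra.
rewrite [2 * s']mulrC -mulrA; apply: ler_pM => //.
by rewrite mulr_ge0 ?ltW.
Qed.

End Space.
End Mass.

(** * The edges to keep *)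

Section EdgeSet.
Variables (R : realType) (Y : finType) (m : Y -> R).
Hypothesis m0 : forall y, 0 <= m y.
Variables (T T' : finType) (q : Y -> T) (q' : Y -> T').

(** Indicator of the pairs at which the fine average is low. *)
Definition low (f : Y -> Y -> R) (c : R) (u v : Y) : R :=
  (average m q' f u v < c / 2)%R%:R.

(** The last condition is a density: the q-average of the indicator [low] is the
    proportion of low pairs in the product of the two cells. *)
Definition edge_set (f : Y -> Y -> R) (tau c K eta : R) (x y : Y) : bool :=
  [&& ~~ tiny m q tau x, ~~ tiny m q tau y, c <= average m q f x y,
      average m q f x y <= K & average m q (low f c) x y <= eta].

(** The deleted edges fall into four parts of mass at most eps / 4: edges at a tiny cell,
    edges with small average, edges with large average, and edges in a product of cells
    with too many low pairs.  For the last one, by Markov the measure of such products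
    is at most the measure of all low pairs divided by eta, which the energy bounds. *)
Lemma edge_set_mass f C N tau c K eta theta eps mu0 :
  0 < C -> 0 < c -> 0 < K -> 0 < eta ->
  (forall x y, 0 <= f x y) -> tame C N (weighted m f) -> \sum_y m y <= mu0 ->
  refines q' q -> energy m q' f - energy m q f <= theta ->
  4 * C * Num.sqrt (measure m (tiny m q tau) * mu0) <= eps / 4 ->
  mass_on m f (fun x y => [&& ~~ tiny m q tau x, ~~ tiny m q tau y &
                              K < average m q f x y]) <= eps / 4 ->
  c * mu0 ^+ 2 <= eps / 4 ->
  K * (theta * ((1 + K) ^+ 3 * 4 / c ^+ 2) / eta) <= eps / 4 ->
  mass_on m f (fun x y => ~~ edge_set f tau c K eta x y) <= eps.
Proof.
move=> C0 c0 K0 eta0 f0 ft mmu q'q en h1 h3 h2 h4.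
have a0 x y := average_ge0 m0 q x y f0.
have S0 : 0 <= \sum_y m y by exact: sumr_ge0.
pose mid x y := (c <= average m q f x y) && (average m q f x y <= K).
pose irr x y := mid x y && (eta < average m q (low f c) x y).
have avgq g x y x' y' : q x = q x' -> q y = q y' ->
    average m q g x y = average m q g x' y' by exact: eq_average.
have massE (Q : Y -> Y -> bool) :
    (forall x y x' y', q x = q x' -> q y = q y' -> Q x y = Q x' y') ->
    mass_on m f Q = \sum_x \sum_y m x * m y * (average m q f x y * (Q x y)%:R).
  move=> Qq; rewrite /mass_on -(sum_average (q := q) m0) // => x y x' y' hx hy.
  by rewrite (Qq _ _ _ _ hx hy).
have b2 : mass_on m f (fun x y => average m q f x y < c) <= eps / 4.
  apply: le_trans h2; rewrite massE; last first.
    by move=> x y x' y' hx hy; rewrite (avgq f _ _ _ _ hx hy).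
  apply: (@le_trans _ _ (c * (\sum_y m y) ^+ 2)); last first.
    by rewrite ler_wpM2l ?(ltW c0) // lerXn2r ?nnegrE ?(le_trans S0).
  rewrite expr2 mulr_suml mulr_sumr; apply: ler_sum => x _.
  rewrite mulr_sumr mulr_sumr; apply: ler_sum => y _.
  rewrite [leRHS]mulrC ler_wpM2l ?mulr_ge0 //.
  by case: ltP => [/ltW|_]; rewrite ?mulr1 ?mulr0 ?(ltW c0).
have b4 : mass_on m f irr <= eps / 4.
  apply: le_trans h4; rewrite massE; last first.
    by move=> x y x' y' hx hy; rewrite /irr /mid !(avgq _ _ _ _ _ hx hy).
  apply: (@le_trans _ _ (K / eta * \sum_x \sum_y m x * m y *
      (average m q (low f c) x y * (mid x y)%:R))).
    rewrite mulr_sumr; apply: ler_sum => x _; rewrite mulr_sumr; apply: ler_sum => y _.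
    rewrite [leRHS]mulrCA ler_wpM2l ?mulr_ge0 //.
    have l0 : 0 <= average m q (low f c) x y.
      by apply: average_ge0 => // u v; exact: ler0n.
    rewrite /irr; case: (boolP (mid x y)) => [/andP[_ fK]|_] /=; last by rewrite !mulr0.
    rewrite mulr1; case: ltP => [lt|_] /=; rewrite ?mulr1 ?mulr0; last first.
      by apply: mulr_ge0 => //; rewrite divr_ge0 ?(ltW K0) ?(ltW eta0).
    apply: le_trans fK _; rewrite -mulrA ler_peMr ?(ltW K0) // mulrC ler_pdivlMr // mul1r.
    exact: ltW.
  rewrite (sum_average (q := q) m0); last first.
    by move=> x y x' y' hx hy; rewrite /mid !(avgq _ _ _ _ _ hx hy).
  rewrite -mulrA ler_wpM2l ?(ltW K0) // mulrC ler_wpM2r ?invr_ge0 ?(ltW eta0) //.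
  apply: le_trans (energy_drop m0 f0 c0 K0 q'q) _.
  by rewrite ler_wpM2r // !(mulr_ge0, invr_ge0, exprn_ge0) //
    ?addr_ge0 ?(ltW c0) ?(ltW K0).
have b1 := le_trans (mass_on_thin m0 (tiny m q tau) C0 f0 ft mmu) h1.
apply: (@le_trans _ _ (mass_on m f (fun x y => tiny m q tau x || tiny m q tau y) +
  mass_on m f (fun x y => average m q f x y < c) +
  mass_on m f (fun x y => [&& ~~ tiny m q tau x, ~~ tiny m q tau y &
                              K < average m q f x y]) + mass_on m f irr)); last lra.
rewrite /mass_on -!big_split; apply: ler_sum => x _ /=.
rewrite -!big_split; apply: ler_sum => y _ /=.
rewrite -!mulrDr ler_wpM2l ?mulr_ge0 // ler_wpM2l // -!natrD ler_nat.
rewrite /edge_set /irr /mid !leNgt.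
case: (tiny m q tau x) => //=; case: (tiny m q tau y) => //=.
by do 3 case: (_ < _).
Qed.

Variables (k : nat) (f : 'I_k -> Y -> Y -> R).
Hypotheses (k2 : (2 <= k)%N) (f0 : forall i x y, 0 <= f i x y).

Lemma cyc_localize_mono (A A' : 'I_k -> pred Y) (F : 'I_k -> Y -> Y -> R) :
  (forall i x y, 0 <= F i x y) -> (forall i y, A' i y -> A i y) ->
  cyc (localize_cycle A' F) <= cyc (localize_cycle A F).
Proof.
move=> F0 A'A; apply: ler_sum => x _; apply: ler_prod => i _.
rewrite /localize_cycle /localize !mulr_ge0 //= ler_wpM2r //.
rewrite -!natrM ler_nat.
by case: (boolP (A' i _)) => [/A'A ->|//]; case: (boolP (A' _ _)) => [/A'A ->|].
Qed.

(** Inside the product of the A i, intersected with the good set, at most half of the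
    tuples meet a low pair, and on the others all fine averages are at least c / 2.  A set
    of relative size 1/(2k) in its cell still has relative size 1/(4k) after removal of
    the bad points, so a proportion eta of low pairs among the cells becomes at most
    16 k^2 eta among the sets. *)
Lemma edge_set_count (good : pred Y) (tau c K eta xi : R) (x : 'I_k -> Y)
    (A : 'I_k -> pred Y) :
  0 < c -> 0 < tau -> 0 <= eta -> k%:R * (16 * k%:R ^+ 2 * eta) <= 2^-1 ->
  (forall i, edge_set (f i) tau c K eta (x i) (x (ordS i))) ->
  measure m (predC good) <= tau / (4 * k%:R) ->
  (forall A' : 'I_k -> pred Y, (forall i y, A' i y -> good y) ->
     `|cyc (localize_cycle A' (fun i => weighted m (f i))) -
       cyc (localize_cycle A' (fun i => sandwich (cond_kernel m q') (cond_kernel m q')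
         (weighted m (f i))))| <= xi) ->
  (forall i y, A i y -> cell q (x i) y) ->
  (forall i, measure m (cell q (x i)) <= 2 * k%:R * measure m (A i)) ->
  (c / 2) ^+ k * 2^-1 * (tau / (4 * k%:R)) ^+ k - xi <=
    cyc (localize_cycle A (fun i => weighted m (f i))).
Proof.
move=> c0 tau0 eta0 keta Ex gm approx Ac Am.
have kR : 0 < k%:R :> R by rewrite ltr0n (leq_trans _ k2).
pose A' i : pred Y := fun y => A i y && good y.
have F0 i u v : 0 <= weighted m (f i) u v by rewrite /weighted !mulr_ge0 ?sqrtr_ge0.
have P0 D := measure_ge0 m0 D.
apply: le_trans (cyc_localize_mono F0 (A' := A') _); last by move=> i y /andP[].
have A'good i y : A' i y -> good y by case/andP.
have lb : (c / 2) ^+ k * 2^-1 * (tau / (4 * k%:R)) ^+ k <=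
    cyc (localize_cycle A' (fun i => sandwich (cond_kernel m q') (cond_kernel m q')
         (weighted m (f i)))); last first.
  have := approx A' A'good; rewrite ler_norml => /andP[+ _]; lra.
have cell_tau i : tau <= measure m (cell q (x i)).
  by have /and5P[] := Ex i; rewrite /tiny -leNgt.
have cellP i : measure m (cell q (x i)) <= 4 * k%:R * measure m (A' i).
  have AA' : measure m (A i) <= measure m (A' i) + tau / (4 * k%:R).
    apply: le_trans (lerD (lexx _) gm).
    rewrite /measure [leLHS]big_mkcond [X in _ <= X + _]big_mkcond
      [X in _ <= _ + X]big_mkcond -big_split /=.
    apply: ler_sum => y _; rewrite /A' /=.
    by case: (A i y); case: (good y); rewrite ?addr0 ?add0r.
  have := Am i; have := cell_tau i.
  have : 2 * k%:R * measure m (A i) <= 2 * k%:R * (measure m (A' i) + tau / (4 * k%:R)).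
    by rewrite ler_wpM2l // mulr_ge0 ?(ltW kR).
  have -> : 2 * k%:R * (measure m (A' i) + tau / (4 * k%:R)) =
     2 * k%:R * measure m (A' i) + tau / 2 by field; rewrite lt0r_neq0.
  lra.
pose w i u : R := (A' i u)%:R * m u.
have wS i : \sum_u w i u = measure m (A' i).
  rewrite /measure [RHS]big_mkcond /=; apply: eq_bigr => u _; rewrite /w.
  by case: (A' i u); rewrite ?mul1r ?mul0r.
have -> : cyc (localize_cycle A' (fun i => sandwich (cond_kernel m q') (cond_kernel m q')
         (weighted m (f i)))) =
    \sum_(y : {ffun 'I_k -> Y}) (\prod_j w j (y j)) *
       \prod_i average m q' (f i) (y i) (y (ordS i)).
  apply: eq_bigr => y _.
  transitivity (\prod_i ((A' i (y i))%:R * (A' (ordS i) (y (ordS i)))%:R *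
     (average m q' (f i) (y i) (y (ordS i)) *
      (Num.sqrt (m (y i)) * Num.sqrt (m (y (ordS i))))))).
    by apply: eq_bigr => i _; rewrite /localize_cycle /localize (sandwich_cond m0).
  rewrite !big_split /=.
  have -> : \prod_i (A' (ordS i) (y (ordS i)))%:R = \prod_i (A' i (y i))%:R :> R.
    by rewrite [RHS](reindex (@ordS k)) //; exact/onW_bij/ordS_bij.
  have -> : \prod_i Num.sqrt (m (y i)) * \prod_i Num.sqrt (m (y (ordS i))) =
            \prod_i m (y i) by rewrite -big_split prod_sqrt_cycle.
  have -> : \prod_i (A' i (y i))%:R * \prod_i (A' i (y i))%:R =
            \prod_i (A' i (y i))%:R :> R.
    by rewrite -big_split; apply: eq_bigr => i _ /=; rewrite -natrM mulnb andbb.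
  by rewrite mulrA mulrAC.
apply: (@le_trans _ _ ((c / 2) ^+ k * 2^-1 * \prod_i \sum_u w i u)); last first.
  apply: (sum_prod_ge (c := c / 2) (w := w) (h := fun i => low (f i) c)
    (g := fun i => average m q' (f i))
    (th := 16 * k%:R ^+ 2 * eta) (P := fun i => measure m (A' i)) k2) => //.
  - by rewrite divr_ge0 ?(ltW c0).
  - by rewrite !mulr_ge0 ?exprn_ge0 ?(ltW kR).
  - by move=> i y; rewrite /w mulr_ge0.
  - by move=> i u v; apply: average_ge0.
  - by move=> i u v; rewrite /low; case: ltP => h; [right; rewrite lexx | left].
  - by move=> i; rewrite wS.
  move=> i.
  have C0 := lt_le_trans tau0 (cell_tau i).
  have C1 := lt_le_trans tau0 (cell_tau (ordS i)).
  apply: (@le_trans _ _ (\sum_(u | cell q (x i) u) \sum_(v | cell q (x (ordS i)) v)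
      m u * m v * low (f i) c u v)).
    rewrite [leRHS]big_mkcond; apply: ler_sum => u _ /=.
    rewrite /w /A'; case: (boolP (A i u)) => [/Ac ->|_]; last first.
      under eq_bigr do rewrite /= !mul0r.
      rewrite sumr_const mul0rn; case: ifP => // _.
      by apply: sumr_ge0 => v _; rewrite !mulr_ge0.
    rewrite [leRHS]big_mkcond; apply: ler_sum => v _ /=.
    have l0 : 0 <= m u * m v * low (f i) c u v by rewrite !mulr_ge0.
    case: (boolP (A (ordS i) v)) => [/Ac ->|_] /=; last first.
      by rewrite mul0r mulr0 mul0r; case: ifP.
    by case: (good u); case: (good v); rewrite /= ?(mul0r, mulr0, mul1r).
  have /and5P[_ _ _ _] := Ex i; rewrite {1}/average ler_pdivrMr ?mulr_gt0 // => h.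
  apply: le_trans h _.
  have -> : 16 * k%:R ^+ 2 * eta * (measure m (A' i) * measure m (A' (ordS i))) =
    eta * ((4 * k%:R * measure m (A' i)) * (4 * k%:R * measure m (A' (ordS i)))) by ring.
  by rewrite ler_wpM2l // ler_pM.
rewrite ler_wpM2l ?mulr_ge0 ?exprn_ge0 ?(ltW c0) ?invr_ge0 //; first lra.
  rewrite -[k in leLHS]card_ord -prodr_const card_ord; apply: ler_prod => i _.
  rewrite divr_ge0 ?mulr_ge0 ?(ltW tau0) ?(ltW kR) //= wS.
  rewrite ler_pdivrMr ?mulr_gt0 // mulrC.
  exact: le_trans (cell_tau i) (cellP i).
Qed.

End EdgeSet.

(** * Removal on a single measure space *)

Section Core.
Variables (R : realType) (k : nat) (C B r : R) (N : 'I_k -> nat -> nat).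
Hypotheses (k2 : (2 <= k)%N).
Hypotheses (C0 : 0 < C) (B0 : 0 < B) (r0 : 0 < r) (r1 : r < 1).
Hypothesis NC : layers_decay C B r N.
Variables (mu0 tau0 eps K : R).
Hypotheses (mu0_gt0 : 0 < mu0) (tau0_gt0 : 0 < tau0) (eps0 : 0 < eps) (K0 : 0 < K).

(** Only partitions refining p0 are tested: for a disjoint union p0 separates the
    spaces, and for the diagonal version its cells have small mass. *)
Definition few_large (Y : finType) (m : Y -> R) (T0 : eqType) (p0 : Y -> T0)
    (f : 'I_k -> Y -> Y -> R) (tau : R) : Prop :=
  forall (T : finType) (p : Y -> T), refines p p0 ->
    (forall x, tau <= measure m (cell p x)) ->
    forall i, mass_on m (f i) (fun x y => K < average m p (f i) x y) <= eps / 4.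

(** The sets A are at our disposal in the applications: whole cells in general, and
    disjoint subsets of the cells for tuples of distinct points. *)
Definition removable (Y : finType) (m : Y -> R)
    (f : 'I_k -> Y -> Y -> R) (delta tau : R) : Prop :=
  exists (T : finType) (q : Y -> T) (E : 'I_k -> Y -> pred Y),
    (forall i, mass_on m (f i) (fun x y => ~~ E i x y) <= eps) /\
    forall x : 'I_k -> Y, (forall i, E i (x i) (x (ordS i))) ->
      (forall i, tau <= measure m (cell q (x i))) /\
      forall A : 'I_k -> pred Y,
        (forall i y, A i y -> cell q (x i) y) ->
        (forall i, measure m (cell q (x i)) <= 2 * k%:R * measure m (A i)) ->
        delta < cyc (localize_cycle A (fun i => weighted m (f i))).

Definition admissible (Y : finType) (m : Y -> R) (T0 : finType) (p0 : Y -> T0)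
    (f : 'I_k -> Y -> Y -> R) : Prop :=
  [/\ forall y, 0 <= m y, \sum_y m y <= mu0,
      forall x, tau0 <= measure m (cell p0 x),
      forall i x y, 0 <= f i x y &
      forall i, tame C (N i) (weighted m (f i))].

(* Averages below c carry mass at most c * mu0^2 = eps / 4. *)
Let c := eps / (4 * mu0 ^+ 2).
(* The proportion of low pairs tolerated, so that k * (16 k^2 * eta) = 1/2. *)
Let eta : R := (32 * k%:R ^+ 3)^-1.
(* Averages up to 2 K are kept: merging tiny cells may halve an average. *)
Let Z := (1 + 2 * K) ^+ 3 * 4 / c ^+ 2.
(* An energy gain that is too small to matter. *)
Let theta := eps * eta / (8 * K * Z).

Let kR : 0 < k%:R :> R. Proof. by rewrite ltr0n (leq_trans _ k2). Qed.
Let c0 : 0 < c. Proof. by rewrite divr_gt0 // mulr_gt0 // exprn_gt0. Qed.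
Let eta0 : 0 < eta. Proof. by rewrite invr_gt0 mulr_gt0 // exprn_gt0. Qed.
Let Z0 : 0 < Z.
Proof.
by rewrite divr_gt0 ?exprn_gt0 // mulr_gt0 // exprn_gt0 // addr_gt0 // mulr_gt0.
Qed.
Let theta0 : 0 < theta.
Proof.
by apply: divr_gt0; [exact: mulr_gt0 | apply: mulr_gt0 => //; exact: mulr_gt0].
Qed.

(** The thresholds depend on the partition q only through a bound M on the number of its
    cells, and the type U of new colours does too; this makes the iteration uniform. *)
Lemma removal_or_increment (M : nat) : (0 < M)%N ->
  exists (delta tau : R) (U : finType),
  [/\ 0 < delta, 0 < tau &
  forall (Y : finType) (m : Y -> R) (T0 T : finType) (p0 : Y -> T0) (q : Y -> T)
    (f : 'I_k -> Y -> Y -> R),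
    admissible m p0 f -> (#|T| <= M)%N -> refines q p0 ->
    few_large m p0 f tau ->
    removable m f delta tau \/
    exists q' : Y -> T * U, refines q' q /\
      exists i, energy m q (f i) + theta < energy m q' (f i)].
Proof.
move=> M0.
have MR : 1 <= M%:R :> R by rewrite ler1n.
have M0R : 0 < M%:R :> R by lra.
(* The first bound is what merging requires; the second makes the strips over the
   tiny cells, of total measure at most M * tau, carry mass at most eps / 4. *)
pose tau := Num.min (tau0 / (6 * M%:R ^+ 2))
  ((eps / (16 * C)) ^+ 2 / (M%:R * mu0)).
have tau_gt0 : 0 < tau.
  have pos1 : 0 < 6 * M%:R ^+ 2 :> R by apply: mulr_gt0 => //; exact: exprn_gt0.
  have pos2 : 0 < eps / (16 * C) by apply: divr_gt0 => //; exact: mulr_gt0.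
  rewrite lt_min; apply/andP; split; first exact: divr_gt0.
  by apply: divr_gt0; [exact: exprn_gt0 | exact: mulr_gt0].
have tau1 : 6 * M%:R ^+ 2 * tau <= tau0.
  rewrite mulrC -ler_pdivlMr ?mulr_gt0 ?exprn_gt0 //.
  by rewrite /tau ge_min lexx.
have tau2 : M%:R * tau * mu0 <= (eps / (16 * C)) ^+ 2.
  rewrite mulrAC mulrC -ler_pdivlMr ?mulr_gt0 //.
  by rewrite /tau ge_min lexx orbT.
(* The count forced by a cycle of kept edges is La, up to an error La / 2. *)
pose La := (c / 2) ^+ k * 2^-1 * (tau / (4 * k%:R)) ^+ k.
have nu0 : 0 < tau / (4 * k%:R) by rewrite divr_gt0 // mulr_gt0.
have La0 : 0 < La.
  have c2 : 0 < c / 2 by exact: divr_gt0.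
  apply: mulr_gt0; last exact: exprn_gt0.
  by apply: mulr_gt0; [exact: exprn_gt0 | rewrite invr_gt0].
have La2 : 0 < La / 2 by rewrite divr_gt0.
have [U count] := count_approx C0 B0 r0 r1 NC mu0_gt0 La2 nu0.
exists (La / 4), tau, U; split => //; first by rewrite divr_gt0.
move=> Y m T0 T p0 q f [m0 mmu p0t f0 ft] TM qp0 large.
have [col [good [colgood goodm close]]] :=
  count Y m (fun i => weighted m (f i)) m0 mmu ft.
pose q' y := (q y, col y).
have q'q : refines q' q by move=> x y [].
have [/existsP[i lt]|small] :=
    boolP [exists i, energy m q (f i) + theta < energy m q' (f i)].
  by right; exists q'; split => //; exists i.
left; have {}small i : energy m q' (f i) - energy m q (f i) <= theta.
  move: small; rewrite negb_exists => /forallP/(_ i); rewrite -leNgt; lra.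
exists T, q, (fun i x y => edge_set m q q' (f i) tau c (2 * K) eta x y).
split=> [i|x Ex].
  apply: (edge_set_mass m0 C0 c0 _ eta0 (f0 i) (ft i) mmu q'q (small i)).
  - by rewrite mulr_gt0.
  - have tinyM : measure m (tiny m q tau) * mu0 <= (eps / (16 * C)) ^+ 2.
      apply: le_trans tau2; rewrite ler_wpM2r ?(ltW mu0_gt0) //.
      apply: le_trans (measure_tiny m0 q (ltW tau_gt0)) _.
      by rewrite ler_wpM2r ?(ltW tau_gt0) // ler_nat.
    apply: (@le_trans _ _ (4 * C * (eps / (16 * C)))).
      rewrite ler_wpM2l ?mulr_ge0 ?(ltW C0) //.
      have e0 : 0 <= eps / (16 * C) by rewrite divr_ge0 ?mulr_ge0 ?(ltW C0) ?(ltW eps0).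
      by rewrite -[leRHS](ger0_norm e0) -sqrtr_sqr ler_wsqrtr.
    by apply: le_of_eq; field; rewrite lt0r_neq0.
  - have [T' [p [pp0 ptau pq]]] := merge_tiny m0 M0 TM tau_gt0 tau1 qp0 p0t.
    apply: le_trans (large T' p pp0 ptau i).
    apply: mass_on_sub => // u v /and3P[tu tv big].
    have [pu eu] := pq u tu; have [pv ev] := pq v tv.
    have Pu : 0 < measure m (cell q u) by rewrite (lt_le_trans tau_gt0) // leNgt.
    have Pv : 0 < measure m (cell q v) by rewrite (lt_le_trans tau_gt0) // leNgt.
    by have := average_merge m0 (f0 i) pu pv Pu Pv eu ev; lra.
  - by rewrite /c; apply: le_of_eq; field; rewrite lt0r_neq0.
  - rewrite -/Z /theta; apply: le_of_eq.
    by field; rewrite !lt0r_neq0.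
split=> [i|A Ac Am].
  by have /andP[] := Ex i; rewrite /tiny -leNgt.
have keta : k%:R * (16 * k%:R ^+ 2 * eta) <= 2^-1.
  by rewrite /eta; apply: le_of_eq; field; rewrite lt0r_neq0.
have := edge_set_count m0 k2 f0 c0 tau_gt0 (ltW eta0) keta Ex goodm _ Ac Am.
move=> /(_ (La / 2)); rewrite -/La => lb.
suff: La - La / 2 <= cyc (localize_cycle A (fun i => weighted m (f i))) by lra.
apply: lb => A' A'good; apply: close => //.
by move=> u v [].
Qed.

Lemma few_large_le (Y : finType) (m : Y -> R) (T0 : eqType) (p0 : Y -> T0) f tau tau' :
  tau <= tau' -> few_large m p0 f tau -> few_large m p0 f tau'.
Proof.
by move=> le large T p pp0 pt; apply: large => // x; exact: le_trans (pt x).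
Qed.

Lemma removable_le (Y : finType) (m : Y -> R) f delta tau delta' tau' :
  delta <= delta' -> tau <= tau' -> removable m f delta' tau' -> removable m f delta tau.
Proof.
move=> led let_ [T [q [E [Em Ex]]]]; exists T, q, E; split => // x /Ex[xt xA].
split => [i|A Ac Am]; first exact: le_trans (xt i).
exact: le_lt_trans (xA A Ac Am).
Qed.

(** Induction on the number n of energy increments still possible.  The bound M on the
    number of cells comes before delta and tau because it grows at each increment. *)
Lemma removal_step (n M : nat) : (0 < M)%N ->
  exists delta tau : R,
  [/\ 0 < delta, 0 < tau &
  forall (Y : finType) (m : Y -> R) (T0 T : finType) (p0 : Y -> T0) (q : Y -> T)
    (f : 'I_k -> Y -> Y -> R),
    admissible m p0 f -> (#|T| <= M)%N -> refines q p0 ->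
    k%:R * mu0 ^+ 2 - n%:R * theta <= \sum_i energy m q (f i) ->
    few_large m p0 f tau -> removable m f delta tau].
Proof.
have incr (Y : finType) (m : Y -> R) (T0 T T' : finType) (p0 : Y -> T0)
    (q : Y -> T) (q' : Y -> T') f :
    admissible m p0 f -> refines q' q ->
    (exists i, energy m q (f i) + theta < energy m q' (f i)) ->
    \sum_i energy m q (f i) + theta < \sum_i energy m q' (f i).
  move=> [m0 mmu p0t f0 ft] q'q [i lt].
  rewrite (bigD1 i) //= [ltRHS](bigD1 i) //= addrAC ltr_leD //.
  by apply: ler_sum => j _; exact: energy_incr_ge0.
elim: n M => [|n IHn] M M0.
all: have [delta [tau [U [delta0 tau_gt0 step]]]] := removal_or_increment M0.
  exists delta, tau; split => // Y m T0 T p0 q f adm TM qp0 en large.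
  have [//|[q' [q'q ex]]] := step Y m T0 T p0 q f adm TM qp0 large.
  have := incr _ _ _ _ _ _ _ _ _ adm q'q ex.
  have [m0 mmu p0t f0 ft] := adm.
  have : \sum_i energy m q' (f i) <= k%:R * mu0 ^+ 2.
    rewrite -[k in k%:R]card_ord mulr_natl -sumr_const; apply: ler_sum => i _.
    by have /andP[] := energy_bounds m0 (f0 i) q' mmu.
  by have := theta0; rewrite mul0r in en; lra.
have MU : (0 < M * #|U|.+1)%N by rewrite muln_gt0 M0.
have [delta' [tau' [delta'0 tau'0 IH]]] := IHn _ MU.
exists (Num.min delta delta'), (Num.min tau tau').
split; rewrite ?lt_min ?delta0 ?tau_gt0 //.
move=> Y m T0 T p0 q f adm TM qp0 en large.
have l1 : Num.min tau tau' <= tau by rewrite ge_min lexx.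
have l2 : Num.min tau tau' <= tau' by rewrite ge_min lexx orbT.
have [|[q' [q'q ex]]] :=
    step Y m T0 T p0 q f adm TM qp0 (few_large_le l1 large).
  by apply: removable_le => //; rewrite ge_min lexx.
apply: (@removable_le _ _ _ _ _ delta' tau') => //; first by rewrite ge_min lexx orbT.
apply: (IH _ _ _ _ p0 q') => //.
- by rewrite card_prod leq_mul // ltnW.
- by move=> x y /q'q; exact: qp0.
- by have := incr _ _ _ _ _ _ _ _ _ adm q'q ex; rewrite -natr1 in en; lra.
- exact: few_large_le large.
Qed.

Theorem removal_core (M : nat) : (0 < M)%N ->
  exists delta tau : R,
  [/\ 0 < delta, 0 < tau &
  forall (Y : finType) (m : Y -> R) (T0 : finType) (p0 : Y -> T0)
    (f : 'I_k -> Y -> Y -> R),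
    admissible m p0 f -> (#|T0| <= M)%N ->
    few_large m p0 f tau -> removable m f delta tau].
Proof.
move=> M0; pose n := Num.bound (k%:R * mu0 ^+ 2 / theta).
have [delta [tau [delta0 tau_gt0 step]]] := removal_step n M0.
exists delta, tau; split => // Y m T0 p0 f adm T0M large.
apply: (step _ _ _ _ p0 p0) => //.
have [m0 mmu p0t f0 ft] := adm.
apply: (@le_trans _ _ 0).
  rewrite subr_le0 -ler_pdivrMr //; apply/ltW/archi_boundP.
  by apply: divr_ge0; [apply: mulr_ge0 => //; exact/exprn_ge0/ltW | exact: ltW].
by apply: sumr_ge0 => i _; have /andP[] := energy_bounds m0 (f0 i) p0 mmu.
Qed.

End Core.

(** * Interpolation between the exponents *)

Section Exponents.
Variable R : realType.

Lemma powR_sum (I : finType) (a : R) (w : I -> R) : 0 < a ->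
  a `^ (\sum_i w i) = \prod_i a `^ w i.
Proof.
move=> a0; apply: (big_morph (fun x => a `^ x)); last by rewrite powRr0.
by move=> x y; rewrite powRD // (gt_eqF a0) implybT.
Qed.

(** Put S = sum 1/q_i > 1 and raise the i-th bound to the power w_i = 1/(q_i S); the w_i
    sum to 1.  Layer m_i then contributes 2^(-m_i) from the norm and at most
    4 * 2^(m_i/S) from the rank, for the same S whatever q_i is, and 2^(1/S) < 2. *)
Lemma layers_decay_exponents (k : nat) (q : 'I_k -> R) (C : R) :
  0 < C -> (forall i, 1 <= q i) -> 1 < \sum_i (q i)^-1 ->
  exists r : R, [/\ 0 < r, r < 1 &
    layers_decay C (4 * C) r (fun i => layer_rank (q i))].
Proof.
move=> C0 q1; set S := \sum_i _ => S1.
have S0 : 0 < S by lra.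
have q0 i : 0 < q i by apply: lt_le_trans (q1 i).
pose s : R := 2 `^ S^-1.
have Si1 : S^-1 < 1 by rewrite invf_lt1.
have Si0 : 0 < S^-1 by rewrite invr_gt0.
have s0 : 0 < s by exact: powR_gt0.
have s2 : s < 2.
  have d0 : 0 < 1 - S^-1 by rewrite subr_gt0.
  have t1 : 1 < 2 `^ (1 - S^-1) :> R.
    have := @gt0_ltr_powR R _ d0 1 2; rewrite powR1; apply; rewrite ?nnegrE //; lra.
  have st : s * 2 `^ (1 - S^-1) = 2.
    rewrite /s -powRD; first by rewrite addrC subrK powRr1.
    by rewrite (gt_eqF (ltr0n R 2)) implybT.
  by rewrite -st ltr_pMr.
pose r := Num.sqrt (s / 2).
have sq : r ^+ 2 = s / 2 by rewrite sqr_sqrtr // divr_ge0 ?(ltW s0).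
exists r; split; first by rewrite sqrtr_gt0 divr_gt0.
  by rewrite -(sqrtr1 R) ltr_sqrt // ltr_pdivrMr ?mul1r.
move=> A m A0 AN.
pose D : R := \prod_j (C / 2 ^+ m j).
have D0 : 0 < D by apply: prodr_gt0 => j _; rewrite divr_gt0 // exprn_gt0.
have [->|An0] := eqVneq A 0.
  apply: prodr_ge0 => j _; rewrite !mulr_ge0 ?(ltW C0) //;
    apply: exprn_ge0; exact: sqrtr_ge0.
have Ap : 0 < A by rewrite lt_def An0.
pose a := A / D; have a0 : 0 < a by exact: divr_gt0.
have aN i : a <= 2 * 2 `^ (q i * (m i).+1%:R).
  rewrite /a ler_pdivrMr //; apply: le_trans (AN i) _; rewrite -/D ler_wpM2r ?(ltW D0) //.
  by rewrite /layer_rank truncn_le mulr_ge0 ?powR_ge0.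
pose w i := (q i)^-1 / S.
have w0 i : 0 < w i by rewrite divr_gt0 ?invr_gt0.
have w1 : \sum_i w i = 1 by rewrite -mulr_suml mulfV ?lt0r_neq0.
have aw i : a `^ w i <= 4 * s ^+ m i.
  apply: (@le_trans _ _ ((2 * 2 `^ (q i * (m i).+1%:R)) `^ w i)).
    by apply: ge0_ler_powR; rewrite ?nnegrE ?(ltW (w0 i)) ?(ltW a0) ?mulr_ge0 ?powR_ge0.
  rewrite powRM ?powR_ge0 // -powRrM.
  have -> : q i * (m i).+1%:R * w i = S^-1 * (m i).+1%:R.
    by rewrite /w; field; rewrite !lt0r_neq0.
  rewrite [2 `^ (S^-1 * _)]powRrM -/s powR_mulrn ?(ltW s0) // exprS.
  have -> : 4 * s ^+ m i = 2 * (2 * s ^+ m i) :> R by ring.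
  apply: ler_pM; rewrite ?powR_ge0 ?mulr_ge0 ?exprn_ge0 ?(ltW s0) //; last first.
    by rewrite ler_wpM2r ?exprn_ge0 ?(ltW s0) ?(ltW s2).
  apply: ler1_powR; first by rewrite ler1n.
  rewrite /w -invfM invf_le1 ?mulr_gt0 //.
  by apply: le_trans (q1 i) _; rewrite ler_peMr ?(ltW (q0 i)) ?(ltW S1).
have -> : A = a * D by rewrite /a divfK ?lt0r_neq0.
have aE : a = \prod_i a `^ w i by rewrite -powR_sum // w1 powRr1 ?(ltW a0).
rewrite aE /D -big_split /=.
apply: ler_prod => j _.
have q2 : 0 <= C / 2 ^+ m j by rewrite divr_ge0 ?exprn_ge0 ?(ltW C0).
rewrite mulr_ge0 ?powR_ge0 //=.
apply: le_trans (ler_wpM2r q2 (aw j)) _.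
have -> : r ^+ m j * r ^+ m j = (s / 2) ^+ m j by rewrite -exprD -sq -exprM mul2n addnn.
rewrite expr_div_n; apply: le_of_eq; ring.
Qed.

End Exponents.

(** * Push-forward along injections *)

Section Push.
Variable R : realType.

Lemma tame_ext (X Y : finType) C N (F F' : X -> Y -> R) :
  (forall x y, F x y = F' x y) -> tame C N F -> tame C N F'.
Proof. by move=> FF' [M [G [FG Gf]]]; exists M, G; split => // x y; rewrite -FF'. Qed.

Section Inj.
Variables (X X' Y : finType) (io : X -> Y) (io' : X' -> Y).
Hypotheses (io_inj : injective io) (io'_inj : injective io').

(** The sum over x selects the preimage of y, if any; this avoids casts between the
    members of a dependent family. *)
Definition extend (Z : finType) (j : Z -> Y) (a : Z -> R) (y : Y) : R :=
  \sum_x (j x == y)%:R * a x.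

Definition push (G : X -> X' -> R) (y y' : Y) : R :=
  \sum_x \sum_x' (io x == y)%:R * (io' x' == y')%:R * G x x'.

Lemma extend_val (Z : finType) (j : Z -> Y) a x : injective j ->
  extend j a (j x) = a x.
Proof.
move=> j_inj; rewrite /extend (bigD1 x) //= eqxx mul1r big1 ?addr0 // => z zx.
by rewrite (inj_eq j_inj) (negPf zx) mul0r.
Qed.

Lemma sum_extend (Z : finType) (j : Z -> Y) (h : Y -> R) a :
  \sum_y h y * extend j a y = \sum_x h (j x) * a x.
Proof.
under eq_bigr do rewrite mulr_sumr.
rewrite exchange_big /=; apply: eq_bigr => x _.
rewrite (bigD1 (j x)) //= eqxx mul1r big1 ?addr0 // => y yx.
by rewrite eq_sym (negPf yx) mul0r mulr0.
Qed.

Lemma norm2_extend (Z : finType) (j : Z -> Y) a : injective j ->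
  norm2 (extend j a) = norm2 a.
Proof.
move=> j_inj; rewrite /norm2; under eq_bigr do rewrite expr2.
by rewrite sum_extend; apply: eq_bigr => x _; rewrite extend_val // expr2.
Qed.

Lemma norm2_comp (Z : finType) (j : Z -> Y) (b : Y -> R) : injective j ->
  norm2 (b \o j) <= norm2 b.
Proof.
move=> j_inj; rewrite /norm2 [leRHS](bigID (mem (j @: [set: Z]))) /=.
rewrite (big_imset (fun y => b y ^+ 2) (in2W j_inj)) /=.
rewrite [X in _ <= X + _](eq_bigl predT) /=; last by move=> x; rewrite inE.
by rewrite lerDl; apply: sumr_ge0 => y _; exact: sqr_ge0.
Qed.

Lemma pushE G y y' : push G y y' = extend io (fun x => extend io' (G x) y') y.
Proof.
apply: eq_bigr => x _; rewrite mulr_sumr; apply: eq_bigr => x' _.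
by rewrite mulrA.
Qed.

Lemma push_val G x x' : push G (io x) (io' x') = G x x'.
Proof. by rewrite pushE !extend_val. Qed.

Lemma sum_push (h : Y -> Y -> R) G :
  \sum_y \sum_y' h y y' * push G y y' = \sum_x \sum_x' h (io x) (io' x') * G x x'.
Proof.
rewrite exchange_big /=.
under eq_bigr do under eq_bigr do rewrite pushE.
under eq_bigr do rewrite (sum_extend io (fun y => h y _)).
rewrite exchange_big /=; apply: eq_bigr => x _.
by rewrite (sum_extend io' (fun y => h (io x) y)).
Qed.

Lemma act_push G b y : act (push G) b y = extend io (act G (b \o io')) y.
Proof.
rewrite /act.
under eq_bigr do rewrite pushE {1}/extend mulr_suml.
rewrite exchange_big /=; apply: eq_bigr => x _.
under eq_bigr do rewrite -mulrA.
rewrite -mulr_sumr; congr (_ * _).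
under [LHS]eq_bigr do rewrite mulrC.
by rewrite sum_extend; apply: eq_bigr => x' _; rewrite mulrC.
Qed.

Lemma flat_push s N G : flat s N G -> flat s N (push G).
Proof.
move=> [Gs [a [b [an bn Gab]]]]; split.
  move=> c; rewrite (eq_norm2 (act_push G c)) norm2_extend //.
  apply: le_trans (Gs _) _; rewrite ler_wpM2l ?sqr_ge0 //.
  exact: norm2_comp.
exists (fun l => extend io (a l)), (fun l => extend io' (b l)); split.
- by move=> l; rewrite norm2_extend.
- by move=> l; rewrite norm2_extend.
move=> y y'; rewrite pushE /extend.
under eq_bigr do under eq_bigr do rewrite Gab mulr_sumr.
under eq_bigr do rewrite exchange_big /= mulr_sumr.
rewrite exchange_big /=; apply: eq_bigr => l _.
rewrite mulr_suml; apply: eq_bigr => x _.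
by rewrite !mulr_sumr; apply: eq_bigr => x' _; ring.
Qed.

Lemma tame_push C N F : tame C N F -> tame C N (push F).
Proof.
move=> [M [G [FG Gf]]]; exists M, (fun m => push (G m)); split => [y y'|m].
  rewrite /push [RHS]exchange_big /=; apply: eq_bigr => x _.
  rewrite [RHS]exchange_big /=; apply: eq_bigr => x' _.
  by rewrite FG mulr_sumr.
exact: flat_push.
Qed.

End Inj.
End Push.

(** * Transfer to families of probability spaces *)

Section Transfer.
Variable R : realType.

Lemma expect_prod (X X' : finProbSpace R) (g : X * X' -> R) :
  expect (X := prod_space X X') g = \sum_x \sum_x' mass x * mass x' * g (x, x').
Proof.
rewrite /expect /= pair_bigA; apply: eq_bigr => -[x x'] _ //.
Qed.

Section Fibres.
Variables (X : finProbSpace R) (Y : finType) (m : Y -> R) (io : X -> Y).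
Hypotheses (io_inj : injective io) (mio : forall x, m (io x) = mass x).
Variables (T : finType) (p : Y -> T).
Hypothesis closed : forall y x, p y = p (io x) -> exists u, y = io u.

(** Partitions of the large space are functions; this is the corresponding partition of
    X as a set of sets. *)
Definition fibres : {set {set X}} := preim_partition (p \o io) [set: X].

Lemma mem_fibre x u : (u \in pblock fibres x) = (p (io u) == p (io x)).
Proof.
have eqv : {in [set: X] & &, equivalence_rel [rel x y | (p \o io) x == (p \o io) y]}.
  by move=> a b c _ _ _; split => //= /eqP ->.
by rewrite (pblock_equivalence_partition eqv) ?inE //= eq_sym.
Qed.

Lemma sum_cell x (h : Y -> R) :
  \sum_(y | cell p (io x) y) h y = \sum_(u in pblock fibres x) h (io u).
Proof.
rewrite -(big_imset h (in2W io_inj)) /=; apply: eq_bigl => y.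
apply/idP/imsetP => [/eqP pyx|[u]].
  have [u yu] := closed pyx; exists u => //.
  by rewrite mem_fibre -yu pyx.
by rewrite mem_fibre => /eqP pux ->; rewrite /cell pux.
Qed.

Lemma measure_cell_fibre x : measure m (cell p (io x)) = prob (pblock fibres x).
Proof. by rewrite /measure sum_cell; apply: eq_bigr => u _; rewrite mio. Qed.

Lemma fibres_ge tau : (forall x, tau <= measure m (cell p x)) -> partition_ge tau fibres.
Proof.
move=> pt; split; first exact: preim_partitionP.
move=> A /imsetP[x _ ->].
have -> : [set y in [set: X] | (p \o io) x == (p \o io) y] = pblock fibres x.
  by apply/setP => u; rewrite !inE mem_fibre eq_sym.
by rewrite -measure_cell_fibre.
Qed.

End Fibres.

Section Pair.
Variables (X X' : finProbSpace R) (Y : finType) (m : Y -> R).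
Variables (io : X -> Y) (io' : X' -> Y).
Hypotheses (io_inj : injective io) (mio : forall x, m (io x) = mass x).
Hypotheses (io'_inj : injective io') (mio' : forall x, m (io' x) = mass x).
Variable (f : X * X' -> R).

Definition push_pair : Y -> Y -> R := push io io' (fun x x' => f (x, x')).

Lemma mass_on_push (Q : Y -> pred Y) : (forall z, 0 <= f z) ->
  mass_on m push_pair Q = L1norm (fun z => f z * (Q (io z.1) (io' z.2))%:R).
Proof.
move=> f0; rewrite /mass_on /L1norm expect_prod.
transitivity (\sum_y \sum_y' (m y * m y' * (Q y y')%:R) * push_pair y y').
  by apply: eq_bigr => y _; apply: eq_bigr => y' _; ring.
rewrite sum_push; apply: eq_bigr => x _; apply: eq_bigr => x' _.
rewrite mio mio' ger0_norm; first ring.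
by rewrite mulr_ge0.
Qed.

Lemma average_push (T : finType) (p : Y -> T) x x' :
  (forall y x, p y = p (io x) -> exists u, y = io u) ->
  (forall y x, p y = p (io' x) -> exists u, y = io' u) ->
  average m p push_pair (io x) (io' x') = cond_exp f (fibres io p) (fibres io' p) (x, x').
Proof.
move=> cl cl'; rewrite /average /cond_exp /=.
rewrite (measure_cell_fibre io_inj mio cl) (measure_cell_fibre io'_inj mio' cl').
congr (_ / _); rewrite (sum_cell io_inj cl) expect_prod.
rewrite [LHS]big_mkcond /=; apply: eq_bigr => u _.
case: ifP => ux; last by rewrite big1 // => u' _; rewrite inE /= ux mulr0 mulr0.
rewrite (sum_cell io'_inj cl') [LHS]big_mkcond /=; apply: eq_bigr => u' _.
rewrite inE /= ux /=; case: ifP => _; last by rewrite !mulr0.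
by rewrite /push_pair push_val // mio mio' mulr1.
Qed.

Lemma tame_push_pair C N :
  tame C N (weighted_kernel f) -> tame C N (weighted m push_pair).
Proof.
move=> ft; apply: (tame_ext _ (tame_push io_inj io'_inj ft)) => y y'.
rewrite /weighted /push_pair /push mulr_suml; apply: eq_bigr => x _.
rewrite mulr_suml; apply: eq_bigr => x' _.
case: eqVneq => [<-|_]; last by rewrite !mul0r.
case: eqVneq => [<-|_]; last by rewrite !(mul0r, mulr0).
by rewrite mio mio' /weighted_kernel sqrtrM ?mass_ge0 // !mul1r.
Qed.

Lemma push_pair_ge0 y y' : (forall z, 0 <= f z) -> 0 <= push_pair y y'.
Proof.
by move=> f0; apply: sumr_ge0 => x _; apply: sumr_ge0 => x' _; rewrite !mulr_ge0.
Qed.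

Lemma push_pair_support y y' : push_pair y y' != 0 ->
  (exists x, y = io x) /\ (exists x', y' = io' x').
Proof.
move=> nz; split.
  have [x /eqP <-|none] := pickP (fun x => io x == y); first by exists x.
  move: nz; rewrite /push_pair /push big1 ?eqxx // => x _.
  by apply: big1 => x' _; rewrite none !mul0r.
have [x /eqP <-|none] := pickP (fun x => io' x == y'); first by exists x.
move: nz; rewrite /push_pair /push big1 ?eqxx // => x _.
by apply: big1 => x' _; rewrite none mulr0 mul0r.
Qed.

End Pair.

Section Cycles.
Variables (k : nat) (X : 'I_k -> finProbSpace R) (Y : finType) (m : Y -> R).
Variables (io : forall i, X i -> Y).
Hypotheses (io_inj : forall i, injective (io (i := i)))
           (mio : forall i x, m (io (i := i) x) = mass x).
Variable (f : forall i, X i * X (ordS i) -> R).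

Definition push_cycle (i : 'I_k) : Y -> Y -> R :=
  push_pair (io (i := i)) (io (i := ordS i)) (f (i := i)).

(** The support condition says that y comes from a dependent tuple, which is unique by
    injectivity. *)
Lemma sum_dffun (Q : {ffun 'I_k -> Y} -> R) :
  (forall y, Q y != 0 -> forall i, exists x, y i = io (i := i) x) ->
  \sum_y Q y = \sum_(x : {dffun forall i, X i}) Q [ffun i => io (x i)].
Proof.
move=> supp.
pose h (x : {dffun forall i, X i}) : {ffun 'I_k -> Y} := [ffun i => io (x i)].
have h_inj : injective h.
  move=> x x' /ffunP hx; apply/ffunP => i; apply: io_inj.
  by have := hx i; rewrite !ffunE.
rewrite (bigID (mem (h @: [set: {dffun forall i, X i}]))) /=.
rewrite [X in _ + X]big1 ?addr0; last first.
  move=> y yn; apply/eqP; apply: contraNT yn => /supp /fin_all_exists[x yx].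
  apply/imsetP; exists [ffun i => x i]; rewrite ?inE //.
  by apply/ffunP => i; rewrite !ffunE yx.
rewrite (big_imset Q (in2W h_inj)) /=.
by apply: eq_bigl => x; rewrite inE.
Qed.

(** The weights around a cycle pair up to the product of the masses. *)
Lemma cyc_push (A : 'I_k -> pred Y) :
  cyc (localize_cycle A (fun i => weighted m (push_cycle i))) =
  expect (X := pi_space X) (fun x =>
    (\prod_i ((A i (io (x i)))%:R * (A (ordS i) (io (x (ordS i))))%:R)) *
    \prod_i f (x i, x (ordS i))).
Proof.
rewrite /cyc sum_dffun; last first.
  move=> y /prodf_neq0 nz i; have := nz i isT.
  rewrite /localize_cycle /localize mulf_eq0 negb_or => /andP[_].
  rewrite /weighted mulf_eq0 negb_or => /andP[h _].
  by have [] := push_pair_support h.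
rewrite /expect /=; apply: eq_bigr => x _.
have -> : pi_mass x = \prod_i (Num.sqrt (mass (x i)) * Num.sqrt (mass (x (ordS i)))).
  rewrite big_split /= [X in _ * X](_ : _ = \prod_i Num.sqrt (mass (x i))); last first.
    by rewrite [RHS](reindex (@ordS k)) //; exact/onW_bij/ordS_bij.
  rewrite -big_split /pi_mass; apply: eq_bigr => i _ /=.
  by rewrite -expr2 sqr_sqrtr ?mass_ge0.
rewrite -!big_split /=; apply: eq_bigr => i _.
rewrite !ffunE /localize_cycle /localize /weighted /push_cycle /push_pair.
by rewrite push_val ?mio //; ring.
Qed.

End Cycles.
End Transfer.

(** * Diagonal blocks and equidistributed colourings *)

Section Diagonal.
Variable R : realType.

(** The diagonal mass is the sum over the cells of the quadratic form of the kernel at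
    the indicator of the cell.  For layer l this is at most the operator norm, because
    the squared norms of the indicators sum to at most 1; it is also at most the rank
    times (C^2 + 1) mu, because a cell captures only its own part of each vector and has
    measure at most mu.  The first bound serves for the low layers, the second for the
    finitely many others. *)
Lemma mass_diagonal (C : R) (N : nat -> nat) (e : R) : 0 < C -> 0 < e ->
  exists mu : R, 0 < mu /\
  forall (Y : finType) (m : Y -> R) (f : Y -> Y -> R) (T0 : finType) (p0 : Y -> T0),
    (forall y, 0 <= m y) -> \sum_y m y <= 1 -> (forall x y, 0 <= f x y) ->
    tame C N (weighted m f) -> (forall x, measure m (cell p0 x) <= mu) ->
    mass_on m f (fun x y => p0 x == p0 y) <= e.
Proof.
move=> C0 e0.
have [m0 m0P] := @expr_small R (2 / 3) (e / (8 * C)) ltac:(lra) ltac:(lra)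
  ltac:(by rewrite divr_gt0 // mulr_gt0).
pose A : R := (\sum_(l < m0) N l)%:R; have A0 : 0 <= A by exact: ler0n.
pose V := (C ^+ 2 + 1) * A * (4 / 3) ^+ m0.
have V0 : 0 <= V by rewrite !mulr_ge0 ?addr_ge0 ?sqr_ge0 ?exprn_ge0 //; lra.
pose mu := e / (8 * (V + 1)).
have V1 : 0 < 8 * (V + 1) by lra.
exists mu; split => [|Y m f T0 p0 mge m1 f0 [M [G [FG Gf]]] p0mu].
  by rewrite divr_gt0.
have mu0 : 0 < mu by rewrite divr_gt0.
pose ind (s : T0) x : R := Num.sqrt (m x) * (p0 x == s)%:R.
pose P s := norm2 (ind s).
have PE s : P s = \sum_(x | p0 x == s) m x.
  rewrite /P /norm2 [RHS]big_mkcond /=; apply: eq_bigr => x _.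
  by rewrite /ind exprMn sqr_sqrtr //; case: eqP; rewrite ?expr1n ?mulr1 // expr0n mulr0.
have P0 s : 0 <= P s by exact: norm2_ge0.
have Pmu s : P s <= mu.
  rewrite PE; have [x /eqP <-|none] := pickP (fun x => p0 x == s); first exact: p0mu.
  by rewrite big_pred0 // ltW.
have sumP : \sum_s P s <= 1.
  apply: le_trans m1; rewrite [leRHS](partition_big p0 predT) //=.
  by apply: ler_sum => s _; rewrite PE.
(* S l is the contribution of layer l, summed over the diagonal blocks. *)
pose S l := \sum_s \sum_x \sum_y ind s x * G l x y * ind s y.
have massE : mass_on m f (fun x y => p0 x == p0 y) = \sum_(l < M) S l.
  rewrite /S exchange_big /=.
  transitivity (\sum_s \sum_x \sum_y ind s x * weighted m f x y * ind s y).
    rewrite exchange_big; apply: eq_bigr => x _ /=.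
    rewrite exchange_big; apply: eq_bigr => y _ /=.
    rewrite (bigD1 (p0 x)) //= big1 ?addr0; last first.
      by move=> s /negPf; rewrite eq_sym /ind => ->; rewrite !(mulr0, mul0r).
    rewrite /ind /weighted eqxx [p0 y == _]eq_sym -{1}(sqr_sqrtr (mge x))
      -{1}(sqr_sqrtr (mge y)).
    by rewrite /=; ring.
  apply: eq_bigr => s _; rewrite [RHS]exchange_big /=; apply: eq_bigr => x _.
  rewrite [RHS]exchange_big /=; apply: eq_bigr => y _.
  by rewrite FG mulr_sumr mulr_suml.
have S1 l : `|S l| <= C / 2 ^+ l.
  apply: le_trans (ler_norm_sum _ _ _) _.
  have C2 : 0 <= C / 2 ^+ l by rewrite divr_ge0 ?exprn_ge0 ?(ltW C0).
  apply: (@le_trans _ _ (\sum_s C / 2 ^+ l * P s)); last first.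
    by rewrite -mulr_sumr ler_piMr.
  apply: ler_sum => s _; apply: sqr_le_norm; first by rewrite mulr_ge0.
  have [Gl _] := Gf l; apply: le_trans (op_bound_form _ _ Gl) _.
  by rewrite -/(P s) [leRHS]exprMn -expr2.
have S2 l : `|S l| <= (N l)%:R * (mu * (C ^+ 2 + 1)).
  have [_ [a [b [an bn Gab]]]] := Gf l.
  pose dot (c : Y -> R) s := \sum_x c x * ind s x.
  have dotP (c : Y -> R) : \sum_s dot c s ^+ 2 <= mu * norm2 c.
    apply: (@le_trans _ _ (\sum_s mu * \sum_(x | p0 x == s) c x ^+ 2)); last first.
      by rewrite -mulr_sumr /norm2 [X in _ <= _ * X](partition_big p0 predT).
    apply: ler_sum => s _.
    have -> : dot c s = \sum_(x | p0 x == s) c x * Num.sqrt (m x).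
      rewrite /dot [RHS]big_mkcond /=; apply: eq_bigr => x _; rewrite /ind.
      by case: eqP => _; rewrite ?mulr1 ?mulr0.
    apply: le_trans (cauchy_schwarz _ _ _) _; rewrite mulrC ler_wpM2r //.
      by apply: sumr_ge0 => x _; exact: sqr_ge0.
    apply: le_trans (Pmu s); rewrite PE; apply: ler_sum => x _.
    by rewrite sqr_sqrtr.
  have SE : S l = \sum_(j < N l) \sum_s dot (a j) s * dot (b j) s.
    rewrite /S [RHS]exchange_big /=; apply: eq_bigr => s _.
    rewrite /dot; under [RHS]eq_bigr do rewrite mulr_suml.
    rewrite [RHS]exchange_big /=; apply: eq_bigr => x _.
    under [RHS]eq_bigr do rewrite mulr_sumr.
    rewrite [RHS]exchange_big /=; apply: eq_bigr => y _.
    by rewrite Gab mulr_sumr mulr_suml; apply: eq_bigr => j _; ring.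
  rewrite SE; apply: le_trans (ler_norm_sum _ _ _) _.
  rewrite -[N l in leRHS]card_ord mulr_natl -sumr_const; apply: ler_sum => j _.
  apply: le_trans (ler_norm_sum _ _ _) _.
  apply: (@le_trans _ _ (\sum_s (dot (a j) s ^+ 2 + dot (b j) s ^+ 2))).
    apply: ler_sum => s _; move: (dot _ _) (dot _ _) => u v.
    by rewrite ler_norml; apply/andP; split; nra.
  rewrite big_split /= mulrDr mulr1; apply: lerD; apply: le_trans (dotP _) _.
    rewrite ler_wpM2l ?(ltW mu0) //; apply: le_trans (an _) _.
    rewrite lerXn2r ?nnegrE ?divr_ge0 ?exprn_ge0 ?(ltW C0) //.
    by rewrite ler_pdivrMr ?exprn_gt0 // ler_peMr ?(ltW C0) // exprn_ege1 // ler1n.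
  by rewrite -[leRHS]mulr1 ler_wpM2l ?(ltW mu0).
pose E := C * (2 / 3) ^+ m0 + mu * V.
have t0 : 0 <= 3 / 4 :> R by lra.
have t1 : 3 / 4 < 1 :> R by lra.
have CE0 : 0 <= C * (2 / 3) ^+ m0.
  by apply: mulr_ge0; [exact: ltW | apply: exprn_ge0; lra].
have mV0 : 0 <= mu * V by apply: mulr_ge0 => //; exact: ltW.
have E0 : 0 <= E by exact: addr_ge0.
(* 1/2 = 2/3 * 3/4: the first factor is small beyond m0, the second summable. *)
have SE l : `|S l| <= E * (3 / 4) ^+ l.
  have p34 : 0 <= (3 / 4) ^+ l :> R by exact: exprn_ge0.
  have [le|lt] := leqP m0 l.
    apply: (@le_trans _ _ (C * (2 / 3) ^+ m0 * (3 / 4) ^+ l)); last first.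
      by rewrite ler_wpM2r // lerDl.
    apply: le_trans (S1 l) _.
    have -> : C / 2 ^+ l = C * (2 / 3) ^+ l * (3 / 4) ^+ l.
      rewrite -mulrA -exprMn; have -> : 2 / 3 * (3 / 4) = 2^-1 :> R by lra.
      by rewrite exprVn.
    rewrite ler_wpM2r // ler_wpM2l ?(ltW C0) // ler_wiXn2l //; lra.
  apply: (@le_trans _ _ (mu * V * (3 / 4) ^+ l)); last first.
    by rewrite ler_wpM2r // lerDr.
  apply: le_trans (S2 l) _; rewrite mulrCA -mulrA ler_wpM2l ?(ltW mu0) //.
  rewrite /V mulrC -!mulrA ler_wpM2l ?addr_ge0 ?sqr_ge0 //.
  have NA : (N l)%:R <= A.
    by rewrite ler_nat (bigD1 (Ordinal lt)) //= leq_addr.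
  rewrite -[leLHS]mulr1; apply: ler_pM => //.
  have -> : (3 / 4) ^+ l = (4 / 3) ^- l :> R.
    by rewrite -exprVn; congr (_ ^+ _); lra.
  rewrite ler_pdivlMr ?exprn_gt0 ?mul1r //; last lra.
  by rewrite ler_weXn2l ?(ltnW lt) //; lra.
rewrite massE; apply: le_trans (ler_norm _) _; apply: le_trans (ler_norm_sum _ _ _) _.
apply: (@le_trans _ _ (\sum_(l < M) E * (3 / 4) ^+ l)); first by apply: ler_sum => l _.
rewrite -mulr_sumr.
apply: (@le_trans _ _ (E * 4)).
  rewrite ler_wpM2l //; apply: le_trans (sum_geometric M t0 t1) _.
  have -> : 1 - 3 / 4 = 4^-1 :> R by lra.
  by rewrite invrK.
have h1 : C * (2 / 3) ^+ m0 <= e / 8.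
  apply: le_trans (ler_wpM2l (ltW C0) m0P) _.
  by apply: le_of_eq; field; rewrite lt0r_neq0.
have h2 : mu * V <= e / 8.
  rewrite /mu mulrAC ler_pdivrMr //.
  have -> : e / 8 * (8 * (V + 1)) = e * V + e by field.
  by rewrite lerDl ltW.
rewrite /E; lra.
Qed.

End Diagonal.

(** Enumerate A and colour by the index modulo n; the factors 2 absorb the rounding. *)
Lemma equidistributed_colouring (X : finType) (A : {set X}) (n : nat) :
  (0 < n)%N -> (n <= #|A|)%N ->
  exists chi : X -> 'I_n, forall i,
    (#|A| <= 2 * n * #|[set y in A | chi y == i]|)%N /\
    (n * #|[set y in A | chi y == i]| <= 2 * #|A|)%N.
Proof.
case: n => // n _ nA.
pose chi y : 'I_n.+1 := inord (index y (enum A) %% n.+1).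
have chiE y : chi y = (index y (enum A) %% n.+1)%N :> nat.
  by rewrite inordK // ltn_mod.
exists chi => i; set S := [set y in A | chi y == i].
pose d := (#|A| %/ n.+1)%N.
have sz : size (enum A) = #|A| by rewrite cardE.
have [x0 _] : exists x0, x0 \in A by apply/card_gt0P; exact: leq_trans nA.
have lo : (d <= #|S|)%N.
  have lt (t : 'I_d) : (t * n.+1 + i < #|A|)%N.
    have := ltn_ord t; have := ltn_ord i; rewrite /d => ii.
    by have := leq_divM #|A| n.+1; nia.
  pose g (t : 'I_d) := nth x0 (enum A) (t * n.+1 + i).
  have g_inj : injective g.
    move=> t t' /eqP; rewrite nth_uniq ?sz ?lt ?enum_uniq // => /eqP e.
    by apply: val_inj => /=; nia.
  rewrite -[d]card_ord -(card_imset _ g_inj); apply: subset_leq_card.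
  apply/subsetP => y /imsetP[t _ ->]; rewrite inE.
  rewrite -mem_enum mem_nth ?sz ?lt //= -val_eqE /= chiE index_uniq ?sz ?lt ?enum_uniq //.
  by rewrite modnMDl modn_small.
have hi : (#|S| <= d.+1)%N.
  pose g y : 'I_d.+1 := inord (index y (enum A) %/ n.+1).
  have gE y : y \in S -> g y = (index y (enum A) %/ n.+1)%N :> nat.
    rewrite inE => /andP[yA _]; rewrite inordK // ltnS leq_div2r // -sz ltnW //.
    by rewrite index_mem mem_enum.
  have g_inj : {in S &, injective g}.
    move=> y y' yS y'S /(congr1 val) /=; rewrite !gE // => eq_div.
    move: (yS) (y'S); rewrite !inE => /andP[yA /eqP cy] /andP[y'A /eqP cy'].
    have eq_idx : index y (enum A) = index y' (enum A).
      rewrite (divn_eq (index y (enum A)) n.+1) (divn_eq (index y' (enum A)) n.+1).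
      by rewrite eq_div -!chiE cy cy'.
    rewrite -(nth_index x0 (s := enum A) (x := y)) ?mem_enum // eq_idx.
    by rewrite nth_index // mem_enum.
  by rewrite -(card_in_imset g_inj) -[leqRHS]card_ord max_card.
have := divn_eq #|A| n.+1; have := ltn_pmod #|A| (ltn0Sn n); rewrite -/d.
have d1 : (0 < d)%N by rewrite divn_gt0.
have h1 := leq_mul (leqnn n.+1) lo; have h2 := leq_mul (leqnn n.+1) hi.
have h3 := leq_mul (leqnn n.+1) d1.
by move=> h4 h5; split; nia.
Qed.

(** * Removal for families, and for distinct points *)

Section Conclude.
Variables (R : realType) (k : nat) (eps : R).

Section General.
Variables (X : 'I_k -> finProbSpace R) (Y : finType) (m : Y -> R).
Variables (io : forall i, X i -> Y).
Hypotheses (io_inj : forall i, injective (io (i := i)))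
           (mio : forall i x, m (io (i := i) x) = mass x).
Variable (f : forall i, X i * X (ordS i) -> R).
Hypothesis f0 : forall i (z : X i * X (ordS i)), 0 <= f z.

Lemma edge_sets_of_removal (E : 'I_k -> Y -> pred Y) :
  (forall i, mass_on m (push_cycle io f i) (fun y y' => ~~ E i y y') <= eps) ->
  (forall x : forall i, X i, ~ (forall i, E i (io (x i)) (io (x (ordS i))))) ->
  exists E' : forall i, {set X i * X (ordS i)},
    (forall i, L1norm (fun z => f z * (z \in ~: E' i)%:R) <= eps) /\
    cycle_mean (fun i z => (z \in E' i)%:R : R) = 0.
Proof.
move=> Em Ex.
exists (fun i => [set z | E i (io z.1) (io z.2)]); split => [i|].
  apply: le_trans (Em i).
  rewrite (mass_on_push (@mio i) (@mio (ordS i))) //.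
  apply: le_of_eq; apply: eq_bigr => z _.
  by rewrite !inE.
rewrite /cycle_mean /expect big1 // => x _.
have [/forallP all|] := boolP [forall i, E i (io (x i)) (io (x (ordS i)))].
  by have := Ex (fun i => x i) all.
rewrite negb_forall => /existsP[i /negPf Ei].
by rewrite (bigD1 i) //= inE /= Ei mul0r mulr0.
Qed.

End General.

Section DisjointUnion.
Variable X : 'I_k -> finProbSpace R.

(** Each copy keeps its own probability measure, so the total mass is k. *)
Definition union_mass (y : {i : 'I_k & X i}) : R := mass (tagged y).

Lemma Tagged_inj (i : 'I_k) : injective (fun x : X i => Tagged (fun i => X i) x).
Proof. by move=> x x' /eqP; rewrite eq_Tagged => /eqP. Qed.

Lemma sum_union_mass : \sum_y union_mass y = k%:R.
Proof.
rewrite /union_mass -(sig_big_dep xpredT (fun _ => xpredT)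
  (fun i (x : X i) => mass x)) /=.
by under eq_bigr do rewrite mass_sum1; rewrite sumr_const card_ord.
Qed.

Lemma sum_union_tag (i : 'I_k) : \sum_(y | tag y == i) union_mass y = 1.
Proof.
rewrite -(mass_sum1 (X i)).
transitivity (\sum_(j | j == i) \sum_(x : X j) mass x); last by rewrite big_pred1_eq.
rewrite (sig_big_dep (pred1 i) (fun _ => xpredT) (fun i (x : X i) => mass x)) /=.
by apply: eq_bigl => y; rewrite andbT.
Qed.

End DisjointUnion.

Lemma measure_uniform (X : finProbSpace R) (A : pred X) : uniform X ->
  measure (fun x : X => mass x) A * #|X|%:R = #|[set y | A y]|%:R.
Proof.
move=> uX; have [X0|X0] := posnP #|X|.
  have -> : [set y | A y] = set0.
    by apply/setP => y; have := card0_eq X0 y; rewrite inE.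
  by rewrite X0 mulr0 cards0.
rewrite /measure (eq_bigr (fun _ => #|X|%:R^-1)); last by move=> y _; exact: uX.
by rewrite sumr_const -[_ *+ _]mulr_natl divfK ?pnatr_eq0 -?lt0n // cardsE.
Qed.

(** Colour each cell by the k indices evenly and let A i be the part of colour i of the
    i-th cell.  These sets are disjoint even if the cells coincide, so only tuples of
    distinct points are counted. *)
Lemma removable_distinct (X : finProbSpace R) (f : 'I_k -> X * X -> R) delta tau :
  (2 <= k)%N -> uniform X -> (forall i z, 0 <= f i z) ->
  k%:R <= tau * #|X|%:R ->
  removable eps (fun x : X => mass x)
    (push_cycle (X := fun _ : 'I_k => X) (fun _ x => x) f) delta tau ->
  distinct_cycle_mean f <= delta ->
  exists E : 'I_k -> {set X * X},
    (forall i, L1norm (fun z => f i z * (z \in ~: E i)%:R) <= eps) /\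
    cycle_mean (X := fun _ => X) (fun i z => (z \in E i)%:R : R) = 0.
Proof.
move=> k2 uX f0 large [T [q [E [Em Ex]]]] cnt.
have k0 : (0 < k)%N by apply: leq_trans k2.
have kR : 0 < k%:R :> R by rewrite ltr0n.
pose XX := (fun _ : 'I_k => X).
suff nocycle (x : 'I_k -> X) : ~ (forall i, E i (x i) (x (ordS i))).
  have [E' [E'm E'0]] := @edge_sets_of_removal XX X (fun x => mass x) (fun _ x => x)
    (fun _ _ => erefl) f f0 E Em nocycle.
  by exists E'.
move=> /(Ex x)[qt count].
have X0 : 0 < #|X|%:R :> R.
  by rewrite ltr0n; apply/card_gt0P; exists (x (Ordinal k0)).
have measureE := measure_uniform (X := X) ^~ uX.
have chiP (s : T) : exists chi : X -> 'I_k, (k <= #|[set y | q y == s]|)%N ->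
    forall i, (#|[set y | q y == s]| <= 2 * k *
       #|[set y in [set y | q y == s] | chi y == i]|)%N.
  have [le|lt] := leqP k #|[set y | q y == s]|; last by exists (fun _ => Ordinal k0).
  have [chi chiP] := equidistributed_colouring k0 le.
  by exists chi => _ i; have [] := chiP i.
have [chi {}chiP] := fin_all_exists chiP.
pose A i : pred X := fun y => cell q (x i) y && (chi (q y) y == i).
have card_cell i : (k <= #|[set y | cell q (x i) y]|)%N.
  rewrite -(ler_nat R); apply: le_trans large _; rewrite -measureE.
  by rewrite ler_wpM2r ?(ltW X0) // qt.
have Acell i : measure (fun x : X => mass x) (cell q (x i)) <=
    2 * k%:R * measure (fun x : X => mass x) (A i).
  rewrite -(ler_pM2r X0) -(mulrA (2 * k%:R)) !measureE -!natrM ler_nat.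
  have := chiP (q (x i)) (card_cell i) i.
  suff -> : [set y in [set y | q y == q (x i)] | chi (q (x i)) y == i] =
    [set y | A i y] by [].
  apply/setP => y; rewrite !inE /A /cell.
  by case: eqP => // ->.
have sub i y : A i y -> cell q (x i) y by case/andP.
have := count A sub Acell.
apply/negP; rewrite -leNgt; apply: le_trans cnt.
rewrite cyc_push //; last by move=> i; exact: inj_id.
rewrite /distinct_cycle_mean /expect; apply: ler_sum => z _.
rewrite ler_wpM2l ?mass_ge0 // ler_wpM2r //.
  by apply: prodr_ge0 => i _; exact: f0.
case: (boolP (injectiveb z)) => [_|ninj].
  apply: prodr_ile1 => i _.
  by case: (A i _); case: (A (ordS i) _); rewrite /= ?(mulr0, mulr1) ?ler01 ?lexx.
have [/forallP all|] := boolP [forall i, A i (z i)].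
  case/injectiveP: ninj => i i' zz.
  have /andP[_ /eqP ci] := all i; have /andP[_ /eqP ci'] := all i'.
  by rewrite -[LHS]ci zz ci'.
rewrite negb_forall => /existsP[i /negPf Ai].
by rewrite (bigD1 i) //= Ai !mul0r.
Qed.

End Conclude.

Section Assembly.
Variables (R : realType) (k : nat) (q : 'I_k -> R) (eps K C r : R).
Hypotheses (k2 : (2 <= k)%N) (q1 : forall i, 1 <= q i).
Hypotheses (eps0 : 0 < eps) (K0 : 0 < K) (C0 : 0 < C) (r0 : 0 < r) (r1 : r < 1).
Hypothesis decay : layers_decay C (4 * C) r (fun i => layer_rank (q i)).

Let q0 i : 0 < q i. Proof. exact: lt_le_trans (q1 i). Qed.

(** The spaces sit side by side in their disjoint union, and the initial partition
    separates them. *)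
Lemma removal_general : exists delta tau : R,
  [/\ 0 < delta, 0 < tau &
  forall (X : 'I_k -> finProbSpace R) (f : forall i, X i * X (ordS i) -> R),
    (forall i z, 0 <= f i z) ->
    (forall i, schatten (q i) (f i) <= C) ->
    (forall i (P : {set {set X i}}) (Q : {set {set X (ordS i)}}),
       partition_ge tau P -> partition_ge tau Q ->
       L1norm (fun z => f i z * (K < cond_exp (f i) P Q z)%R%:R) <= eps / 4) ->
    cycle_mean f <= delta ->
    exists E : forall i, {set X i * X (ordS i)},
      (forall i, L1norm (fun z => f i z * (z \in ~: E i)%:R) <= eps) /\
      cycle_mean (fun i z => (z \in E i)%:R : R) = 0].
Proof.
have k0 : (0 < k)%N by apply: leq_trans k2.
have kR : 0 < k%:R :> R by rewrite ltr0n.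
have [delta [tau [delta0 tau0 core]]] :=
  removal_core k2 C0 (mulr_gt0 (ltr0n R 4) C0) r0 r1 decay kR ltr01 eps0 K0 k0.
exists delta, tau; split => // X f f0 fC large cnt.
pose Y := {i : 'I_k & X i}.
pose m : Y -> R := @union_mass R k X.
pose io i (x : X i) : Y := Tagged (fun i => X i) x.
pose F := push_cycle (Y := Y) io f.
have m0 y : 0 <= m y by exact: mass_ge0.
have io_inj i : injective (@io i) by exact: Tagged_inj.
have mio i x : m (@io i x) = mass x by [].
have adm : admissible C (fun i => layer_rank (q i)) k%:R 1 m (fun y : Y => tag y) F.
  split => //.
  - by rewrite sum_union_mass.
  - by move=> y; rewrite /measure /cell sum_union_tag.
  - by move=> i y y'; apply: push_pair_ge0 => z; exact: f0.
  - move=> i; exact: (tame_push_pair (@io_inj i) (@mio i) (@io_inj (ordS i))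
      (@mio (ordS i)) (schatten_tame (q0 i) C0 (fC i))).
have lgF : few_large eps K m (fun y : Y => tag y) F tau.
  move=> T p ptag pt i.
  have cl j (y : Y) (x : X j) : p y = p (@io j x) -> exists u, y = @io j u.
    move=> /ptag /=; case: y => j' u /= e; subst j'; by exists u.
  rewrite (mass_on_push (@mio i) (@mio (ordS i))); last exact: f0.
  have := large i _ _ (fibres_ge (@io_inj i) (@mio i) (@cl i) pt)
    (fibres_ge (@io_inj (ordS i)) (@mio (ordS i)) (@cl (ordS i)) pt).
  apply: le_trans; apply: le_of_eq; apply: eq_bigr => -[x x'] _.
  by rewrite /= /F /push_cycle (average_push (@io_inj i) (@mio i) (@io_inj (ordS i))
    (@mio (ordS i)) _ _ _ (@cl i) (@cl (ordS i))).
have card_k : (#|'I_k| <= k)%N by rewrite card_ord.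
have [T [p [E [Em Ex]]]] := core Y m _ (fun y : Y => tag y) F adm card_k lgF.
apply: (edge_sets_of_removal mio f0 Em) => x Exx.
have [_ count] := Ex (fun i => io i (x i)) Exx.
have whole i : measure m (cell p (io i (x i))) <=
    2 * k%:R * measure m (cell p (io i (x i))).
  rewrite ler_peMl ?measure_ge0 // -natrM ler1n muln_gt0 k0 //.
have := count (fun i => cell p (io i (x i))) (fun _ _ h => h) whole.
apply/negP; rewrite -leNgt; apply: le_trans cnt.
rewrite (cyc_push io_inj mio) /cycle_mean /expect; apply: ler_sum => z _.
rewrite ler_wpM2l ?mass_ge0 // ler_piMl //.
  by apply: prodr_ge0 => i _; exact: f0.
apply: prodr_ile1 => i _.
by case: (cell _ _ _); case: (cell _ _ _); rewrite /= ?(mulr0, mulr1) ?ler01 ?lexx.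
Qed.

Lemma mem_diag_fibres (X : finProbSpace R) (T : finType) (p : X -> T) z :
  (z \in diag (fibres (fun x : X => x) p)) = (p z.1 == p z.2).
Proof.
have part : partition (fibres (fun x : X => x) p) [set: X] by exact: preim_partitionP.
have fib x : x \in pblock (fibres (fun x : X => x) p) x by rewrite mem_fibre.
apply/bigcupP/idP => [[A AP]|pz].
  rewrite inE => /andP[z1 z2]; rewrite eq_sym -(mem_fibre (fun x : X => x) p).
  by have /and3P[_ triv _] := part; rewrite (def_pblock triv AP z1).
exists (pblock (fibres (fun x : X => x) p) z.1); last first.
  by rewrite inE fib /= mem_fibre eq_sym.
by rewrite pblock_mem // (cover_partition part) inE.
Qed.

Lemma uniform_admissible (X : finProbSpace R) (T0 : finType) (p0 : X -> T0) (tau0 : R)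
    (f : 'I_k -> X * X -> R) :
  (forall i z, 0 <= f i z) -> (forall i, schatten (q i) (f i) <= C) ->
  (forall x, tau0 <= measure (fun x : X => mass x) (cell p0 x)) ->
  admissible C (fun i => layer_rank (q i)) 1 tau0 (fun x : X => mass x) p0
    (push_cycle (X := fun _ : 'I_k => X) (fun _ x => x) f).
Proof.
move=> f0 fC p0t; split => //.
- exact: mass_ge0.
- by rewrite mass_sum1.
- by move=> i y y'; apply: push_pair_ge0 => z; exact: f0.
- move=> i; have idm (x : X) : mass x = mass x by [].
  exact: (tame_push_pair (m := fun x : X => mass x) (@inj_id X) idm (@inj_id X) idm
    (schatten_tame (q0 i) C0 (fC i))).
Qed.

Lemma large_size (tau : R) (X : finProbSpace R) : 0 < tau ->
  (Num.bound (k%:R / tau) <= #|X|)%N -> k%:R <= tau * #|X|%:R.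
Proof.
move=> tau0 XN; rewrite -ler_pdivrMl // mulrC.
apply: le_trans (ltW (archi_boundP _)) _; first by rewrite divr_ge0 // ltW.
by rewrite ler_nat.
Qed.

(** The initial partition is trivial, and a lower bound on the size of X makes the cells
    large enough to be divided among k colours. *)
Lemma removal_uniform : exists (delta tau : R) (N : nat),
  [/\ 0 < delta, 0 < tau &
  forall X : finProbSpace R, uniform X -> (N <= #|X|)%N ->
  forall f : 'I_k -> X * X -> R,
    (forall i z, 0 <= f i z) ->
    (forall i, schatten (q i) (f i) <= C) ->
    (forall i (P : {set {set X}}), partition_ge tau P ->
       L1norm (fun z => f i z * (K < cond_exp (f i) P P z)%R%:R) <= eps / 4) ->
    distinct_cycle_mean f <= delta ->
    exists E : 'I_k -> {set X * X},
      (forall i, L1norm (fun z => f i z * (z \in ~: E i)%:R) <= eps) /\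
      cycle_mean (X := fun _ => X) (fun i z => (z \in E i)%:R : R) = 0].
Proof.
have [delta [tau [delta0 tau0 core]]] :=
  removal_core k2 C0 (mulr_gt0 (ltr0n R 4) C0) r0 r1 decay ltr01 ltr01 eps0 K0 (ltn0Sn 0).
exists delta, tau, (Num.bound (k%:R / tau)); split => // X uX XN f f0 fC large cnt.
apply: (removable_distinct k2 uX f0 (large_size tau0 XN) _ cnt).
apply: (core _ _ _ (fun _ : X => tt)); last 1 first.
- move=> T p _ pt i.
  have cl (y x : X) : p y = p x -> exists u, y = u by exists y.
  rewrite (mass_on_push (fun _ => erefl) (fun _ => erefl)); last exact: f0.
  have := large i _ (fibres_ge (io := fun x : X => x) (@inj_id X) (fun _ => erefl) cl pt).
  apply: le_trans; apply: le_of_eq; apply: eq_bigr => -[x x'] _.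
  by rewrite /= /push_cycle (average_push (@inj_id X) (fun _ => erefl) (@inj_id X)
    (fun _ => erefl) _ _ _ cl cl).
- apply: uniform_admissible => // x.
  by rewrite -[leLHS](mass_sum1 X) /measure /cell.
- by rewrite card_unit.
Qed.

(** Start from a partition into cells of measure at most mu and at least 1/(2M).  Any
    refinement has its diagonal blocks inside those of the initial partition, so the
    edges in diagonal blocks have mass at most eps / 8 and the hypothesis bounds the
    others. *)
Lemma removal_uniform_diagonal : exists (delta tau : R) (N : nat),
  [/\ 0 < delta, 0 < tau &
  forall X : finProbSpace R, uniform X -> (N <= #|X|)%N ->
  forall f : X * X -> R,
    (forall z, 0 <= f z) ->
    (forall i, schatten (q i) f <= C) ->
    (forall P : {set {set X}}, partition_ge tau P ->
       L1norm (fun z => f z * (K < cond_exp f P P z)%R%:R * (z \in ~: diag P)%:R)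
         <= eps / 8) ->
    distinct_cycle_mean (fun _ : 'I_k => f) <= delta ->
    exists E : 'I_k -> {set X * X},
      (forall i, L1norm (fun z => f z * (z \in ~: E i)%:R) <= eps) /\
      cycle_mean (X := fun _ => X) (fun i z => (z \in E i)%:R : R) = 0].
Proof.
have k0 : (0 < k)%N by apply: leq_trans k2.
have e8 : 0 < eps / 8 by rewrite divr_gt0.
have [mu [mu0 diagonal]] := mass_diagonal (layer_rank (q (Ordinal k0))) C0 e8.
pose M := (Num.bound (2 / mu)).+1.
have M0 : (0 < M)%N by [].
have MR : 0 < M%:R :> R by rewrite ltr0n.
have Mmu : 2 / M%:R <= mu.
  rewrite ler_pdivrMr // mulrC -ler_pdivrMr //.
  apply: le_trans (ltW (archi_boundP _)) _; first by rewrite divr_ge0 // ltW.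
  by rewrite ler_nat.
have t0 : 0 < (2 * M%:R)^-1 :> R by rewrite invr_gt0 mulr_gt0.
have [delta [tau [delta0 tau0 core]]] :=
  removal_core k2 C0 (mulr_gt0 (ltr0n R 4) C0) r0 r1 decay ltr01 t0 eps0 K0 M0.
exists delta, tau, (maxn M (Num.bound (k%:R / tau))); split => // X uX.
rewrite geq_max => /andP[XM XN] f f0 fC large cnt.
apply: (removable_distinct k2 uX (fun _ => f0) (large_size tau0 XN) _ cnt).
have XM' : (M <= #|[set: X]|)%N by rewrite cardsT.
have [p0 p0P] := equidistributed_colouring M0 XM'.
have X0 : 0 < #|X|%:R :> R by rewrite ltr0n (leq_trans M0).
have cell_card x : measure (fun x : X => mass x) (cell p0 x) * #|X|%:R =
    #|[set y in [set: X] | p0 y == p0 x]|%:R.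
  by rewrite measure_uniform //; congr (_%:R); apply: eq_card => y; rewrite !inE.
have p0_lo x : (2 * M%:R)^-1 <= measure (fun x : X => mass x) (cell p0 x).
  rewrite -(ler_pM2r X0) cell_card mulrC ler_pdivrMr ?mulr_gt0 //.
  have [+ _] := p0P (p0 x); rewrite cardsT => h.
  by rewrite mulrC -!natrM ler_nat.
have p0_hi x : measure (fun x : X => mass x) (cell p0 x) <= mu.
  apply: le_trans Mmu; rewrite -(ler_pM2r X0) cell_card mulrAC ler_pdivlMr //.
  have [_ +] := p0P (p0 x); rewrite cardsT => h.
  by rewrite mulrC -!natrM ler_nat.
have adm : admissible C (fun i => layer_rank (q i)) 1 (2 * M%:R)^-1
    (fun x : X => mass x) p0
    (push_cycle (X := fun _ : 'I_k => X) (fun _ x => x) (fun _ => f)).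
  exact: uniform_admissible.
apply: (core _ _ _ p0) => //; first by rewrite card_ord.
have [m0 m1 _ F0 Ft] := adm.
move=> T p pp0 pt i.
have cl (y x : X) : p y = p x -> exists u, y = u by exists y.
pose F := push_pair (fun x : X => x) (fun x : X => x) f.
have F0' x y : 0 <= F x y by exact: F0 i x y.
have onDiag := diagonal X _ F _ p0 m0 m1 F0' (Ft (Ordinal k0)) p0_hi.
have offDiag : mass_on (fun x : X => mass x) F (fun x y =>
    (K < average (fun x : X => mass x) p F x y) && (p x != p y)) <= eps / 8.
  rewrite (mass_on_push (fun _ => erefl) (fun _ => erefl)) //.
  have := large _ (fibres_ge (io := fun x : X => x) (@inj_id X) (fun _ => erefl) cl pt).
  apply: le_trans; apply: le_of_eq; apply: eq_bigr => -[x x'] _.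
  rewrite /= (average_push (@inj_id X) (fun _ => erefl) (@inj_id X)
    (fun _ => erefl) _ _ _ cl cl) inE mem_diag_fibres /=.
  by rewrite -mulrA -natrM mulnb.
apply: (@le_trans _ _ (mass_on (fun x : X => mass x) F (fun x y =>
    (K < average (fun x : X => mass x) p F x y) && (p x != p y)) +
    mass_on (fun x : X => mass x) F (fun x y => p0 x == p0 y))); last lra.
rewrite /mass_on -big_split; apply: ler_sum => x _ /=.
rewrite -big_split; apply: ler_sum => y _ /=.
rewrite -mulrDr ler_wpM2l ?mulr_ge0 ?mass_ge0 // -mulrDr ler_wpM2l // -natrD ler_nat.
have [pxy|pxy] := eqVneq (p x) (p y); last by rewrite /= andbT leq_addr.
by rewrite (pp0 _ _ pxy) eqxx; case: (_ < _).
Qed.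

End Assembly.

Theorem theorem6p1 (R : realType) (k : nat) (hk : (3 <= k)%N)
    (q : 'I_k -> R) (hq : forall i, 1 <= q i)
    (hsum : 1 < \sum_i (q i)^-1)
    (eps K C : R) (heps : 0 < eps) (hK : 0 < K) (hC : 0 < C) :
  exists delta tau : R,
  [/\ 0 < delta,
      0 < tau,
      forall (X : 'I_k -> finProbSpace R)
             (f : forall i, X i * X (ordS i) -> R),
        (forall i z, 0 <= f i z) ->
        (forall i, schatten (q i) (f i) <= C) ->
        (forall i (P : {set {set X i}}) (Q : {set {set X (ordS i)}}),
           partition_ge tau P -> partition_ge tau Q ->
           L1norm (fun z => f i z * (K < cond_exp (f i) P Q z)%R%:R)
             <= eps / 4) ->
        cycle_mean f <= delta ->
        exists E : forall i, {set X i * X (ordS i)},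
          (forall i, L1norm (fun z => f i z * (z \in ~: E i)%:R) <= eps) /\
          cycle_mean (fun i z => (z \in E i)%:R : R) = 0
    & exists N : nat,
      forall X : finProbSpace R, uniform X -> (N <= #|X|)%N ->
      (forall f : 'I_k -> X * X -> R,
        (forall i z, 0 <= f i z) ->
        (forall i, schatten (q i) (f i) <= C) ->
        (forall i (P : {set {set X}}), partition_ge tau P ->
           L1norm (fun z => f i z * (K < cond_exp (f i) P P z)%R%:R)
             <= eps / 4) ->
        distinct_cycle_mean f <= delta ->
        exists E : 'I_k -> {set X * X},
          (forall i, L1norm (fun z => f i z * (z \in ~: E i)%:R) <= eps) /\
          cycle_mean (X := fun _ => X) (fun i z => (z \in E i)%:R : R) = 0)
      /\
      (forall f : X * X -> R,
        (forall z, 0 <= f z) ->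
        (forall i, schatten (q i) f <= C) ->
        (forall P : {set {set X}}, partition_ge tau P ->
           L1norm (fun z => f z * (K < cond_exp f P P z)%R%:R
                                * (z \in ~: diag P)%:R)
             <= eps / 8) ->
        distinct_cycle_mean (fun _ : 'I_k => f) <= delta ->
        exists E : 'I_k -> {set X * X},
          (forall i, L1norm (fun z => f z * (z \in ~: E i)%:R) <= eps) /\
          cycle_mean (X := fun _ => X) (fun i z => (z \in E i)%:R : R) = 0)].
Proof.
have k2 : (2 <= k)%N by apply: leq_trans hk.
have [r [r0 r1 decay]] := layers_decay_exponents hC hq hsum.
have [d1 [t1 [d10 t10 H1]]] := removal_general k2 hq heps hK hC r0 r1 decay.
have [d2 [t2 [N2 [d20 t20 H2]]]] := removal_uniform k2 hq heps hK hC r0 r1 decay.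
have [d3 [t3 [N3 [d30 t30 H3]]]] := removal_uniform_diagonal k2 hq heps hK hC r0 r1 decay.
have part_le (X : finProbSpace R) (P : {set {set X}}) (t t' : R) :
    t <= t' -> partition_ge t' P -> partition_ge t P.
  by move=> le [Pp Pt]; split => // A /Pt; exact: le_trans.
exists (Num.min d1 (Num.min d2 d3)), (Num.min t1 (Num.min t2 t3)).
split; rewrite ?lt_min ?d10 ?d20 ?d30 ?t10 ?t20 ?t30 //.
  move=> X f f0 fC large cnt; apply: H1 => //.
    by move=> i P Q Pt Qt; apply: large; [apply: part_le Pt | apply: part_le Qt];
      rewrite ge_min lexx.
  by apply: le_trans cnt _; rewrite ge_min lexx.
exists (maxn N2 N3) => X uX; rewrite geq_max => /andP[XN2 XN3]; split.
  move=> f f0 fC large cnt; apply: (H2 X) => //.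
    by move=> i P Pt; apply: large; apply: part_le Pt; rewrite !ge_min lexx !orbT.
  by apply: le_trans cnt _; rewrite !ge_min lexx !orbT.
move=> f f0 fC large cnt; apply: (H3 X) => //.
  by move=> P Pt; apply: large; apply: part_le Pt; rewrite !ge_min lexx !orbT.
by apply: le_trans cnt _; rewrite !ge_min lexx !orbT.
Qed.
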